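(* Let $i\in I$, $\beta\in\mathsf Q_+$, $n=\mathrm{ht}(\beta)$, and let $M$ be a (graded) $R(\beta)$-module. (i) The $\mathbf k$-linear map $J_M:M\to(\mathrm E_iM)\circ_z\langle i\rangle_z$ defined by $$J_M(u)=\sum_{a\in[1,n];\ \nu_a=i}\tau_a\cdots\tau_{n-1}\bigl(r(\tau_1\cdots\tau_{a-1}u)\otimes\langle i\rangle_z\bigr)\qquad\text{for }\nu\in I^\beta,\ u\in e(\nu)M,$$ is $R(\beta)$-linear and homogeneous of degree $(\alpha_i,\mathrm{wt}(M)+\alpha_i)$. Here $\mathbf k[z]$ acts on $\mathrm E_iM$ by $z\cdot r(w)=r(x_1w)$ for $w\in e(i,* )M$. (ii) The composition $$\mathrm E_iM\xrightarrow{\ \mathrm E_i(J_M)\ }\mathrm E_i\bigl((\mathrm E_iM)\circ_z\langle i\rangle_z\bigr)\longrightarrow(\mathrm E_iM)\circ_z(\mathrm E_i\langle i\rangle_z)\simeq\mathrm E_iM$$ is the identity, where the second morphism is the canonical projection from the shuffle lemma.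
   Context: $\mathbf k$ is a field; $(\mathsf c_{j,k})_{j,k\in I}$ is a symmetrizable generalized Cartan matrix with simple roots $\alpha_j$, $\mathsf Q_+=\sum_j\mathbb Z_{\ge0}\alpha_j$, and a symmetric bilinear form with $(\alpha_j,\alpha_j)\in2\mathbb Z_{>0}$, $\mathsf c_{j,k}=2(\alpha_j,\alpha_k)/(\alpha_j,\alpha_j)$. A quiver Hecke datum is a family $Q_{j,k}(u,v)\in\mathbf k[u,v]$ with $Q_{j,j}=0$, $Q_{j,k}(u,v)=Q_{k,j}(v,u)$ and, for $j\neq k$, $Q_{j,k}$ a linear combination of $u^pv^r$ with $p(\alpha_j,\alpha_j)+r(\alpha_k,\alpha_k)=-2(\alpha_j,\alpha_k)$, the coefficient of $u^{-\mathsf c_{j,k}}$ being nonzero. For $\beta\in\mathsf Q_+$ of height $n$ put $I^\beta=\{\nu\in I^n:\sum_k\alpha_{\nu_k}=\beta\}$. $R(\beta)$ is the $\mathbf k$-algebra generated by $e(\nu)$ ($\nu\in I^\beta$), $x_1,\dots,x_n$, $\tau_1,\dots,\tau_{n-1}$ with relations: the $e(\nu)$ are orthogonal idempotents with sum $1$; $x_ke(\nu)=e(\nu)x_k$; $x_kx_l=x_lx_k$; $\tau_le(\nu)=e(s_l\nu)\tau_l$; $\tau_k\tau_l=\tau_l\tau_k$ if $|k-l|>1$; $\tau_l^2e(\nu)=Q_{\nu_l,\nu_{l+1}}(x_l,x_{l+1})e(\nu)$; $(\tau_lx_k-x_{s_l(k)}\tau_l)e(\nu)=(\delta(k=l+1)-\delta(k=l))\delta(\nu_l=\nu_{l+1})e(\nu)$;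 $(\tau_{l+1}\tau_l\tau_{l+1}-\tau_l\tau_{l+1}\tau_l)e(\nu)=\delta(\nu_l=\nu_{l+2})\frac{Q_{\nu_l,\nu_{l+1}}(x_l,x_{l+1})-Q_{\nu_l,\nu_{l+1}}(x_{l+2},x_{l+1})}{x_l-x_{l+2}}e(\nu)$. Grading: $\deg e(\nu)=0$, $\deg x_ke(\nu)=(\alpha_{\nu_k},\alpha_{\nu_k})$, $\deg\tau_le(\nu)=-(\alpha_{\nu_l},\alpha_{\nu_{l+1}})$. For an $R(\beta)$-module $M$, $\mathrm{wt}(M)=-\beta$. $M\circ N=R(\beta+\gamma)e(\beta,\gamma)\otimes_{R(\beta)\otimes R(\gamma)}(M\otimes N)$. $e(i,* )\in R(\beta)$ is the sum of $e(\nu)$ with $\nu_1=i$. $\mathrm E_iM=e(i,* )M$ regarded as an $R(\beta-\alpha_i)$-module; $r:e(i,* )M\to\mathrm E_iM$ denotes the tautological $\mathbf k$-linear bijection (degree $0$), so that $x_kr(u)=r(x_{k+1}u)$, $\tau_lr(u)=r(\tau_{l+1}u)$. $\langle i\rangle_z=R(\alpha_i)=\mathbf k[x_1]$ with $z$ acting by $x_1$; the symbol $\langle i\rangle_z$ inside a tensor denotes its generator $1$. For modules $M,N$ with commuting actions of $z$, $M\circ_zN=\mathrm{Coker}(z\circ\mathrm{id}_N-\mathrm{id}_M\circ z: M\circ N\to M\circ N)$. Shuffle-lemma projection: for an $R(\gamma)$-module $N$ of height $m$ with $\mathbf k[z]$-action, $N\circ_z\langle i\rangle_z=\bigoplus_{a=1}^{m+1}\tau_a\cdots\tau_m(N\otimes\langle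 i\rangle_z)$, and the projection $\mathrm E_i(N\circ_z\langle i\rangle_z)\to N\circ_z(\mathrm E_i\langle i\rangle_z)\simeq N$ sends $\tau_1\cdots\tau_m(v\otimes\langle i\rangle_z)\mapsto v$ and kills the contributions of the terms with $a>1$ (its kernel is the image of $(\mathrm E_iN)\circ_z\langle i\rangle_z$). *)

(* Defs.v *)
From HB Require Import structures.
From mathcomp Require Import all_boot all_order all_algebra.
From mathcomp Require Import finmap multiset boolp zify.

Set Implicit Arguments.
Unset Strict Implicit.
Unset Printing Implicit Defensive.

Import Order.TTheory GRing.Theory Num.Theory.
Local Open Scope mset_scope.
Local Open Scope ring_scope.
Local Open Scope quotient_scope.

(* MathComp's [algType] requires [1 != 0], and that R(beta) is nonzero is only
   known through a basis theorem.  So a K-algebra is represented here by a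
   [pzRingType] with a central ring morphism from K. *)

Section FreeAlgebra.
Variables (K : pzRingType) (G : Type).

Inductive term : Type :=
| TGen of G | TConst of K | TAdd of term & term | TMul of term & term.

Inductive term_eq : term -> term -> Prop :=
| teq_refl t : term_eq t t
| teq_sym t u : term_eq t u -> term_eq u t
| teq_trans t u v : term_eq t u -> term_eq u v -> term_eq t v
| teq_add t t' u u' :
    term_eq t t' -> term_eq u u' -> term_eq (TAdd t u) (TAdd t' u')
| teq_mul t t' u u' :
    term_eq t t' -> term_eq u u' -> term_eq (TMul t u) (TMul t' u')
| teq_addA t u v : term_eq (TAdd t (TAdd u v)) (TAdd (TAdd t u) v)
| teq_addC t u : term_eq (TAdd t u) (TAdd u t)
| teq_add0 t : term_eq (TAdd (TConst 0) t) t
| teq_mulA t u v : term_eq (TMul t (TMul u v)) (TMul (TMul t u) v)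
| teq_mul0 t : term_eq (TMul (TConst 0) t) (TConst 0)
| teq_mul1 t : term_eq (TMul (TConst 1) t) t
| teq_mulDl t u v : term_eq (TMul (TAdd t u) v) (TAdd (TMul t v) (TMul u v))
| teq_mulDr t u v : term_eq (TMul t (TAdd u v)) (TAdd (TMul t u) (TMul t v))
| teq_constD c d : term_eq (TConst (c + d)) (TAdd (TConst c) (TConst d))
| teq_constM c d : term_eq (TConst (c * d)) (TMul (TConst c) (TConst d))
| teq_constC c t : term_eq (TMul (TConst c) t) (TMul t (TConst c)).

HB.instance Definition _ := gen_eqMixin term.
HB.instance Definition _ := gen_choiceMixin term.

Definition term_eqb (t u : term) : bool := `[< term_eq t u >].

Lemma term_eqb_equiv : equiv_class_of term_eqb.
Proof.
split=> [t|t u|u t v].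
- by apply/asboolP; apply: teq_refl.
- by apply/asboolP/asboolP; apply: teq_sym.
- by move=> /asboolP h1 /asboolP h2; apply/asboolP; apply: teq_trans h1 h2.
Qed.
Canonical term_eqb_equivRel := EquivRelPack term_eqb_equiv.

Definition free_alg : Type := {eq_quot term_eqb}.
HB.instance Definition _ := Choice.on free_alg.
HB.instance Definition _ : EqQuotient term term_eqb free_alg :=
  EqQuotient.on free_alg.

Definition fclass (t : term) : free_alg := \pi_free_alg t.
Definition fgen (g : G) : free_alg := fclass (TGen g).
Definition fconst (c : K) : free_alg := fclass (TConst c).

Lemma fclassP t u : fclass t = fclass u <-> term_eq t u.
Proof.
split=> [/eqP|h]; first by rewrite /fclass piE => /asboolP.
by apply/eqP; rewrite /fclass piE; apply/asboolP.
Qed.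

Lemma fclass_repr (a : free_alg) : fclass (repr a) = a.
Proof. exact: reprK. Qed.

Lemma repr_fclass t : term_eq (repr (fclass t)) t.
Proof. by apply/fclassP; rewrite fclass_repr. Qed.

Definition fadd (a b : free_alg) := fclass (TAdd (repr a) (repr b)).
Definition fmul (a b : free_alg) := fclass (TMul (repr a) (repr b)).
Definition fopp (a : free_alg) := fmul (fconst (-1)) a.

Lemma faddE t u : fadd (fclass t) (fclass u) = fclass (TAdd t u).
Proof. by apply/fclassP/teq_add; apply: repr_fclass. Qed.
Lemma fmulE t u : fmul (fclass t) (fclass u) = fclass (TMul t u).
Proof. by apply/fclassP/teq_mul; apply: repr_fclass. Qed.

Lemma fclassW (P : free_alg -> Prop) : (forall t, P (fclass t)) -> forall a, P a.
Proof. by move=> h a; rewrite -(fclass_repr a). Qed.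

Fact faddA : associative fadd.
Proof.
elim/fclassW=> t; elim/fclassW=> u; elim/fclassW=> v.
by rewrite !faddE; apply/fclassP/teq_addA.
Qed.
Fact faddC : commutative fadd.
Proof.
by elim/fclassW=> t; elim/fclassW=> u; rewrite !faddE; apply/fclassP/teq_addC.
Qed.
Fact fadd0 : left_id (fconst 0) fadd.
Proof. by elim/fclassW=> t; rewrite !faddE; apply/fclassP/teq_add0. Qed.
Fact fmulA : associative fmul.
Proof.
elim/fclassW=> t; elim/fclassW=> u; elim/fclassW=> v.
by rewrite !fmulE; apply/fclassP/teq_mulA.
Qed.
Fact fmulC_const c a : fmul (fconst c) a = fmul a (fconst c).
Proof. by elim/fclassW: a => t; rewrite !fmulE; apply/fclassP/teq_constC. Qed.
Fact fmul1l : left_id (fconst 1) fmul.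
Proof. by elim/fclassW=> t; rewrite fmulE; apply/fclassP/teq_mul1. Qed.
Fact fmul1r : right_id (fconst 1) fmul.
Proof. by move=> a; rewrite -fmulC_const fmul1l. Qed.
Fact fmulDl : left_distributive fmul fadd.
Proof.
elim/fclassW=> t; elim/fclassW=> u; elim/fclassW=> v.
by rewrite !(faddE, fmulE); apply/fclassP/teq_mulDl.
Qed.
Fact fmulDr : right_distributive fmul fadd.
Proof.
elim/fclassW=> t; elim/fclassW=> u; elim/fclassW=> v.
by rewrite !(faddE, fmulE); apply/fclassP/teq_mulDr.
Qed.
Fact fconst_add c d : fconst (c + d) = fadd (fconst c) (fconst d).
Proof. by rewrite faddE; apply/fclassP/teq_constD. Qed.
Fact fconst_mul c d : fconst (c * d) = fmul (fconst c) (fconst d).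
Proof. by rewrite fmulE; apply/fclassP/teq_constM. Qed.
Fact faddN : left_inverse (fconst 0) fopp fadd.
Proof.
move=> a; rewrite -[X in fadd _ X]fmul1l -fmulDl -fconst_add addNr.
by elim/fclassW: a => t; rewrite fmulE; apply/fclassP/teq_mul0.
Qed.

HB.instance Definition _ := GRing.isPzRing.Build free_alg
  faddA faddC fadd0 faddN fmulA fmul1l fmul1r fmulDl fmulDr.

Fact fconst_monoid : monoid_morphism fconst.
Proof. by split=> // c d; rewrite fconst_mul. Qed.
Fact fconst_nmod : nmod_morphism fconst.
Proof. by split=> // c d; rewrite fconst_add. Qed.
HB.instance Definition _ :=
  GRing.isNmodMorphism.Build K free_alg fconst fconst_nmod.
HB.instance Definition _ :=
  GRing.isMonoidMorphism.Build K free_alg fconst fconst_monoid.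

Lemma fconst_central c (a : free_alg) : fconst c * a = a * fconst c.
Proof. exact: fmulC_const. Qed.

End FreeAlgebra.

Section ModuleQuotient.
Variables (A : pzRingType) (V : lmodType A) (S : V -> Prop).

Inductive submodule_span : V -> Prop :=
| span_gen v : S v -> submodule_span v
| span_0 : submodule_span 0
| span_sub u v : submodule_span u -> submodule_span v -> submodule_span (u - v)
| span_scale a v : submodule_span v -> submodule_span (a *: v).

Definition in_span : {pred V} := fun v => `[< submodule_span v >].
Fact in_span_zmod : zmod_closed in_span.
Proof.
split=> [|u v]; first by apply/asboolP; apply: span_0.
by move=> /asboolP hu /asboolP hv; apply/asboolP; apply: span_sub.
Qed.
HB.instance Definition _ := GRing.isZmodClosed.Build V in_span in_span_zmod.

Definition mod_quot : Type := (Quotient.quot in_span).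
HB.instance Definition _ := GRing.Zmodule.on mod_quot.

Definition mod_proj (v : V) : mod_quot := \pi_(Quotient.quot in_span) v.

Lemma mod_projP u v : mod_proj u = mod_proj v <-> submodule_span (u - v).
Proof.
split=> [/eqP|h]; first by rewrite -Quotient.idealrBE => /asboolP.
by apply/eqP; rewrite -Quotient.idealrBE; apply/asboolP.
Qed.

Lemma mod_projW (P : mod_quot -> Prop) :
  (forall v, P (mod_proj v)) -> forall w, P w.
Proof. by move=> h w; rewrite -[w](@reprK _ (Quotient.quot in_span)). Qed.

Lemma mod_projB : zmod_morphism mod_proj.
Proof. by move=> u v; rewrite /mod_proj piE. Qed.
HB.instance Definition _ := GRing.isZmodMorphism.Build V mod_quot mod_proj
  mod_projB.

Definition mod_quot_scale (a : A) (w : mod_quot) : mod_quot :=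
  mod_proj (a *: repr (w : (Quotient.quot in_span))).

Lemma mod_quot_scaleE a v : mod_quot_scale a (mod_proj v) = mod_proj (a *: v).
Proof.
apply/mod_projP; rewrite -scalerBr; apply: span_scale; apply/mod_projP.
exact: (@reprK _ (Quotient.quot in_span)).
Qed.

Fact mod_quot_scaleA a b w :
  mod_quot_scale a (mod_quot_scale b w) = mod_quot_scale (a * b) w.
Proof. by elim/mod_projW: w => v; rewrite !mod_quot_scaleE scalerA. Qed.
Fact mod_quot_scale1 : left_id 1 mod_quot_scale.
Proof. by elim/mod_projW=> v; rewrite !mod_quot_scaleE scale1r. Qed.
Fact mod_quot_scaleDr : right_distributive mod_quot_scale +%R.
Proof.
move=> a; elim/mod_projW=> u; elim/mod_projW=> v.
by rewrite -raddfD !mod_quot_scaleE scalerDr raddfD.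
Qed.
Fact mod_quot_scaleDl w : {morph mod_quot_scale^~ w : a b / a + b}.
Proof.
by elim/mod_projW: w => v a b; rewrite !mod_quot_scaleE scalerDl raddfD.
Qed.
HB.instance Definition _ := GRing.Zmodule_isLmodule.Build A mod_quot
  mod_quot_scaleA mod_quot_scale1 mod_quot_scaleDr mod_quot_scaleDl.

Fact mod_proj_scalable : scalable mod_proj.
Proof. by move=> a v; rewrite [RHS]mod_quot_scaleE. Qed.
HB.instance Definition _ := GRing.isScalable.Build A V mod_quot *:%R mod_proj
  mod_proj_scalable.

End ModuleQuotient.

Definition coker (A : pzRingType) (U V : lmodType A) (f : U -> V) : Type :=
  mod_quot (fun v => exists u, v = f u).
HB.instance Definition _ (A : pzRingType) (U V : lmodType A) (f : U -> V) :=
  GRing.Lmodule.on (coker f).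

Section RingQuotient.
Variables (A : pzRingType) (S : A -> Prop).

Inductive ideal_span : A -> Prop :=
| ideal_gen a : S a -> ideal_span a
| ideal_0 : ideal_span 0
| ideal_sub a b : ideal_span a -> ideal_span b -> ideal_span (a - b)
| ideal_mull c a : ideal_span a -> ideal_span (c * a)
| ideal_mulr c a : ideal_span a -> ideal_span (a * c).

Definition in_ideal : {pred A} := fun v => `[< ideal_span v >].
Fact in_ideal_zmod : zmod_closed in_ideal.
Proof.
split=> [|u v]; first by apply/asboolP; apply: ideal_0.
by move=> /asboolP hu /asboolP hv; apply/asboolP; apply: ideal_sub.
Qed.
HB.instance Definition _ := GRing.isZmodClosed.Build A in_ideal in_ideal_zmod.

Definition ring_quot : Type := (Quotient.quot in_ideal).
HB.instance Definition _ := GRing.Zmodule.on ring_quot.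

Definition ring_proj (v : A) : ring_quot := \pi_(Quotient.quot in_ideal) v.

Lemma ring_projP u v : ring_proj u = ring_proj v <-> ideal_span (u - v).
Proof.
split=> [/eqP|h]; first by rewrite -Quotient.idealrBE => /asboolP.
by apply/eqP; rewrite -Quotient.idealrBE; apply/asboolP.
Qed.

Lemma ring_projW (P : ring_quot -> Prop) :
  (forall v, P (ring_proj v)) -> forall w, P w.
Proof. by move=> h w; rewrite -[w](@reprK _ (Quotient.quot in_ideal)). Qed.

Lemma ring_projB : zmod_morphism ring_proj.
Proof. by move=> u v; rewrite /ring_proj piE. Qed.
HB.instance Definition _ := GRing.isZmodMorphism.Build A ring_quot ring_proj
  ring_projB.

Definition ring_repr (w : ring_quot) : A := repr (w : (Quotient.quot in_ideal)).
Lemma ring_reprK w : ring_proj (ring_repr w) = w.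
Proof. exact: (@reprK _ (Quotient.quot in_ideal)). Qed.

Definition ring_quot_mul (u v : ring_quot) : ring_quot :=
  ring_proj (ring_repr u * ring_repr v).
Lemma ring_quot_mulE a b :
  ring_quot_mul (ring_proj a) (ring_proj b) = ring_proj (a * b).
Proof.
apply/ring_projP.
set a' := ring_repr _; set b' := ring_repr _.
have -> : a' * b' - a * b = a' * (b' - b) - (a - a') * b.
  by rewrite mulrBr mulrBl opprB addrA subrK.
by apply: ideal_sub; [apply: ideal_mull | apply: ideal_mulr];
   apply/ring_projP; rewrite ring_reprK.
Qed.
Fact ring_quot_mulA : associative ring_quot_mul.
Proof.
elim/ring_projW=> a; elim/ring_projW=> b; elim/ring_projW=> c.
by rewrite !ring_quot_mulE mulrA.
Qed.
Fact ring_quot_mul1l : left_id (ring_proj 1) ring_quot_mul.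
Proof. by elim/ring_projW=> a; rewrite ring_quot_mulE mul1r. Qed.
Fact ring_quot_mul1r : right_id (ring_proj 1) ring_quot_mul.
Proof. by elim/ring_projW=> a; rewrite ring_quot_mulE mulr1. Qed.
Fact ring_quot_mulDl : left_distributive ring_quot_mul +%R.
Proof.
elim/ring_projW=> a; elim/ring_projW=> b; elim/ring_projW=> c.
by rewrite -raddfD !ring_quot_mulE mulrDl raddfD.
Qed.
Fact ring_quot_mulDr : right_distributive ring_quot_mul +%R.
Proof.
elim/ring_projW=> a; elim/ring_projW=> b; elim/ring_projW=> c.
by rewrite -raddfD !ring_quot_mulE mulrDr raddfD.
Qed.
HB.instance Definition _ := GRing.Zmodule_isPzRing.Build ring_quot
  ring_quot_mulA ring_quot_mul1l ring_quot_mul1r ring_quot_mulDl ring_quot_mulDr.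

Fact ring_proj_monoid : monoid_morphism ring_proj.
Proof. by split=> // a b; rewrite -ring_quot_mulE. Qed.
HB.instance Definition _ :=
  GRing.isMonoidMorphism.Build A ring_quot ring_proj ring_proj_monoid.

End RingQuotient.

(* A polynomial q(u,v) = sum_{p,r} q_{p,r} u^p v^r is an element of
   [{poly {poly K}}] with q_{p,r} = q`_r`_p: the inner variable is u, the
   outer one is v.  The argument [c] is the structure map K -> A. *)

Definition bieval (K : nzRingType) (A : pzRingType) (c : K -> A)
    (q : {poly {poly K}}) (a b : A) : A :=
  \sum_(r < size q) \sum_(p < size q`_r) c q`_r`_p * (a ^+ p * b ^+ r).

(* (q(a1,b) - q(a2,b)) / (a1 - a2), computed as a polynomial *)
Definition bidiff (K : nzRingType) (A : pzRingType) (c : K -> A)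
    (q : {poly {poly K}}) (a1 a2 b : A) : A :=
  \sum_(r < size q) \sum_(p < size q`_r)
    c q`_r`_p * ((\sum_(s < p) a1 ^+ (p.-1 - s) * a2 ^+ s) * b ^+ r).

Lemma bidiffP (K : nzRingType) (A : pzRingType) (c : K -> A)
    (q : {poly {poly K}}) (a1 a2 b : A) :
  (forall d a, c d * a = a * c d) -> GRing.comm a1 a2 ->
  (a1 - a2) * bidiff c q a1 a2 b = bieval c q a1 b - bieval c q a2 b.
Proof.
move=> cC a12; rewrite /bidiff /bieval -sumrB mulr_sumr.
apply: eq_bigr => r _; rewrite -sumrB mulr_sumr; apply: eq_bigr => p _.
by rewrite -mulrBr -mulrBl subrXX_comm // mulrA -cC -!mulrA.
Qed.

Record cartan_datum (I : eqType) : Type := CartanDatum {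
  cartan : I -> I -> int;
  root_form : I -> I -> int;
  cartan_diag : forall j, cartan j j = 2;
  cartan_offdiag : forall j k, j != k -> cartan j k <= 0;
  cartan_zero : forall j k, cartan j k = 0 -> cartan k j = 0;
  form_sym : forall j k, root_form j k = root_form k j;
  form_diag : forall j, exists2 m : nat, (0 < m)%N & root_form j j = (2 * m)%:Z;
  form_cartan : forall j k, cartan j k * root_form j j = 2 * root_form j k
}.

Record qh_datum (K : fieldType) (I : eqType) (C : cartan_datum I) : Type :=
    QHDatum {
  qpol : I -> I -> {poly {poly K}};
  qpol_diag : forall j, qpol j j = 0;
  qpol_sym : forall j k, qpol j k = swapXY (qpol k j);
  qpol_homog : forall j k p r, j != k -> (qpol j k)`_r`_p != 0 ->
    p%:Z * root_form C j j + r%:Z * root_form C k k = - 2 * root_form C j k;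
  (* the coefficient of u^{- c_{j,k}} v^0 *)
  qpol_lead : forall j k, j != k -> (qpol j k)`_0`_(absz (cartan C j k)) != 0
}.

(* The positive cone Q_+ is [{mset I}], so that ht(beta) = [size beta] and
   I^beta consists of the sequences nu with [seq_mset nu = beta].
   Positions are numbered from 1; "nu_l = j and nu_{l+1} = k" is expressed by
   nu = s ++ j :: k :: t with l = (size s).+1. *)

Definition wseqs (I : choiceType) (beta : {mset I}) : seq (seq I) :=
  permutations (beta : seq I).

Lemma mem_wseqs (I : choiceType) (beta : {mset I}) nu :
  (nu \in wseqs beta) = (seq_mset nu == beta).
Proof.
rewrite mem_permutations; apply/idP/eqP => [/eq_seq_msetP ->|<-].
  exact: seq_mset_id.
by rewrite perm_sym perm_eq_seq_mset.
Qed.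

Definition swap_at (l k : nat) : nat :=
  if k == l then l.+1 else if k == l.+1 then l else k.

Inductive qgen (I : Type) : Type := GE of seq I | GX of nat | GT of nat.
Arguments GX {I}. Arguments GT {I}.

Section QuiverHecke.
Variables (K : fieldType) (I : choiceType) (C : cartan_datum I).
Variables (D : qh_datum K C) (beta : {mset I}).

Local Notation F := (free_alg K (qgen I)).
Local Notation e nu := (fgen K (GE nu) : F).
Local Notation x k := (fgen K (GX k) : F).
Local Notation tau l := (fgen K (GT l) : F).
Local Notation n := (size beta).

(* The symbols e(nu), x_k, tau_l are available for all nu, k, l, and are set to
   0 when they do not belong to the presentation of R(beta). *)
Inductive qrel : F -> Prop :=
| qrel_e_out nu : seq_mset nu != beta -> qrel (e nu)
| qrel_x_out k : ~~ (1 <= k <= n)%N -> qrel (x k)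
| qrel_t_out l : ~~ (1 <= l < n)%N -> qrel (tau l)
| qrel_ee nu mu : qrel (e nu * e mu - (if nu == mu then e nu else 0))
| qrel_e1 : qrel (\sum_(nu <- wseqs beta) e nu - 1)
| qrel_xe k nu : qrel (x k * e nu - e nu * x k)
| qrel_xx k l : qrel (x k * x l - x l * x k)
| qrel_te s i j t : let l := (size s).+1 in
    qrel (tau l * e (s ++ [:: i, j & t]) - e (s ++ [:: j, i & t]) * tau l)
| qrel_tt k l : (k.+1 < l)%N || (l.+1 < k)%N ->
    qrel (tau k * tau l - tau l * tau k)
| qrel_t2 s i j t : let l := (size s).+1 in let nu := s ++ [:: i, j & t] in
    qrel (tau l ^+ 2 * e nu
          - bieval (@fconst K _) (qpol D i j) (x l) (x l.+1) * e nu)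
| qrel_tx s i j t k : let l := (size s).+1 in let nu := s ++ [:: i, j & t] in
    qrel ((tau l * x k - x (swap_at l k) * tau l) * e nu
          - ((k == l.+1)%:R - (k == l)%:R) * (i == j)%:R * e nu)
| qrel_braid s i j i' t :
    let l := (size s).+1 in let nu := s ++ [:: i, j, i' & t] in
    qrel ((tau l.+1 * tau l * tau l.+1 - tau l * tau l.+1 * tau l) * e nu
          - (i == i')%:R
            * bidiff (@fconst K _) (qpol D i j) (x l) (x l.+2) (x l.+1)
            * e nu).

Definition qha : Type := ring_quot qrel.
HB.instance Definition _ := GRing.PzRing.on qha.

Definition qpr (a : F) : qha := ring_proj qrel a.
Fact qpr_nmod : nmod_morphism qpr.
Proof. by split; [apply: (raddf0 (ring_proj qrel)) | apply: (raddfD (ring_proj qrel))]. Qed.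
Fact qpr_monoid : monoid_morphism qpr.
Proof. by split; [apply: (rmorph1 (ring_proj qrel)) | apply: (rmorphM (ring_proj qrel))]. Qed.
HB.instance Definition _ := GRing.isNmodMorphism.Build F qha qpr qpr_nmod.
HB.instance Definition _ := GRing.isMonoidMorphism.Build F qha qpr qpr_monoid.

Definition qconst (c : K) : qha := qpr (fconst _ c).
HB.instance Definition _ := GRing.RMorphism.copy qconst
  (qpr \o @fconst K (qgen I)).
Definition qe (nu : seq I) : qha := qpr (e nu).
Definition qx (k : nat) : qha := qpr (x k).
Definition qtau (l : nat) : qha := qpr (tau l).

(* the sum of the e(nu), nu in I^beta, with P nu *)
Definition qeP (P : pred (seq I)) : qha := \sum_(nu <- wseqs beta | P nu) qe nu.

End QuiverHecke.

Arguments qconst {K I C D beta} c.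
Arguments qe {K I C D beta} nu.
Arguments qx {K I C D beta} k.
Arguments qtau {K I C D beta} l.
Arguments qeP {K I C D beta} P.

(* [corner_ev c e h] evaluates a noncommutative polynomial in a ring S, sending
   1 to the idempotent e and the generators to their images under h. *)

Section CornerEvaluation.
Variables (K : nzRingType) (G : Type) (S : pzRingType).
Variables (c : {rmorphism K -> S}) (e : S) (h : G -> S).

Fixpoint corner_tev (t : term K G) : S :=
  match t with
  | TGen g => h g
  | TConst d => c d * e
  | TAdd t u => corner_tev t + corner_tev u
  | TMul t u => corner_tev t * corner_tev u
  end.

Definition corner_ev (a : free_alg K G) : S := corner_tev (repr a).

Hypothesis cC : forall d a, c d * a = a * c d.
Hypothesis ee : e * e = e.
Hypotheses (eh : forall g, e * h g = h g) (he : forall g, h g * e = h g).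

Lemma corner_tevl t : e * corner_tev t = corner_tev t.
Proof.
elim: t => //= [d|t iht u ihu|t iht u _].
- by rewrite mulrA -cC -mulrA ee.
- by rewrite mulrDr iht ihu.
- by rewrite mulrA iht.
Qed.
Lemma corner_tevr t : corner_tev t * e = corner_tev t.
Proof.
elim: t => //= [d|t iht u ihu|t _ u ihu].
- by rewrite -mulrA ee.
- by rewrite mulrDl iht ihu.
- by rewrite -mulrA ihu.
Qed.

Lemma corner_tev_eq t u : term_eq t u -> corner_tev t = corner_tev u.
Proof.
elim=> //= {t u} => [t u v _ -> _ -> //|t t' u u' _ -> _ -> //
  |t t' u u' _ -> _ -> //|t u v|t u|t|t u v|t|t|t u v|t u v|d d'|d d'|d t].
- exact: addrA.
- exact: addrC.
- by rewrite rmorph0 mul0r add0r.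
- exact: mulrA.
- by rewrite rmorph0 !mul0r.
- by rewrite rmorph1 mul1r corner_tevl.
- exact: mulrDl.
- exact: mulrDr.
- by rewrite rmorphD mulrDl.
- by rewrite rmorphM -!mulrA; congr (_ * _); rewrite mulrA -cC -mulrA ee.
- by rewrite -mulrA corner_tevl mulrA -cC -mulrA corner_tevr.
Qed.

Lemma corner_evE t : corner_ev (fclass t) = corner_tev t.
Proof. exact/corner_tev_eq/repr_fclass. Qed.
Lemma corner_ev_gen g : corner_ev (fgen K g) = h g.
Proof. exact: corner_evE. Qed.
Lemma corner_ev_const d : corner_ev (fconst G d) = c d * e.
Proof. exact: corner_evE. Qed.
Lemma corner_ev1 : corner_ev 1 = e.
Proof. by rewrite corner_ev_const rmorph1 mul1r. Qed.
Lemma corner_evD : {morph corner_ev : a b / a + b}.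
Proof.
elim/fclassW=> t; elim/fclassW=> u.
by rewrite /GRing.add /= faddE !corner_evE.
Qed.
Lemma corner_evM : {morph corner_ev : a b / a * b}.
Proof.
elim/fclassW=> t; elim/fclassW=> u.
by rewrite /GRing.mul /= fmulE !corner_evE.
Qed.
Lemma corner_ev0 : corner_ev 0 = 0.
Proof. by apply: (addIr (corner_ev 0)); rewrite -corner_evD !add0r. Qed.
Lemma corner_evN : {morph corner_ev : a / - a}.
Proof.
by move=> a; apply: (addIr (corner_ev a)); rewrite -corner_evD !addNr corner_ev0.
Qed.
Lemma corner_evB : {morph corner_ev : a b / a - b}.
Proof. by move=> a b; rewrite corner_evD corner_evN. Qed.
Lemma corner_ev_sum T (s : seq T) (P : pred T) F :
  corner_ev (\sum_(i <- s | P i) F i) = \sum_(i <- s | P i) corner_ev (F i).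
Proof. exact: (big_morph _ corner_evD corner_ev0). Qed.
Lemma corner_evl a : e * corner_ev a = corner_ev a.
Proof. exact: corner_tevl. Qed.
Lemma corner_evr a : corner_ev a * e = corner_ev a.
Proof. exact: corner_tevr. Qed.

Lemma corner_ev_nat d : corner_ev d%:R = d%:R * e.
Proof.
elim: d => [|d IHd]; first by rewrite corner_ev0 mul0r.
by rewrite -addn1 !natrD corner_evD IHd corner_ev1 mulrDl mul1r.
Qed.

Lemma expr_comm_corner b p : e * b = b * e -> e * b ^+ p = b ^+ p * e.
Proof. by move=> eb; apply: (@commrX _ e b p eb). Qed.

Lemma corner_evX a b p : corner_ev a = b * e -> e * b = b * e ->
  corner_ev (a ^+ p) = b ^+ p * e.
Proof.
move=> ab eb; elim: p => [|p IHp]; first by rewrite corner_ev1 mul1r.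
rewrite !exprS corner_evM IHp ab -!mulrA; congr (_ * _).
by rewrite mulrA (expr_comm_corner _ eb) -mulrA ee.
Qed.

Lemma corner_ev_bieval q a b a' b' :
    corner_ev a = a' * e -> e * a' = a' * e ->
    corner_ev b = b' * e -> e * b' = b' * e ->
  corner_ev (bieval (@fconst K G) q a b) = bieval c q a' b' * e.
Proof.
move=> ha ca hb cb; rewrite /bieval corner_ev_sum mulr_suml.
apply: eq_bigr => r _; rewrite corner_ev_sum mulr_suml.
apply: eq_bigr => p _; rewrite !corner_evM corner_ev_const.
rewrite (corner_evX _ ha ca) (corner_evX _ hb cb) -!mulrA; congr (_ * _).
rewrite (mulrA e) (expr_comm_corner _ ca) -!mulrA; congr (_ * _).
by rewrite (mulrA e) ee (mulrA e) (expr_comm_corner _ cb) -mulrA ee.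
Qed.

Lemma corner_ev_bidiff q a1 a2 b a1' a2' b' :
    corner_ev a1 = a1' * e -> e * a1' = a1' * e ->
    corner_ev a2 = a2' * e -> e * a2' = a2' * e ->
    corner_ev b = b' * e -> e * b' = b' * e ->
  corner_ev (bidiff (@fconst K G) q a1 a2 b) = bidiff c q a1' a2' b' * e.
Proof.
move=> h1 c1 h2 c2 hb cb; rewrite /bidiff corner_ev_sum mulr_suml.
apply: eq_bigr => r _; rewrite corner_ev_sum mulr_suml.
apply: eq_bigr => p _; rewrite !corner_evM corner_ev_const corner_ev_sum.
rewrite (corner_evX _ hb cb) -!mulrA; congr (_ * _).
rewrite mulr_suml mulr_sumr mulr_suml; apply: eq_bigr => s _.
rewrite corner_evM (corner_evX _ h1 c1) (corner_evX _ h2 c2) -!mulrA.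
rewrite (mulrA e) (expr_comm_corner _ c1) -!mulrA; congr (_ * _).
rewrite (mulrA e) ee (mulrA e) (expr_comm_corner _ c2) -!mulrA; congr (_ * _).
by rewrite (mulrA e) ee (mulrA e) (expr_comm_corner _ cb) -mulrA ee.
Qed.

Lemma corner_ev_comm z a : e * z = z * e -> (forall g, h g * z = z * h g) ->
  corner_ev a * z = z * corner_ev a.
Proof.
move=> ez hz; elim/fclassW: a => t; rewrite corner_evE.
elim: t => //= [d|t iht u ihu|t iht u ihu].
- by rewrite -mulrA ez mulrA cC -mulrA.
- by rewrite mulrDl mulrDr iht ihu.
- by rewrite -mulrA ihu mulrA iht mulrA.
Qed.

Variable rel : free_alg K G -> Prop.
Hypothesis rel0 : forall a, rel a -> corner_ev a = 0.

Lemma corner_ev_ideal a : ideal_span rel a -> corner_ev a = 0.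
Proof.
elim=> {a} [a /rel0 //||a b _ ha _ hb|d a _ ha|d a _ ha].
- exact: corner_ev0.
- by rewrite corner_evB ha hb subr0.
- by rewrite corner_evM ha mulr0.
- by rewrite corner_evM ha mul0r.
Qed.

Lemma corner_ev_repr a : corner_ev (ring_repr (ring_proj rel a)) = corner_ev a.
Proof.
apply/eqP; rewrite -subr_eq0 -corner_evB corner_ev_ideal //.
by apply/ring_projP; rewrite ring_reprK.
Qed.

End CornerEvaluation.

Section QuiverHeckeRelations.
Variables (K : fieldType) (I : choiceType) (C : cartan_datum I).
Variables (D : qh_datum K C) (beta : {mset I}).
Local Notation R := (qha D beta).
Local Notation n := (size beta).

Lemma qpr_rel a : qrel D beta a -> qpr D beta a = 0.
Proof.
move=> ra; rewrite -(rmorph0 (qpr D beta)); apply/ring_projP.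
by rewrite subr0; apply: ideal_gen.
Qed.
Lemma qpr_rel_eq a b : qrel D beta (a - b) -> qpr D beta a = qpr D beta b.
Proof. by move/qpr_rel/eqP; rewrite rmorphB subr_eq0 => /eqP. Qed.

Lemma qconstC d (a : R) : qconst d * a = a * qconst d.
Proof.
elim/ring_projW: a => a.
by rewrite -[ring_proj _ a]/(qpr D beta a) -[qconst d]/(qpr D beta (fconst _ d))
  -!rmorphM fconst_central.
Qed.
Lemma qe_out nu : seq_mset nu != beta -> qe nu = 0 :> R.
Proof. by move=> h; apply/qpr_rel/qrel_e_out. Qed.
Lemma qx_out k : ~~ (1 <= k <= n)%N -> qx k = 0 :> R.
Proof. by move=> h; apply/qpr_rel/qrel_x_out. Qed.
Lemma qtau_out k : ~~ (1 <= k < n)%N -> qtau k = 0 :> R.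
Proof. by move=> h; apply/qpr_rel/qrel_t_out. Qed.
Lemma qee nu mu : qe nu * qe mu = (if nu == mu then qe nu else 0) :> R.
Proof.
have := qpr_rel_eq (qrel_ee D beta nu mu); rewrite rmorphM => ->.
by case: ifP; rewrite ?rmorph0.
Qed.
Lemma qe_sum : \sum_(nu <- wseqs beta) qe nu = 1 :> R.
Proof. by have := qpr_rel_eq (qrel_e1 D beta); rewrite rmorph_sum rmorph1. Qed.
Lemma qxe k nu : qx k * qe nu = qe nu * qx k :> R.
Proof. by have := qpr_rel_eq (qrel_xe D beta k nu); rewrite !rmorphM. Qed.
Lemma qxx k l : qx k * qx l = qx l * qx k :> R.
Proof. by have := qpr_rel_eq (qrel_xx D beta k l); rewrite !rmorphM. Qed.
Lemma qte s i j t :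
  qtau (size s).+1 * qe (s ++ [:: i, j & t])
  = qe (s ++ [:: j, i & t]) * qtau (size s).+1 :> R.
Proof. by have := qpr_rel_eq (qrel_te D beta s i j t); rewrite !rmorphM. Qed.
Lemma qtt k l : (k.+1 < l)%N || (l.+1 < k)%N ->
  qtau k * qtau l = qtau l * qtau k :> R.
Proof. by move=> h; have := qpr_rel_eq (qrel_tt D beta h); rewrite !rmorphM. Qed.

Lemma rmorph_bieval (A B : pzRingType) (f : {rmorphism A -> B}) (c : K -> A) q a b :
  f (bieval c q a b) = bieval (f \o c) q (f a) (f b).
Proof.
rewrite /bieval rmorph_sum; apply: eq_bigr => r _.
rewrite rmorph_sum; apply: eq_bigr => p _.
by rewrite !rmorphM !rmorphXn.
Qed.
Lemma rmorph_bidiff (A B : pzRingType) (f : {rmorphism A -> B}) (c : K -> A)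
    q a1 a2 b :
  f (bidiff c q a1 a2 b) = bidiff (f \o c) q (f a1) (f a2) (f b).
Proof.
rewrite /bidiff rmorph_sum; apply: eq_bigr => r _.
rewrite rmorph_sum; apply: eq_bigr => p _.
rewrite !rmorphM rmorph_sum !rmorphXn; congr (_ * (_ * _)).
by apply: eq_bigr => s _; rewrite rmorphM !rmorphXn.
Qed.

Lemma qt2 s i j t (l := (size s).+1) :
  qtau l ^+ 2 * qe (s ++ [:: i, j & t])
  = bieval qconst (qpol D i j) (qx l) (qx l.+1) * qe (s ++ [:: i, j & t]) :> R.
Proof.
have := qpr_rel_eq (qrel_t2 D beta s i j t).
by rewrite !rmorphM rmorph_bieval.
Qed.
Lemma qtx s i j t k (l := (size s).+1) :
  (qtau l * qx k - qx (swap_at l k) * qtau l) * qe (s ++ [:: i, j & t])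
  = ((k == l.+1)%:R - (k == l)%:R) * (i == j)%:R
    * qe (s ++ [:: i, j & t]) :> R.
Proof.
have := qpr_rel_eq (qrel_tx D beta s i j t k).
by rewrite !(rmorphM, rmorphB, rmorph_nat).
Qed.
Lemma qbraid s i j i' t (l := (size s).+1) :
  (qtau l.+1 * qtau l * qtau l.+1 - qtau l * qtau l.+1 * qtau l)
    * qe (s ++ [:: i, j, i' & t])
  = (i == i')%:R * bidiff qconst (qpol D i j) (qx l) (qx l.+2) (qx l.+1)
    * qe (s ++ [:: i, j, i' & t]) :> R.
Proof.
have := qpr_rel_eq (qrel_braid D beta s i j i' t).
by rewrite !(rmorphM, rmorphB, rmorph_bidiff, rmorph_nat).
Qed.

Lemma qe_ext (a b : R) :
  (forall nu, seq_mset nu = beta -> a * qe nu = b * qe nu) -> a = b.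
Proof.
move=> h; rewrite -[a]mulr1 -[b]mulr1 -qe_sum !mulr_sumr.
by apply: eq_big_seq => nu; rewrite mem_wseqs => /eqP; apply: h.
Qed.

Lemma qeP_e P nu : qeP P * qe nu = (if P nu then qe nu else 0) :> R.
Proof.
have [hnu|hnu] := boolP (seq_mset nu == beta); last first.
  by rewrite (qe_out hnu) mulr0; case: ifP.
rewrite mulr_suml big_mkcond /=.
rewrite (bigD1_seq nu) ?mem_wseqs ?permutations_uniq //= qee eqxx big1 ?addr0 //.
by move=> mu /negbTE neq; case: ifP => // _; rewrite qee neq.
Qed.
Lemma e_qeP P nu : qe nu * qeP P = (if P nu then qe nu else 0) :> R.
Proof.
rewrite -qeP_e /qeP mulr_sumr mulr_suml; apply: eq_bigr => mu _.
by rewrite !qee eq_sym; case: eqP => // ->.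
Qed.
Lemma qePM P Q : qeP P * qeP Q = qeP (fun nu => P nu && Q nu) :> R.
Proof.
apply: qe_ext => nu _; rewrite -mulrA !qeP_e.
by case: (Q nu); rewrite ?mulr0 ?andbF // andbT qeP_e.
Qed.
Lemma eq_qeP P Q : (forall nu, seq_mset nu = beta -> P nu = Q nu) ->
  qeP P = qeP Q :> R.
Proof. by move=> h; apply: qe_ext => nu hnu; rewrite !qeP_e h. Qed.
Lemma qePx P k : qeP P * qx k = qx k * qeP P :> R.
Proof. by rewrite mulr_suml mulr_sumr; apply: eq_bigr => nu _; rewrite qxe. Qed.
Lemma qeP_idem P : qeP P * qeP P = qeP P :> R.
Proof. by rewrite qePM; apply: eq_qeP => nu _; rewrite andbb. Qed.

Lemma wseq_split nu l : seq_mset nu = beta -> (1 <= l < n)%N ->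
  exists s i j t, nu = s ++ [:: i, j & t] /\ (size s).+1 = l.
Proof.
move=> hnu hl; have szn : size nu = n.
  by rewrite -(perm_size (perm_eq_seq_mset nu)) hnu.
exists (take l.-1 nu).
have := cat_take_drop l.-1 nu; have := size_drop l.-1 nu.
case: (drop l.-1 nu) => [|i [|j t]] /= sz e; try by lia.
by exists i, j, t; split=> //; rewrite size_take; case: ifP; lia.
Qed.

Lemma qtau_qx l k : k != l -> k != l.+1 -> qtau l * qx k = qx k * qtau l :> R.
Proof.
move=> h1 h2; have [hl|hl] := boolP (1 <= l < n)%N; last first.
  by rewrite (qtau_out hl) mulr0 mul0r.
apply: qe_ext => nu hnu; have [s [i [j [t [-> sl]]]]] := wseq_split hnu hl.
have := qtx s i j t k; cbv zeta; rewrite sl /swap_at (negbTE h1) (negbTE h2).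
by rewrite subrr !mul0r mulrBl => /eqP; rewrite subr_eq0 => /eqP.
Qed.

Lemma qtau_qeP P l :
    (forall s i j t, (size s).+1 = l ->
       P (s ++ [:: i, j & t]) = P (s ++ [:: j, i & t])) ->
  qeP P * qtau l = qtau l * qeP P :> R.
Proof.
move=> hP; have [hl|hl] := boolP (1 <= l < n)%N; last first.
  by rewrite (qtau_out hl) mulr0 mul0r.
apply: qe_ext => nu hnu.
have [s [i [j [t [-> sl]]]]] := wseq_split hnu hl.
rewrite -mulrA -[RHS]mulrA qeP_e -sl.
rewrite qte mulrA qeP_e (hP _ _ _ _ sl).
by case: ifP; rewrite ?mul0r ?mulr0 // qte.
Qed.

End QuiverHeckeRelations.

(* [block_map m beta P] : R(beta) -> R(delta) puts the generators of R(beta) on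
   the strands m+1, ..., m+ht(beta), inside the corner cut out by the idempotent
   [qeP P]; it sends 1 to [qeP P]. *)

Section Block.
Variables (K : fieldType) (I : choiceType) (C : cartan_datum I).
Variables (D : qh_datum K C) (delta : {mset I}) (m : nat) (beta : {mset I}).
Variable (P : pred (seq I)).
Local Notation R := (qha D delta).
Local Notation n := (size beta).
Local Notation E := (qeP P : R).

Definition block (nu : seq I) : seq I := take n (drop m nu).

Definition block_gen (g : qgen I) : R :=
  match g with
  | GE nu => qeP (fun mu => P mu && (block mu == nu))
  | GX k => if (1 <= k <= n)%N then qx (m + k) * E else 0
  | GT l => if (1 <= l < n)%N then qtau (m + l) * E else 0
  end.

Definition block_map (a : qha D beta) : R :=
  corner_ev (@qconst K I C D delta) E block_gen (ring_repr a).

Hypothesis P_block : forall nu, seq_mset nu = delta -> P nu ->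
  seq_mset (block nu) = beta.
Hypothesis P_swap : forall s i j t, (m <= size s)%N -> ((size s).+1 < m + n)%N ->
  P (s ++ [:: i, j & t]) = P (s ++ [:: j, i & t]).

Local Notation ev := (corner_ev (@qconst K I C D delta) E block_gen).
Local Notation h nu := (block_gen (GE nu)).
Local Notation fe nu := (fgen K (GE nu)).
Local Notation fx k := (fgen K (GX k)).
Local Notation ft l := (fgen K (GT l)).

Lemma block_tauE l : (1 <= l < n)%N -> E * qtau (m + l) = qtau (m + l) * E.
Proof. by move=> hl; apply: qtau_qeP => s i j t sl; apply: P_swap; lia. Qed.

Lemma block_El g : E * block_gen g = block_gen g.
Proof.
case: g => [nu|k|l] /=.
- by rewrite qePM; apply: eq_qeP => mu _; rewrite andbA andbb.
- by case: ifP => _; rewrite ?mulr0 // mulrA qePx -mulrA qeP_idem.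
- by case: ifP => hl; rewrite ?mulr0 // mulrA block_tauE // -mulrA qeP_idem.
Qed.
Lemma block_Er g : block_gen g * E = block_gen g.
Proof.
case: g => [nu|k|l] /=.
- by rewrite qePM; apply: eq_qeP => mu _; rewrite andbAC andbb.
- by case: ifP => _; rewrite ?mul0r // -mulrA qeP_idem.
- by case: ifP => _; rewrite ?mul0r // -mulrA qeP_idem.
Qed.

Let cC := @qconstC K I C D delta.
Let EE := qeP_idem D delta P.
Let evM := corner_evM cC EE block_El block_Er.
Let evB := corner_evB cC EE block_El block_Er.
Let evg := corner_ev_gen cC EE block_El block_Er.

Lemma block_h_out nu : seq_mset nu != beta -> h nu = 0.
Proof.
move=> hnu /=; apply: qe_ext => mu hmu; rewrite qeP_e mul0r.
by case: ifP => // /andP[hP /eqP e]; rewrite -e (P_block hmu hP) eqxx in hnu.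
Qed.

Lemma block_ext nu (a b : R) : nu != [::] ->
    (forall p q, size p = m -> P (p ++ nu ++ q) ->
       a * qe (p ++ nu ++ q) = b * qe (p ++ nu ++ q)) ->
  a * h nu = b * h nu.
Proof.
move=> nu0 hab /=; rewrite !mulr_sumr; apply: eq_bigr => mu /andP[hP /eqP e].
have sm : (m < size mu)%N.
  rewrite ltnNge; apply/negP => sm; move: nu0; rewrite -e /block.
  by rewrite drop_oversize.
have {}e : mu = take m mu ++ nu ++ drop n (drop m mu).
  by rewrite -e /block cat_take_drop cat_take_drop.
rewrite e; apply: hab; last by rewrite -e.
by rewrite size_take sm.
Qed.

Lemma block_extl nu (a b : R) : nu != [::] ->
    (forall p q, size p = m -> P (p ++ nu ++ q) ->
       qe (p ++ nu ++ q) * a = qe (p ++ nu ++ q) * b) ->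
  h nu * a = h nu * b.
Proof.
move=> nu0 hab /=; rewrite !mulr_suml; apply: eq_bigr => mu /andP[hP /eqP e].
have sm : (m < size mu)%N.
  rewrite ltnNge; apply/negP => sm; move: nu0; rewrite -e /block.
  by rewrite drop_oversize.
have {}e : mu = take m mu ++ nu ++ drop n (drop m mu).
  by rewrite -e /block cat_take_drop cat_take_drop.
rewrite e; apply: hab; last by rewrite -e.
by rewrite size_take sm.
Qed.

Lemma block_cat p nu q : size p = m -> size nu = n -> block (p ++ nu ++ q) = nu.
Proof. by move=> sp sn; rewrite /block drop_size_cat // take_size_cat. Qed.

Lemma wseq_size (nu : seq I) : seq_mset nu = beta -> size nu = n.
Proof. by move=> <-; rewrite (perm_size (perm_eq_seq_mset nu)). Qed.

Lemma wseq_swap s (i j : I) t :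
  seq_mset (s ++ [:: i, j & t]) = seq_mset (s ++ [:: j, i & t]).
Proof.
apply/eq_seq_msetP; rewrite perm_cat2l.
by apply/permP => a /=; rewrite addnCA.
Qed.

Lemma block_h_e p nu q : size p = m -> seq_mset nu = beta -> P (p ++ nu ++ q) ->
  h nu * qe (p ++ nu ++ q) = qe (p ++ nu ++ q).
Proof.
move=> sp snu hP; rewrite /= qeP_e hP block_cat ?eqxx //.
exact: wseq_size.
Qed.
Lemma block_e_h p nu q : size p = m -> seq_mset nu = beta -> P (p ++ nu ++ q) ->
  qe (p ++ nu ++ q) * h nu = qe (p ++ nu ++ q).
Proof.
move=> sp snu hP; rewrite /= e_qeP hP block_cat ?eqxx //.
exact: wseq_size.
Qed.

Lemma block_te s i j t : seq_mset (s ++ [:: i, j & t]) = beta ->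
  qtau (m + (size s).+1) * h (s ++ [:: i, j & t])
  = h (s ++ [:: j, i & t]) * qtau (m + (size s).+1).
Proof.
move=> hnu; have hnu' := hnu; rewrite wseq_swap in hnu'.
have hs := wseq_size hnu; rewrite size_cat /= in hs.
have ne a b : s ++ [:: a, b & t] != [::] by case: (s).
have Psw p q a b : size p = m ->
    P (p ++ (s ++ [:: a, b & t]) ++ q) = P (p ++ (s ++ [:: b, a & t]) ++ q).
  move=> sp; rewrite -!catA !(catA p) /=; apply: P_swap; rewrite size_cat; lia.
have te p q a b : size p = m ->
    qtau (m + (size s).+1) * qe (p ++ (s ++ [:: a, b & t]) ++ q)
    = qe (p ++ (s ++ [:: b, a & t]) ++ q) * qtau (m + (size s).+1) :> R.
  move=> sp; rewrite -!catA !(catA p) /=.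
  by have := qte D delta (p ++ s) a b (t ++ q); rewrite size_cat sp addnS.
transitivity (h (s ++ [:: j, i & t]) * (qtau (m + (size s).+1)
              * h (s ++ [:: i, j & t]))).
  rewrite [RHS]mulrA; apply: block_ext => // p q sp hP.
  rewrite -mulrA te // mulrA block_h_e //.
  by rewrite Psw.
rewrite -[h _ * qtau _]mulr1 -!mulrA; apply: block_extl => // p q sp hP.
rewrite mulr1 [LHS]mulrA -te // -mulrA block_e_h // Psw //.
Qed.

Lemma block_ev_x k : (1 <= k <= n)%N -> ev (fx k) = qx (m + k) * E.
Proof. by move=> hk; rewrite evg /= hk. Qed.
Lemma block_ev_t l : (1 <= l < n)%N -> ev (ft l) = qtau (m + l) * E.
Proof. by move=> hl; rewrite evg /= hl. Qed.
Lemma block_swap_at l k : swap_at (m + l) (m + k) = (m + swap_at l k)%N.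
Proof. rewrite /swap_at -addnS !eqn_add2l; case: ifP => _ //; by case: ifP. Qed.
Lemma block_ev_nat d : ev d%:R = d%:R * E.
Proof. exact: corner_ev_nat cC EE block_El block_Er d. Qed.

Lemma block_rel a : qrel D beta a -> ev a = 0.
Proof.
case=> {a} [nu hnu|k hk|l hl|nu mu||k nu|k l|s i j t|k l hkl|s i j t|s i j t k
  |s i j i' t].
- by rewrite evg block_h_out.
- by rewrite evg /= (negbTE hk).
- by rewrite evg /= (negbTE hl).
- rewrite evB evM !evg (_ : ev (if _ then _ else _)
    = if nu == mu then h nu else 0); last first.
    by case: ifP => _; rewrite ?evg ?(corner_ev0 cC EE block_El block_Er).
  apply/eqP; rewrite subr_eq0; apply/eqP; apply: qe_ext => rho _ /=.
  rewrite qePM qeP_e; have [<-|hne] := eqVneq nu mu; first by rewrite andbb qeP_e.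
  rewrite mul0r; case: ifP => // /andP[/andP[_ /eqP e1]].
  by move=> /andP[_ /eqP e2]; rewrite -e1 e2 eqxx in hne.
- rewrite evB (corner_ev_sum cC EE block_El block_Er).
  rewrite (corner_ev1 cC EE block_El block_Er).
  apply/eqP; rewrite subr_eq0; apply/eqP; apply: qe_ext => rho hrho.
  rewrite mulr_suml qeP_e (eq_bigr (fun nu =>
    if P rho && (block rho == nu) then qe rho else 0)); last first.
    by move=> nu _; rewrite evg /= qeP_e.
  case: ifP => hP /=; last by rewrite big1.
  rewrite (bigD1_seq (block rho)) ?mem_wseqs ?permutations_uniq ?P_block //=.
  rewrite eqxx big1 ?addr0 // => nu; by rewrite eq_sym => /negbTE ->.
- rewrite evB !evM !evg /=; case: ifP => _; last by rewrite mul0r mulr0 subrr.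
  by rewrite -mulrA (block_El (GE nu)) mulrA qePx -mulrA (block_Er (GE nu)) subrr.
- rewrite evB !evM !evg /=.
  case: ifP => _; case: ifP => _; rewrite ?mul0r ?mulr0 ?subrr //.
  rewrite -!mulrA !(mulrA E) !qePx -!mulrA EE.
  by rewrite (mulrA (qx _)) qxx -mulrA subrr.
- cbv zeta; case: (eqVneq (seq_mset (s ++ [:: i, j & t])) beta) => hnu; last first.
    by rewrite evB !evM !(evg (GE _)) !block_h_out ?mulr0 ?mul0r ?subrr //
      -wseq_swap.
  have := wseq_size hnu; rewrite size_cat /= => hs.
  rewrite evB !evM !(evg (GE _)) block_ev_t; last by lia.
  rewrite -block_tauE ?mulrA; last by lia.
  rewrite block_Er block_tauE; last by lia.
  by rewrite -mulrA block_El block_te // subrr.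
- rewrite evB !evM !evg /=.
  case: ifP => hk; case: ifP => hl; rewrite ?mul0r ?mulr0 ?subrr //.
  rewrite -!mulrA !(mulrA E) !block_tauE // -!mulrA EE.
  by rewrite (mulrA (qtau _)) qtt ?mulrA ?subrr //; move: hkl; lia.
- cbv zeta; case: (eqVneq (seq_mset (s ++ [:: i, j & t])) beta) => hnu; last first.
    by rewrite evB !evM !(evg (GE _)) !block_h_out ?mulr0 ?subrr.
  have := wseq_size hnu; rewrite size_cat /= => hs.
  rewrite evB !evM !(evg (GE _)) block_ev_t; last by lia.
  rewrite (corner_ev_bieval cC EE block_El block_Er _ (a' := qx (m + (size s).+1))
    (b' := qx (m + (size s).+2))) ?qePx ?block_ev_x //; try by lia.
  apply/eqP; rewrite subr_eq0; apply/eqP.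
  have tE : E * qtau (m + (size s).+1) = qtau (m + (size s).+1) * E.
    by apply: block_tauE; lia.
  rewrite -!mulrA !block_El [E * (_ * h _)]mulrA tE -mulrA block_El !mulrA.
  apply: block_ext => [|p q sp hP]; first by case: (s).
  rewrite -!catA !(catA p) /=.
  have := qt2 D delta (p ++ s) i j (t ++ q); rewrite size_cat sp !addnS => ->.
  by [].
- cbv zeta; case: (eqVneq (seq_mset (s ++ [:: i, j & t])) beta) => hnu; last first.
    by rewrite evB !evM !(evg (GE _)) !block_h_out ?mulr0 ?subrr.
  have := wseq_size hnu; rewrite size_cat /= => hs.
  have [hk|hk] := boolP (1 <= k <= n)%N; last first.
    have xk : ev (fx k) = 0 by rewrite evg /= (negbTE hk).
    have sk : swap_at (size s).+1 k = k.
      by rewrite /swap_at; case: eqP; [lia | case: eqP => //; lia].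
    have [k1 k2] : k == (size s).+1 = false /\ k == (size s).+2 = false.
      by split; apply/eqP; lia.
    rewrite sk k1 k2 !(evB, evM) !block_ev_nat xk.
    by rewrite !(mulr0, mul0r, subrr).
  have hk' : (1 <= swap_at (size s).+1 k <= n)%N.
    by rewrite /swap_at; case: ifP => _; [lia | case: ifP => _; lia].
  rewrite !(evB, evM) !(evg (GE _)) !block_ev_nat !block_ev_x // block_ev_t; last lia.
  have tE : E * qtau (m + (size s).+1) = qtau (m + (size s).+1) * E.
    by apply: block_tauE; lia.
  apply/eqP; rewrite subr_eq0; apply/eqP.
  have natE d : E * d%:R = d%:R * E by exact: commr_nat.
  rewrite !mulrBl -!mulrA !(block_El (GE _)) !(mulrA E) !(tE, qePx, natE) -!mulrA.
  rewrite !(block_El (GE _)) !mulrA -!mulrBl -block_swap_at.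
  apply: block_ext => [|p q sp hP]; first by case: (s).
  rewrite -!catA !(catA p) /=.
  have := qtx D delta (p ++ s) i j (t ++ q) (m + k).
  cbv zeta; rewrite size_cat sp -!addnS !eqn_add2l; exact.
- cbv zeta; case: (eqVneq (seq_mset (s ++ [:: i, j, i' & t])) beta) => hnu; last first.
    by rewrite evB !evM !(evg (GE _)) !block_h_out ?mulr0 ?subrr.
  have := wseq_size hnu; rewrite size_cat /= => hs.
  have bE : ev ((i == i')%:R * bidiff (@fconst K _) (qpol D i j)
        (fx (size s).+1) (fx (size s).+3) (fx (size s).+2))
      = (i == i')%:R * bidiff qconst (qpol D i j) (qx (m + (size s).+1))
          (qx (m + (size s).+3)) (qx (m + (size s).+2)) * E.
    rewrite evM block_ev_nat -[LHS]mulrA (corner_evl cC EE block_El) -[RHS]mulrA.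
    by rewrite (corner_ev_bidiff cC EE block_El block_Er _
      (a1' := qx (m + (size s).+1)) (a2' := qx (m + (size s).+3))
      (b' := qx (m + (size s).+2))) ?qePx ?block_ev_x //; lia.
  rewrite evB [X in _ - X]evM bE !(evB, evM) !(evg (GE _)).
  rewrite !block_ev_t; try by lia.
  have tE : E * qtau (m + (size s).+1) = qtau (m + (size s).+1) * E.
    by apply: block_tauE; lia.
  have tE' : E * qtau (m + (size s).+2) = qtau (m + (size s).+2) * E.
    by apply: block_tauE; lia.
  apply/eqP; rewrite subr_eq0; apply/eqP.
  rewrite !mulrBl -!mulrA !(block_El (GE _)) !(mulrA E) !(tE, tE') -!mulrA.
  rewrite !(block_El (GE _)) !(mulrA E) !(tE, tE') -!mulrA !(block_El (GE _)).
  rewrite !mulrA -!mulrBl.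
  apply: block_ext => [|p q sp hP]; first by case: (s).
  rewrite -!catA !(catA p) /=.
  have := qbraid D delta (p ++ s) i j i' (t ++ q).
  cbv zeta; rewrite size_cat sp -!addnS; exact.
Qed.
Lemma block_map_qpr a : block_map (qpr D beta a) = ev a.
Proof. exact: (corner_ev_repr cC EE block_El block_Er block_rel). Qed.
Lemma block_mapD : {morph block_map : a b / a + b}.
Proof.
elim/ring_projW=> a; elim/ring_projW=> b.
rewrite -[ring_proj _ a]/(qpr D beta a) -[ring_proj _ b]/(qpr D beta b).
by rewrite -rmorphD !block_map_qpr (corner_evD cC EE block_El block_Er).
Qed.
Lemma block_mapM : {morph block_map : a b / a * b}.
Proof.
elim/ring_projW=> a; elim/ring_projW=> b.
rewrite -[ring_proj _ a]/(qpr D beta a) -[ring_proj _ b]/(qpr D beta b).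
by rewrite -rmorphM !block_map_qpr evM.
Qed.
Lemma block_map1 : block_map 1 = E.
Proof.
by rewrite -(rmorph1 (qpr D beta)) block_map_qpr
  (corner_ev1 cC EE block_El block_Er).
Qed.
Lemma block_map_const d : block_map (qconst d) = qconst d * E.
Proof.
by rewrite block_map_qpr (corner_ev_const cC EE block_El block_Er).
Qed.
Lemma block_map_e nu : block_map (qe nu) = qeP (fun mu => P mu && (block mu == nu)).
Proof. by rewrite block_map_qpr evg. Qed.
Lemma block_map_x k : (1 <= k <= n)%N -> block_map (qx k) = qx (m + k) * E.
Proof. by move=> hk; rewrite block_map_qpr block_ev_x. Qed.
Lemma block_map_tau l : (1 <= l < n)%N -> block_map (qtau l) = qtau (m + l) * E.
Proof. by move=> hl; rewrite block_map_qpr block_ev_t. Qed.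
Lemma block_mapl a : E * block_map a = block_map a.
Proof. exact: (corner_evl cC EE block_El). Qed.
Lemma block_mapr a : block_map a * E = block_map a.
Proof. exact: (corner_evr _ EE block_Er). Qed.

End Block.

Section Restriction.
Variables (K : fieldType) (I : choiceType) (C : cartan_datum I).
Variables (D : qh_datum K C) (i : I) (beta : {mset I}).

Definition starts_with : pred (seq I) := fun nu => ohead nu == Some i.

(* e(i, * ) *)
Definition qei : qha D beta := qeP starts_with.

(* R(beta - alpha_i) -> e(i, * ) R(beta) e(i, * ),
   e(nu) |-> e(i nu), x_k |-> x_{k+1}, tau_l |-> tau_{l+1}.
   When i is not in the support of beta, [beta `\ i] is beta, but e(i, * ) = 0. *)
Definition shift_map : qha D (beta `\ i) -> qha D beta :=
  block_map beta 1 starts_with.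

Lemma starts_with_block nu : seq_mset nu = beta -> starts_with nu ->
  seq_mset (block 1 (beta `\ i) nu) = beta `\ i.
Proof.
case: nu => [|j nu] //= hb /eqP[e]; rewrite /block drop1 /=.
have e' : seq_mset nu = beta `\ i by rewrite -hb mset_cons e msetD1K.
by rewrite -e' (perm_size (perm_eq_seq_mset nu)) take_size.
Qed.
Lemma starts_with_swap s j k t : (1 <= size s)%N ->
    ((size s).+1 < 1 + size (beta `\ i))%N ->
  starts_with (s ++ [:: j, k & t]) = starts_with (s ++ [:: k, j & t]).
Proof. by case: s. Qed.

Lemma shift_mapl a : qei * shift_map a = shift_map a.
Proof. by apply: block_mapl; apply: starts_with_swap. Qed.
Lemma shift_mapr a : shift_map a * qei = shift_map a.
Proof. exact: block_mapr. Qed.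
Lemma shift_mapM : {morph shift_map : a b / a * b}.
Proof.
by apply: block_mapM; [apply: starts_with_block | apply: starts_with_swap].
Qed.
Lemma shift_mapD : {morph shift_map : a b / a + b}.
Proof.
by apply: block_mapD; [apply: starts_with_block | apply: starts_with_swap].
Qed.
Lemma shift_map1 : shift_map 1 = qei.
Proof.
by apply: block_map1; [apply: starts_with_block | apply: starts_with_swap].
Qed.

Lemma shift_map_x1 a : shift_map a * qx 1 = qx 1 * shift_map a.
Proof.
have tE l : (1 <= l < size (beta `\ i))%N ->
    qei * qtau (1 + l) = qtau (1 + l) * qei.
  by apply: block_tauE; apply: starts_with_swap.
apply: corner_ev_comm; [exact: qconstC|exact: qeP_idem| | |exact: qePx|].
- by apply: block_El; apply: starts_with_swap.
- exact: block_Er.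
- case=> [nu|k|l] /=; first exact: qePx.
    case: ifP => _; rewrite ?mulr0 ?mul0r //.
    by rewrite -mulrA qePx !mulrA qxx.
  case: ifP => hl; rewrite ?mulr0 ?mul0r //.
  by rewrite -mulrA qePx !mulrA qtau_qx //; apply/eqP; lia.
Qed.

Variable M : lmodType (qha D beta).

Definition Ei_pred : {pred M} := fun u => qei *: u == u.
Fact Ei_pred_zmod : zmod_closed Ei_pred.
Proof.
split=> [|u v]; rewrite !unfold_in ?scaler0 //.
by move=> /eqP hu /eqP hv; rewrite scalerBr hu hv.
Qed.
HB.instance Definition _ := GRing.isZmodClosed.Build M Ei_pred Ei_pred_zmod.

(* [Ei_val] is the inverse of the bijection r : e(i, * )M -> E_i M. *)
Record Ei : Type := EiElt { Ei_val : M; _ : Ei_val \in Ei_pred }.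
HB.instance Definition _ := [isSub for Ei_val].
HB.instance Definition _ := [Choice of Ei by <:].
HB.instance Definition _ := [SubChoice_isSubZmodule of Ei by <:].

Lemma Ei_mem (a : qha D beta) (u : M) : qei * a = a -> a *: u \in Ei_pred.
Proof. by move=> h; rewrite unfold_in scalerA h. Qed.

(* The bijection r, extended by 0 to (1 - e(i, * ))M. *)
Definition Er (u : M) : Ei := EiElt (Ei_mem u (qeP_idem D beta starts_with)).

Lemma Ei_valK (u : Ei) : qei *: Ei_val u = Ei_val u.
Proof. by apply/eqP; apply: (valP u). Qed.
Lemma ErK (u : Ei) : Er (Ei_val u) = u.
Proof. exact/val_inj/Ei_valK. Qed.
Lemma Er_val (u : M) : Ei_val (Er u) = qei *: u. Proof. by []. Qed.

Definition Ei_scale (a : qha D (beta `\ i)) (u : Ei) : Ei :=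
  EiElt (Ei_mem (Ei_val u) (shift_mapl a)).

Fact Ei_scaleA a b u : Ei_scale a (Ei_scale b u) = Ei_scale (a * b) u.
Proof.
apply: val_inj => /=.
by rewrite scalerA shift_mapM.
Qed.
Fact Ei_scale1 : left_id 1 Ei_scale.
Proof.
move=> u; apply: val_inj => /=.
by rewrite shift_map1 Ei_valK.
Qed.
Fact Ei_scaleDr : right_distributive Ei_scale +%R.
Proof. by move=> a u v; apply: val_inj; rewrite /= scalerDr. Qed.
Fact Ei_scaleDl u : {morph Ei_scale^~ u : a b / a + b}.
Proof.
move=> a b; apply: val_inj => /=.
by rewrite shift_mapD scalerDl.
Qed.
HB.instance Definition _ := GRing.Zmodule_isLmodule.Build (qha D (beta `\ i)) Ei
  Ei_scaleA Ei_scale1 Ei_scaleDr Ei_scaleDl.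

Lemma Ei_scaleE a (u : Ei) : Ei_val (a *: u) = shift_map a *: Ei_val u.
Proof. by []. Qed.

Lemma Er_x k u : (1 <= k <= size (beta `\ i))%N ->
  qx k *: Er u = Er (qx k.+1 *: u).
Proof.
move=> hk; apply: val_inj; rewrite /= /shift_map block_map_x //; last first.
- exact: starts_with_swap.
- exact: starts_with_block.
by rewrite !scalerA -mulrA qeP_idem -qePx.
Qed.
Lemma Er_tau l u : (1 <= l < size (beta `\ i))%N ->
  qtau l *: Er u = Er (qtau l.+1 *: u).
Proof.
move=> hl; apply: val_inj; rewrite /= /shift_map block_map_tau //; last first.
- exact: starts_with_swap.
- exact: starts_with_block.
rewrite !scalerA -mulrA qeP_idem.
by rewrite -(block_tauE D beta (@starts_with_swap)).
Qed.

(* z . r(w) = r(x_1 w) *)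
Definition Ei_z (u : Ei) : Ei := Er (qx 1 *: Ei_val u).
Fact Ei_z_linear : linear Ei_z.
Proof.
move=> a u v; apply: val_inj => /=.
rewrite !scalerDr; congr (_ + _).
by rewrite !scalerA -mulrA -shift_map_x1 mulrA shift_mapl shift_mapr.
Qed.
HB.instance Definition _ := GRing.isLinear.Build _ _ _ _ Ei_z Ei_z_linear.

End Restriction.

Arguments Ei {K I C D} i {beta} M.
Arguments Er {K I C D} i {beta M} u.
Arguments Ei_z {K I C D} i {beta} M u.

Definition Ei_map (K : fieldType) (I : choiceType) (C : cartan_datum I)
    (D : qh_datum K C) (i : I) (beta : {mset I}) (M N : lmodType (qha D beta))
    (f : M -> N) (u : Ei i M) : Ei i N := Er i (f (Ei_val u)).
Arguments Ei_map {K I C D} i {beta M N} f u.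

(* M o N = R(beta+gamma) e(beta,gamma) (x)_{R(beta) (x) R(gamma)} (M (x) N).
   The total weight is a separate argument [delta]: it is meant to be
   [beta `+` gamma], but it may be equal to it only propositionally, as for
   delta = (delta - alpha_i) + alpha_i.  If [delta] is something else, then
   e(beta,gamma) = 0 in R(delta) and M o N = 0. *)

Section Convolution.
Variables (K : fieldType) (I : choiceType) (C : cartan_datum I).
Variables (D : qh_datum K C) (delta beta gamma : {mset I}).
Local Notation R := (qha D delta).

Definition splits_as : pred (seq I) := fun nu =>
  (seq_mset (take (size beta) nu) == beta)
  && (seq_mset (drop (size beta) nu) == gamma).

(* R(beta) -> R(delta) and R(gamma) -> R(delta), a |-> a (x) 1 and b |-> 1 (x) b,
   both with 1 |-> e(beta,gamma) *)
Definition iotaL : qha D beta -> R := block_map delta 0 splits_as.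
Definition iotaR : qha D gamma -> R := block_map delta (size beta) splits_as.

Lemma splits_as_blockL nu : seq_mset nu = delta -> splits_as nu ->
  seq_mset (block 0 beta nu) = beta.
Proof. by move=> _ /andP[/eqP h _]; rewrite /block drop0. Qed.
Lemma splits_as_blockR nu : seq_mset nu = delta -> splits_as nu ->
  seq_mset (block (size beta) gamma nu) = gamma.
Proof.
move=> _ /andP[_ /eqP h]; rewrite /block -[in RHS]h -[in take _]h.
by rewrite (perm_size (perm_eq_seq_mset _)) take_size.
Qed.
Lemma splits_as_swapL s i j t : (0 <= size s)%N ->
    ((size s).+1 < 0 + size beta)%N ->
  splits_as (s ++ [:: i, j & t]) = splits_as (s ++ [:: j, i & t]).
Proof.
move=> _; rewrite /splits_as; move: (size beta) => b hs.
have {hs} -> : b = (size s + (b - (size s).+2).+2)%N by lia.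
rewrite !take_cat !drop_cat ltnNge leq_addr /= addKn /=.
by rewrite (wseq_swap _ i j).
Qed.
Lemma splits_as_swapR s i j t : (size beta <= size s)%N ->
    ((size s).+1 < size beta + size gamma)%N ->
  splits_as (s ++ [:: i, j & t]) = splits_as (s ++ [:: j, i & t]).
Proof.
move=> hs _; rewrite /splits_as; move: (size beta) hs => b hs.
have hd j1 j2 : drop b (s ++ [:: j1, j2 & t]) = drop b s ++ [:: j1, j2 & t].
  by rewrite drop_cat; case: ltngtP hs => // -> _; rewrite subnn drop_size.
have ht j1 j2 : take b (s ++ [:: j1, j2 & t]) = take b s.
  by rewrite take_cat; case: ltngtP hs => // -> _; rewrite subnn take_size cats0.
by rewrite !hd !ht (wseq_swap _ i j).
Qed.

Variables (M : lmodType (qha D beta)) (N : lmodType (qha D gamma)).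

(* [TPure r m n] is r e(beta,gamma) (x) (m (x) n) *)
Inductive tensor_term : Type :=
| TPure of R & M & N | TNull | TNeg of tensor_term
| TPlus of tensor_term & tensor_term.

Inductive tensor_eq : tensor_term -> tensor_term -> Prop :=
| tens_refl s : tensor_eq s s
| tens_sym s t : tensor_eq s t -> tensor_eq t s
| tens_trans s t u : tensor_eq s t -> tensor_eq t u -> tensor_eq s u
| tens_neg s s' : tensor_eq s s' -> tensor_eq (TNeg s) (TNeg s')
| tens_plus s s' t t' :
    tensor_eq s s' -> tensor_eq t t' -> tensor_eq (TPlus s t) (TPlus s' t')
| tens_plusA s t u : tensor_eq (TPlus s (TPlus t u)) (TPlus (TPlus s t) u)
| tens_plusC s t : tensor_eq (TPlus s t) (TPlus t s)
| tens_plus0 s : tensor_eq (TPlus TNull s) s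
| tens_plusN s : tensor_eq (TPlus (TNeg s) s) TNull
| tens_addl r r' m n :
    tensor_eq (TPure (r + r') m n) (TPlus (TPure r m n) (TPure r' m n))
| tens_addm r m m' n :
    tensor_eq (TPure r (m + m') n) (TPlus (TPure r m n) (TPure r m' n))
| tens_addr r m n n' :
    tensor_eq (TPure r m (n + n')) (TPlus (TPure r m n) (TPure r m n'))
| tens_balanced r a b m n :
    tensor_eq (TPure (r * (iotaL a * iotaR b)) m n)
              (TPure r (a *: m) (b *: n)).

HB.instance Definition _ := gen_eqMixin tensor_term.
HB.instance Definition _ := gen_choiceMixin tensor_term.

Definition tensor_eqb (s t : tensor_term) : bool := `[< tensor_eq s t >].
Lemma tensor_eqb_equiv : equiv_class_of tensor_eqb.
Proof.
split=> [t|t u|u t v].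
- by apply/asboolP; apply: tens_refl.
- by apply/asboolP/asboolP; apply: tens_sym.
- by move=> /asboolP h1 /asboolP h2; apply/asboolP; apply: tens_trans h1 h2.
Qed.
Canonical tensor_eqb_equivRel := EquivRelPack tensor_eqb_equiv.

Definition conv : Type := {eq_quot tensor_eqb}.
HB.instance Definition _ := Choice.on conv.
HB.instance Definition _ : EqQuotient tensor_term tensor_eqb conv :=
  EqQuotient.on conv.

Definition tclass (t : tensor_term) : conv := \pi_conv t.

(* r e(beta,gamma) (x) (m (x) n) *)
Definition tpure (r : R) (m : M) (n : N) : conv := tclass (TPure r m n).

Lemma tclassP t u : tclass t = tclass u <-> tensor_eq t u.
Proof.
split=> [/eqP|h]; first by rewrite /tclass piE => /asboolP.
by apply/eqP; rewrite /tclass piE; apply/asboolP.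
Qed.
Lemma tclass_repr (w : conv) : tclass (repr w) = w.
Proof. exact: reprK. Qed.
Lemma repr_tclass t : tensor_eq (repr (tclass t)) t.
Proof. by apply/tclassP; rewrite tclass_repr. Qed.
Lemma tclassW (P : conv -> Prop) : (forall t, P (tclass t)) -> forall w, P w.
Proof. by move=> h w; rewrite -(tclass_repr w). Qed.

Definition tens_add (v w : conv) : conv := tclass (TPlus (repr v) (repr w)).
Definition tens_opp (v : conv) : conv := tclass (TNeg (repr v)).
Lemma tens_addE s t : tens_add (tclass s) (tclass t) = tclass (TPlus s t).
Proof. by apply/tclassP/tens_plus; apply: repr_tclass. Qed.
Lemma tens_oppE s : tens_opp (tclass s) = tclass (TNeg s).
Proof. by apply/tclassP/tens_neg/repr_tclass. Qed.

Fact tens_addA : associative tens_add.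
Proof.
elim/tclassW=> t; elim/tclassW=> u; elim/tclassW=> v.
by rewrite !tens_addE; apply/tclassP/tens_plusA.
Qed.
Fact tens_addC : commutative tens_add.
Proof.
by elim/tclassW=> t; elim/tclassW=> u; rewrite !tens_addE; apply/tclassP/tens_plusC.
Qed.
Fact tens_add0 : left_id (tclass TNull) tens_add.
Proof. by elim/tclassW=> t; rewrite !tens_addE; apply/tclassP/tens_plus0. Qed.
Fact tens_addN : left_inverse (tclass TNull) tens_opp tens_add.
Proof.
by elim/tclassW=> t; rewrite tens_oppE tens_addE; apply/tclassP/tens_plusN.
Qed.
HB.instance Definition _ :=
  GRing.isZmodule.Build conv tens_addA tens_addC tens_add0 tens_addN.

Lemma tclassD s t : tclass (TPlus s t) = tclass s + tclass t.
Proof. by rewrite -tens_addE. Qed.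
Lemma tclassN s : tclass (TNeg s) = - tclass s.
Proof. by rewrite -tens_oppE. Qed.

Lemma conv_ind (P : conv -> Prop) :
    P 0 -> (forall v w, P v -> P w -> P (v + w)) -> (forall v, P v -> P (- v)) ->
    (forall r m n, P (tpure r m n)) ->
  forall w, P w.
Proof.
move=> h0 hD hN hP; elim/tclassW; elim=> [r m n||s hs|s hs t ht].
- exact: hP.
- exact: h0.
- by rewrite tclassN; apply: hN.
- by rewrite tclassD; apply: hD.
Qed.

Lemma tpureDl m n : {morph (fun r => tpure r m n) : r r' / r + r'}.
Proof. by move=> r r'; rewrite -tclassD; apply/tclassP/tens_addl. Qed.
Lemma tpureDm r n : {morph (fun m => tpure r m n) : m m' / m + m'}.
Proof. by move=> m m'; rewrite -tclassD; apply/tclassP/tens_addm. Qed.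
Lemma tpureDr r m : {morph tpure r m : n n' / n + n'}.
Proof. by move=> n n'; rewrite -tclassD; apply/tclassP/tens_addr. Qed.
Lemma tpure_balanced r a b m n :
  tpure (r * (iotaL a * iotaR b)) m n = tpure r (a *: m) (b *: n).
Proof. exact/tclassP/tens_balanced. Qed.

Section Lift.
Variables (V : zmodType) (f : R -> M -> N -> V).

Fixpoint tlift_term (t : tensor_term) : V :=
  match t with
  | TPure r m n => f r m n
  | TNull => 0
  | TNeg s => - tlift_term s
  | TPlus s t => tlift_term s + tlift_term t
  end.
Definition tlift (w : conv) : V := tlift_term (repr w).

Hypothesis fDl : forall m n, {morph (fun r => f r m n) : r r' / r + r'}.
Hypothesis fDm : forall r n, {morph (fun m => f r m n) : m m' / m + m'}.
Hypothesis fDr : forall r m, {morph f r m : n n' / n + n'}.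
Hypothesis fB : forall r a b m n,
  f (r * (iotaL a * iotaR b)) m n = f r (a *: m) (b *: n).

Lemma tlift_class t : tlift (tclass t) = tlift_term t.
Proof.
suff h s u : tensor_eq s u -> tlift_term s = tlift_term u.
  exact/h/repr_tclass.
elim=> //= {s u} [s v u _ -> _ -> //|s s' _ -> //
 
  |s s' v v' _ -> _ -> //|s v u|s v|s|s|r r' m n|r m m' n].
- exact: addrA.
- exact: addrC.
- exact: add0r.
- exact: addNr.
- exact: fDl.
- exact: fDm.
Qed.
Lemma tlift_pure r m n : tlift (tpure r m n) = f r m n.
Proof. exact: tlift_class. Qed.
Lemma tlift_add : {morph tlift : v w / v + w}.
Proof.
by elim/tclassW=> s; elim/tclassW=> t; rewrite -tclassD !tlift_class.
Qed.
Lemma tlift_zmod : zmod_morphism tlift.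
Proof.
move=> v w; apply: (addIr (tlift w)); rewrite -tlift_add !subrK //.
Qed.
End Lift.

Definition conv_scale (a : R) : conv -> conv :=
  tlift (fun r m n => tpure (a * r) m n).

Section ScaleHyps.
Variable a : R.
Let f (r : R) (m : M) (n : N) := tpure (a * r) m n.
Fact conv_scale_fDl m n : {morph (fun r => f r m n) : r r' / r + r'}.
Proof. by move=> r r'; rewrite /f mulrDr tpureDl. Qed.
Fact conv_scale_fDm r n : {morph (fun m => f r m n) : m m' / m + m'}.
Proof. exact: tpureDm. Qed.
Fact conv_scale_fDr r m : {morph f r m : n n' / n + n'}.
Proof. exact: tpureDr. Qed.
Fact conv_scale_fB r b c m n :
  f (r * (iotaL b * iotaR c)) m n = f r (b *: m) (c *: n).
Proof. by rewrite /f mulrA tpure_balanced. Qed.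
Fact conv_scale_pure r m n : conv_scale a (tpure r m n) = tpure (a * r) m n.
Proof.
exact: tlift_pure conv_scale_fDl conv_scale_fDm conv_scale_fDr conv_scale_fB _ _ _.
Qed.
Fact conv_scale_zmod : zmod_morphism (conv_scale a).
Proof.
exact: tlift_zmod conv_scale_fDl conv_scale_fDm conv_scale_fDr conv_scale_fB.
Qed.
HB.instance Definition _ :=
  GRing.isZmodMorphism.Build conv conv (conv_scale a) conv_scale_zmod.
Fact conv_scaleD : {morph conv_scale a : v w / v + w}.
Proof. exact: raddfD. Qed.
Fact conv_scaleN : {morph conv_scale a : v / - v}.
Proof. exact: raddfN. Qed.
Fact conv_scale0 : conv_scale a 0 = 0.
Proof. exact: raddf0. Qed.
End ScaleHyps.

Fact conv_scaleA a b w : conv_scale a (conv_scale b w) = conv_scale (a * b) w.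
Proof.
elim/conv_ind: w => [|v w hv hw|v hv|r m n].
- by rewrite !conv_scale0.
- by rewrite !conv_scaleD hv hw.
- by rewrite !conv_scaleN hv.
- by rewrite !conv_scale_pure mulrA.
Qed.
Fact conv_scale1 : left_id 1 conv_scale.
Proof.
elim/conv_ind => [|v w hv hw|v hv|r m n].
- by rewrite conv_scale0.
- by rewrite conv_scaleD hv hw.
- by rewrite conv_scaleN hv.
- by rewrite conv_scale_pure mul1r.
Qed.
Fact conv_scaleDr : right_distributive conv_scale +%R.
Proof. by move=> a v w; rewrite conv_scaleD. Qed.
Fact conv_scaleDl w : {morph conv_scale^~ w : a b / a + b}.
Proof.
move=> a b; elim/conv_ind: w => [|v w hv hw|v hv|r m n].
- by rewrite !conv_scale0 addr0.
- by rewrite !conv_scaleD hv hw addrACA.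
- by rewrite !conv_scaleN hv opprD.
- by rewrite !conv_scale_pure mulrDl tpureDl.
Qed.
HB.instance Definition _ := GRing.Zmodule_isLmodule.Build R conv
  conv_scaleA conv_scale1 conv_scaleDr conv_scaleDl.

Lemma tpureZ a r m n : a *: tpure r m n = tpure (a * r) m n.
Proof. exact: conv_scale_pure. Qed.

End Convolution.

Arguments conv {K I C D} delta {beta gamma} M N.
Arguments tpure {K I C D} delta {beta gamma M N} r m n.

Section ConvolutionMaps.
Variables (K : fieldType) (I : choiceType) (C : cartan_datum I).
Variables (D : qh_datum K C) (delta beta gamma : {mset I}).
Variables (M M' : lmodType (qha D beta)) (N N' : lmodType (qha D gamma)).
Variables (f : {linear M -> M'}) (g : {linear N -> N'}).

Definition conv_map : conv delta M N -> conv delta M' N' :=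
  tlift (fun r m n => tpure delta r (f m) (g n)).

Let h (r : qha D delta) (m : M) (n : N) := tpure delta r (f m) (g n).
Fact conv_map_fDl m n : {morph (fun r => h r m n) : r r' / r + r'}.
Proof. exact: tpureDl. Qed.
Fact conv_map_fDm r n : {morph (fun m => h r m n) : m m' / m + m'}.
Proof. by move=> m m'; rewrite /h raddfD tpureDm. Qed.
Fact conv_map_fDr r m : {morph h r m : n n' / n + n'}.
Proof. by move=> n n'; rewrite /h raddfD tpureDr. Qed.
Fact conv_map_fB r b c m n :
  h (r * (iotaL delta gamma b * iotaR delta beta c)) m n = h r (b *: m) (c *: n).
Proof. by rewrite /h tpure_balanced !linearZ. Qed.
Lemma conv_map_pure r m n :
  conv_map (tpure delta r m n) = tpure delta r (f m) (g n).
Proof.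
exact: tlift_pure conv_map_fDl conv_map_fDm conv_map_fDr conv_map_fB _ _ _.
Qed.
Fact conv_map_zmod : zmod_morphism conv_map.
Proof. exact: tlift_zmod conv_map_fDl conv_map_fDm conv_map_fDr conv_map_fB. Qed.
HB.instance Definition _ := GRing.isZmodMorphism.Build (conv delta M N)
  (conv delta M' N') conv_map conv_map_zmod.
Fact conv_mapD : {morph conv_map : v w / v + w}.
Proof. exact: raddfD. Qed.
Fact conv_mapN : {morph conv_map : v / - v}.
Proof. exact: raddfN. Qed.
Fact conv_map0 : conv_map 0 = 0.
Proof. exact: raddf0. Qed.
Fact conv_map_scalable : scalable conv_map.
Proof.
move=> a; elim/conv_ind => [|v w hv hw|v hv|r m n].
- by rewrite scaler0 !conv_map0 scaler0.
- by rewrite scalerDr !conv_mapD hv hw scalerDr.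
- by rewrite scalerN !conv_mapN hv scalerN.
- by rewrite tpureZ !conv_map_pure tpureZ.
Qed.
HB.instance Definition _ := GRing.isScalable.Build (qha D delta) (conv delta M N)
  (conv delta M' N') *:%R conv_map conv_map_scalable.
End ConvolutionMaps.

(* M o_z N = Coker(z o id_N - id_M o z) *)
Definition conv_z (K : fieldType) (I : choiceType) (C : cartan_datum I)
    (D : qh_datum K C) (delta beta gamma : {mset I})
    (M : lmodType (qha D beta)) (N : lmodType (qha D gamma))
    (zM : {linear M -> M}) (zN : {linear N -> N}) : Type :=
  coker (fun w : conv delta M N => conv_map zM idfun w - conv_map idfun zN w).
HB.instance Definition _ (K : fieldType) (I : choiceType) (C : cartan_datum I)
    (D : qh_datum K C) (delta beta gamma : {mset I})
    (M : lmodType (qha D beta)) (N : lmodType (qha D gamma))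
    (zM : {linear M -> M}) (zN : {linear N -> N}) :=
  GRing.Lmodule.on (conv_z delta zM zN).

Section ConvolutionWithSimpleRoot.
Variables (K : fieldType) (I : choiceType) (C : cartan_datum I).
Variables (D : qh_datum K C) (i : I) (beta : {mset I}).
Local Notation n := (size beta).

(* <i>_z = R(alpha_i), with z acting by (right multiplication by) x_1 *)
Definition Li : Type := (qha D [mset i])^o.
HB.instance Definition _ := GRing.Lmodule.on Li.

Definition Li_z (u : Li) : Li := (u : qha D [mset i]) * qx 1.
Fact Li_z_linear : linear Li_z.
Proof. by move=> a u v; rewrite /Li_z mulrDl -mulrA. Qed.
HB.instance Definition _ :=
  GRing.isLinear.Build (qha D [mset i]) Li Li *:%R Li_z Li_z_linear.

Definition Li_gen : Li := (1 : qha D [mset i]).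

Variables (N : lmodType (qha D (beta `\ i))) (z : {linear N -> N}).

(* N o_z <i>_z, as an R(beta)-module *)
Definition conv_Li : Type := conv_z beta z Li_z.
HB.instance Definition _ := GRing.Lmodule.on conv_Li.

(* v (x) <i>_z *)
Definition pure_Li (v : N) : conv_Li := mod_proj _ (tpure beta 1 v Li_gen).

(* The canonical projection E_i(N o_z <i>_z) -> N given by the decomposition
   N o_z <i>_z = (+)_{1 <= a <= n} tau_a ... tau_{n-1} (N (x) <i>_z). *)
Definition shuffle_projection (p : Ei i conv_Li -> N) : Prop :=
  (forall v : N, p (Er i ((\prod_(1 <= l < n) qtau l) *: pure_Li v)) = v)
  /\ (forall (a : nat) (v : N), (1 < a <= n)%N ->
        p (Er i ((\prod_(a <= l < n) qtau l) *: pure_Li v)) = 0).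

End ConvolutionWithSimpleRoot.

Arguments conv_Li {K I C D} i {beta N} z.
Arguments pure_Li {K I C D} i {beta N} z v.
Arguments shuffle_projection {K I C D} i {beta N} z p.

Section Gradings.
Variables (K : fieldType) (I : choiceType) (C : cartan_datum I).
Variables (D : qh_datum K C).

(* [qha_deg d r]: r is homogeneous of degree d in R(beta) *)
Inductive qha_deg (beta : {mset I}) : int -> qha D beta -> Prop :=
| qdeg_e nu : qha_deg 0 (qe nu)
| qdeg_x s i t : qha_deg (root_form C i i) (qx (size s).+1 * qe (s ++ i :: t))
| qdeg_tau s i j t :
    qha_deg (- root_form C i j) (qtau (size s).+1 * qe (s ++ [:: i, j & t]))
| qdeg_0 d : qha_deg d 0
| qdeg_add d a b : qha_deg d a -> qha_deg d b -> qha_deg d (a + b)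
| qdeg_const d c a : qha_deg d a -> qha_deg d (qconst c * a)
| qdeg_mul d d' a b : qha_deg d a -> qha_deg d' b -> qha_deg (d + d') (a * b).

(* [G d u]: u is homogeneous of degree d, for a Z-grading of the module M *)
Record grading (beta : {mset I}) (M : lmodType (qha D beta))
    (G : int -> M -> Prop) : Prop := Grading {
  grading_0 : forall d, G d 0;
  grading_add : forall d u v, G d u -> G d v -> G d (u + v);
  grading_scale : forall d d' a u, qha_deg d a -> G d' u -> G (d + d') (a *: u);
  grading_span : forall u, exists (s : seq int) (f : int -> M),
    [/\ uniq s, forall d, G d (f d) & u = \sum_(d <- s) f d];
  grading_direct : forall (s : seq int) (f : int -> M), uniq s ->
    (forall d, G d (f d)) -> \sum_(d <- s) f d = 0 ->
    forall d, d \in s -> f d = 0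
}.

Definition Ei_deg (i : I) (beta : {mset I}) (M : lmodType (qha D beta))
    (G : int -> M -> Prop) (d : int) (u : Ei i M) : Prop := G d (Ei_val u).

Inductive conv_deg (delta beta gamma : {mset I})
    (M : lmodType (qha D beta)) (N : lmodType (qha D gamma))
    (GM : int -> M -> Prop) (GN : int -> N -> Prop) :
    int -> conv delta M N -> Prop :=
| cdeg_pure a b c r m n : qha_deg a r -> GM b m -> GN c n ->
    conv_deg GM GN (a + b + c) (tpure delta r m n)
| cdeg_0 d : conv_deg GM GN d 0
| cdeg_add d v w : conv_deg GM GN d v -> conv_deg GM GN d w ->
    conv_deg GM GN d (v + w).

Definition Li_deg (i : I) (d : int) (u : Li D i) : Prop :=
  qha_deg d (u : qha D [mset i]).

(* the grading of N o_z <i>_z as a quotient of N o <i>_z *)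
Definition conv_Li_deg (i : I) (beta : {mset I})
    (N : lmodType (qha D (beta `\ i))) (z : {linear N -> N})
    (G : int -> N -> Prop) (d : int) (w : conv_Li i z) : Prop :=
  exists2 v : conv beta N (Li D i),
    conv_deg G (@Li_deg i) d v & w = mod_proj _ v.

End Gradings.

(* (alpha_i, wt(M)) for an R(beta)-module M, where wt(M) = - beta *)
Definition root_form_wt (I : choiceType) (C : cartan_datum I) (i : I)
  (beta : {mset I}) : int := - \sum_(j <- (beta : seq I)) root_form C i j.

Section J.
Variables (K : fieldType) (I : choiceType) (C : cartan_datum I).
Variables (D : qh_datum K C) (i : I) (beta : {mset I}).
Variable (M : lmodType (qha D beta)).
Local Notation n := (size beta).

(* The formula for u in e(nu)M, extended linearly by u = sum_nu e(nu)u. *)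
Definition J_map (u : M) : conv_Li i (Ei_z i M) :=
  \sum_(nu <- wseqs beta) \sum_(1 <= a < n.+1 | nth i nu a.-1 == i)
    (\prod_(a <= l < n) qtau l)
    *: pure_Li i (Ei_z i M)
         (Er i ((\prod_(1 <= l < a) qtau l) *: (qe nu *: u))).

End J.

Arguments J_map {K I C D} i {beta} M u.

(* Main.v *)
From HB Require Import structures.
Require Import Defs.
From mathcomp Require Import all_boot all_order all_algebra.
From mathcomp Require Import finmap multiset boolp functions zify.

Set Implicit Arguments.
Unset Strict Implicit.
Unset Printing Implicit Defensive.

Import Order.TTheory GRing.Theory Num.Theory.
Local Open Scope mset_scope.
Local Open Scope ring_scope.

(** Write N = E_i M, n = ht(beta), b_a = tau_a ... tau_{n-1} and
    b*_a = tau_1 ... tau_{a-1}.  The existence of the shuffle projection p does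
    not need the basis theorem for R(beta): let R(beta) act on the n-tuples of
    Laurent series in 1/t with coefficients in N, the a-th entry standing for the
    words in which the strand of colour i and variable t sits at position a.  The
    action of tau_l mixes the entries l and l+1 through 1/(t - x_k) and
    Q_{j,i}(x_k, t); reading off the first entry and substituting z for t gives p.

    In this representation b*_c b_a has first entry delta_{a,c} on the vector
    supported at the last position, so that w = sum_a b_a p(b*_a w) for every w in
    N o_z <i>_z.  Since J(u) = sum_a b_a r(b*_a u), and since e(i, * )R(beta) is
    spanned by the products (shift of R(beta - alpha_i)) x_1^k b*_c, one gets
    p(x J(u)) = r(x u) for all x in R(beta); linearity of J and (ii) follow. *)

(** * Endomorphisms commuting with the ground field *)

(** A straightening argument shows that the b_a v span N o_z <i>_z, but a map out of a tensor
    product cannot be defined on spanning elements: their independence is what the basis theorem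
    would provide. A module in which coefficients can be read off replaces it. Its tau_l is forced.
    Exchanging x_l and x_(l+1) up to a Kronecker delta requires diagonal entries -g and g with (t -
    x_l) g = 1 on words whose letter at l is i, and g = 0 on the others. The matrix with rows (-g,
    1) and (q, g) has trace zero and square q + g^2, which must be Q. The denominators t - x_k rule
    out polynomials in t; expanding in 1/t inverts them without inverting x_k. The price is that the
    substitution of z for t does not turn multiplication by t into z once negative powers occur.
    What saves it is that vectors coming from N o <i>_z have a first entry polynomial in t, a
    consequence of the spanning argument. Thus spanning serves the existence of p as well as its
    uniqueness. *)

Section Endomorphisms.
Variables (K : fieldType) (A : pzRingType) (c : {rmorphism K -> A}).
Variable V : lmodType A.

(** Multiplication by an element of [A] is not [A]-linear, so these operators are only asked to
    commute with the scalars of the ground field, which reach [V] through [c]. This centrality is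
    what [corner_ev] requires of its target ring. *)
Record endo : Type := Endo {
  efun :> V -> V;
  endoB : zmod_morphism efun;
  endoZ : forall d v, efun (c d *: v) = c d *: efun v }.

HB.instance Definition _ := gen_eqMixin endo.
HB.instance Definition _ := gen_choiceMixin endo.
HB.instance Definition _ (f : endo) :=
  GRing.isZmodMorphism.Build V V f (endoB f).

Lemma efunB (f : endo) u v : f (u - v) = f u - f v. Proof. exact: raddfB. Qed.
Lemma efunD (f : endo) u v : f (u + v) = f u + f v. Proof. exact: raddfD. Qed.
Lemma efunN (f : endo) u : f (- u) = - f u. Proof. exact: raddfN. Qed.
Lemma efun0 (f : endo) : f 0 = 0. Proof. exact: raddf0. Qed.

Lemma endoP (f g : endo) : f =1 g -> f = g.
Proof.
case: f g => [f fB fZ] [g gB gZ] /= /funext fg; case: _ / fg in gB gZ *.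
by congr Endo; apply: Prop_irrelevance.
Qed.

Lemma endo0_additive : zmod_morphism (fun _ : V => 0 : V).
Proof. by move=> u v; rewrite subr0. Qed.
Definition endo0 := Endo endo0_additive (fun d _ => esym (scaler0 V (c d))).

Definition endo1 : endo :=
  @Endo id (fun u v => erefl) (fun d v => erefl).

Lemma endo_add_additive (f g : endo) : zmod_morphism (fun v => f v + g v).
Proof. by move=> u v /=; rewrite !raddfB opprD addrACA. Qed.
Lemma endo_add_scale (f g : endo) d v :
  f (c d *: v) + g (c d *: v) = c d *: (f v + g v).
Proof. by rewrite !endoZ scalerDr. Qed.
Definition endo_add f g := Endo (endo_add_additive f g) (endo_add_scale f g).

Lemma endo_opp_additive (f : endo) : zmod_morphism (fun v => - f v).
Proof. by move=> u v /=; rewrite raddfB opprD. Qed.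
Lemma endo_opp_scale (f : endo) d v : - f (c d *: v) = c d *: (- f v).
Proof. by rewrite endoZ scalerN. Qed.
Definition endo_opp f := Endo (endo_opp_additive f) (endo_opp_scale f).

Lemma endo_mul_additive (f g : endo) : zmod_morphism (fun v => f (g v)).
Proof. by move=> u v /=; rewrite !raddfB. Qed.
Lemma endo_mul_scale (f g : endo) d v : f (g (c d *: v)) = c d *: f (g v).
Proof. by rewrite !endoZ. Qed.
Definition endo_mul f g := Endo (endo_mul_additive f g) (endo_mul_scale f g).

Fact endo_addA : associative endo_add.
Proof. by move=> f g h; apply: endoP => v /=; rewrite addrA. Qed.
Fact endo_addC : commutative endo_add.
Proof. by move=> f g; apply: endoP => v /=; rewrite addrC. Qed.
Fact endo_add0 : left_id endo0 endo_add.
Proof. by move=> f; apply: endoP => v /=; rewrite add0r. Qed.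
Fact endo_addN : left_inverse endo0 endo_opp endo_add.
Proof. by move=> f; apply: endoP => v /=; rewrite addNr. Qed.
Fact endo_mulA : associative endo_mul.
Proof. by move=> f g h; apply: endoP. Qed.
Fact endo_mul1l : left_id endo1 endo_mul.
Proof. by move=> f; apply: endoP. Qed.
Fact endo_mul1r : right_id endo1 endo_mul.
Proof. by move=> f; apply: endoP. Qed.
Fact endo_mulDl : left_distributive endo_mul endo_add.
Proof. by move=> f g h; apply: endoP. Qed.
Fact endo_mulDr : right_distributive endo_mul endo_add.
Proof. by move=> f g h; apply: endoP => v /=; rewrite raddfD. Qed.

HB.instance Definition _ := GRing.isPzRing.Build endo
  endo_addA endo_addC endo_add0 endo_addN endo_mulA endo_mul1l endo_mul1r
  endo_mulDl endo_mulDr.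

Lemma endoM_app (f g : endo) v : (f * g) v = f (g v). Proof. by []. Qed.
Lemma endoD_app (f g : endo) v : (f + g) v = f v + g v. Proof. by []. Qed.
Lemma endoN_app (f : endo) v : (- f) v = - f v. Proof. by []. Qed.
Lemma endo0_app v : (0 : endo) v = 0. Proof. by []. Qed.
Lemma endo_sum_app (T : Type) (s : seq T) (P : pred T) (F : T -> endo) v :
  (\sum_(j <- s | P j) F j) v = \sum_(j <- s | P j) F j v.
Proof. by elim/big_rec2: _ => // j x f _ <-. Qed.

Lemma cscaleC d d' (v : V) : c d *: (c d' *: v) = c d' *: (c d *: v).
Proof. by rewrite !scalerA -!rmorphM mulrC. Qed.

Definition endo_const (d : K) : endo :=
  @Endo ( *:%R (c d)) (scalerBr (c d)) (cscaleC d).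
Fact endo_const_zmod : zmod_morphism endo_const.
Proof. by move=> d d'; apply: endoP => v /=; rewrite rmorphB scalerBl. Qed.
Fact endo_const_monoid : monoid_morphism endo_const.
Proof.
split; first by apply: endoP => v /=; rewrite rmorph1 scale1r.
by move=> d d'; apply: endoP => v /=; rewrite rmorphM scalerA.
Qed.
HB.instance Definition _ :=
  GRing.isZmodMorphism.Build K endo endo_const endo_const_zmod.
HB.instance Definition _ :=
  GRing.isMonoidMorphism.Build K endo endo_const endo_const_monoid.

Lemma endo_constC d (f : endo) : endo_const d * f = f * endo_const d.
Proof. by apply: endoP => v /=; rewrite endoZ. Qed.

Hypothesis cC : forall d a, c d * a = a * c d.

Lemma endo_scale_scale a d (v : V) : a *: (c d *: v) = c d *: (a *: v).
Proof. by rewrite !scalerA cC. Qed.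
Definition endo_scale (a : A) : endo :=
  @Endo ( *:%R a) (scalerBr a) (endo_scale_scale a).
Fact endo_scale_zmod : zmod_morphism endo_scale.
Proof. by move=> a b; apply: endoP => v /=; rewrite scalerBl. Qed.
Fact endo_scale_monoid : monoid_morphism endo_scale.
Proof.
split; first by apply: endoP => v /=; rewrite scale1r.
by move=> a b; apply: endoP => v /=; rewrite scalerA.
Qed.
HB.instance Definition _ :=
  GRing.isZmodMorphism.Build A endo endo_scale endo_scale_zmod.
HB.instance Definition _ :=
  GRing.isMonoidMorphism.Build A endo endo_scale endo_scale_monoid.

End Endomorphisms.

(** * Quiver Hecke generators modulo polynomials *)

Section Bivariate.
Variables (K : nzRingType) (A : pzRingType) (c : {rmorphism K -> A}).
Hypothesis cC : forall d a, c d * a = a * c d.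
Implicit Types (q : {poly {poly K}}) (a b x : A).

(** Padding with zero coefficients puts [q] and [swapXY q] over the same square of exponents, so
    that [bieval_swapXY] becomes an exchange of summations. *)
Lemma bieval_wide q a b m : (size q <= m)%N ->
    (forall r : nat, (size (q`_r)%R <= m)%N) ->
  bieval c q a b = \sum_(r < m) \sum_(p < m) c q`_r`_p * (a ^+ p * b ^+ r).
Proof.
move=> hm hq; rewrite /bieval (big_ord_widen m (fun r : nat =>
  \sum_(p < size q`_r) c q`_r`_p * (a ^+ p * b ^+ r))) // big_mkcond.
apply: eq_bigr => r _; case: ltnP => hr; last first.
  by rewrite big1 // => p _; rewrite (nth_default 0 hr) coef0 rmorph0 mul0r.
rewrite (big_ord_widen m (fun p : nat => c q`_r`_p * (a ^+ p * b ^+ r))) //.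
rewrite big_mkcond; apply: eq_bigr => p _; case: ltnP => // hp.
by rewrite (nth_default 0 hp) rmorph0 mul0r.
Qed.

Lemma bieval_swapXY q a b : GRing.comm a b ->
  bieval c (swapXY q) a b = bieval c q b a.
Proof.
move=> ab; pose m := maxn (maxn (size q) (sizeY q)) (maxn (size (swapXY q)) (sizeY (swapXY q))).
have h1 r := max_size_coefXY q r; have h2 r := max_size_coefXY (swapXY q) r.
rewrite !(@bieval_wide _ _ _ m) /m; try by [lia | move=> r; have := h1 r; lia
  | move=> r; have := h2 r; lia].
rewrite exchange_big; apply: eq_bigr => r _; apply: eq_bigr => p _.
by rewrite coef_swapXY (commrX _ (commr_sym (commrX _ (commr_sym ab)))).
Qed.

Lemma comm_sum (T : Type) (s : seq T) (P : pred T) (F : T -> A) x :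
  (forall j, GRing.comm x (F j)) -> GRing.comm x (\sum_(j <- s | P j) F j).
Proof.
move=> h; apply: big_ind => [||j _]; [exact: commr0 | exact: commrD | exact: h].
Qed.

Lemma comm_const x d : GRing.comm x (c d).
Proof. exact/commr_sym/cC. Qed.

Lemma comm_bieval q a b x : GRing.comm x a -> GRing.comm x b ->
  GRing.comm x (bieval c q a b).
Proof.
move=> xa xb; apply: comm_sum => r; apply: comm_sum => p.
by apply/commrM; [exact: comm_const | apply: commrM; apply: commrX].
Qed.

Lemma comm_bidiff q a b a' x : GRing.comm x a -> GRing.comm x b ->
  GRing.comm x a' -> GRing.comm x (bidiff c q a b a').
Proof.
move=> xa xb xa'; apply: comm_sum => r; apply: comm_sum => p.
apply/commrM; first exact: comm_const.
apply: commrM; last exact: commrX.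
by apply: comm_sum => s; apply: commrM; apply: commrX.
Qed.

End Bivariate.

(** * Adjacent transpositions of words *)

Section WordSwap.
Variable I : Type.
Implicit Types (s t : seq I).

(** A total form of s_l: a tail with fewer than two letters is left alone, and l = 0 acts as l = 1.
    Both conventions are harmless because [qtau] vanishes out of range, and they give [qtau_qe] and
    [swap_wordK] without side conditions. *)
Definition swap_word (l : nat) (nu : seq I) : seq I :=
  take l.-1 nu ++
  match drop l.-1 nu with j :: k :: t => k :: j :: t | t => t end.

Lemma swap_word_cat s (j k : I) t :
  swap_word (size s).+1 (s ++ [:: j, k & t]) = s ++ [:: k, j & t].
Proof. by rewrite /swap_word /= take_size_cat // drop_size_cat. Qed.

End WordSwap.

(** * The relations of R(beta) modulo its polynomial part *)

Section QuiverHeckeAlgebra.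
Variables (K : fieldType) (I : choiceType) (C : cartan_datum I).
Variables (D : qh_datum K C) (beta : {mset I}).
Local Notation R := (qha D beta).
Local Notation n := (size beta).

Lemma qha_ind (P : R -> Prop) :
    (forall d, P (qconst d)) -> (forall nu, P (qe nu)) -> (forall k, P (qx k)) ->
    (forall l, P (qtau l)) -> (forall a b, P a -> P b -> P (a + b)) ->
    (forall a b, P a -> P b -> P (a * b)) ->
  forall a, P a.
Proof.
move=> hc he hx ht hD hM; elim/ring_projW; elim/fclassW.
elim=> [[nu|k|l]|d|t iht u ihu|t iht u ihu].
- exact: he.
- exact: hx.
- exact: ht.
- exact: hc.
- have -> : fclass (TAdd t u) = fclass t + fclass u by rewrite -faddE.
  by rewrite raddfD; apply: hD.
- have -> : fclass (TMul t u) = fclass t * fclass u by rewrite -fmulE.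
  by rewrite rmorphM; apply: hM.
Qed.

Lemma wseq_swap_word l (nu : seq I) :
  seq_mset (swap_word l nu) = seq_mset nu.
Proof.
rewrite /swap_word -{3}(cat_take_drop l.-1 nu).
case: (drop _ _) => [|j [|k t]] //; exact: wseq_swap.
Qed.

Lemma swap_wordK l : involutive (@swap_word I l).
Proof.
move=> nu; rewrite /swap_word; set s := take _ nu; set r := drop _ nu.
have e : nu = s ++ r by rewrite cat_take_drop.
have ss : size s = minn l.-1 (size nu) by rewrite size_take_min.
have sr : size r = (size nu - l.-1)%N by rewrite size_drop.
(* The swap keeps the length of the tail, so cutting again at [l.-1] returns the same head; when
   [l.-1] exceeds the length of the word, both tails are empty. *)
have h (r' : seq I) : (size r' == size r) ->
    take l.-1 (s ++ r') = s /\ drop l.-1 (s ++ r') = r'.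
  move=> /eqP er; have [sl|sl] := leqP l.-1 (size nu).
    by rewrite take_size_cat ?drop_size_cat //; lia.
  have /nilP -> : nilp r' by rewrite /nilp; lia.
  by rewrite cats0 take_oversize ?drop_oversize //; lia.
have {h} := h; rewrite {}e; case: r {sr} => [|j [|k t]] h.
- by have [|-> ->] := h [::].
- by have [|-> ->] := h [:: j].
- by have [|-> ->] := h [:: k, j & t].
Qed.

Lemma qtau_qe l nu : qtau l * qe nu = qe (swap_word l nu) * qtau l :> R.
Proof.
have [hl|hl] := boolP (1 <= l < n)%N; last by rewrite (qtau_out _ hl) mulr0 mul0r.
have [/eqP hnu|hnu] := boolP (seq_mset nu == beta); last first.
  by rewrite !qe_out ?mulr0 ?mul0r ?wseq_swap_word.
have [s [j [k [t [-> <-]]]]] := wseq_split hnu hl.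
by rewrite qte swap_word_cat.
Qed.

Lemma qe_qtau l nu : qe nu * qtau l = qtau l * qe (swap_word l nu) :> R.
Proof. by rewrite qtau_qe swap_wordK. Qed.

(* Modulo these elements tau_l^2 vanishes, the braid relations hold and the tau_l
   permute the x_k; this is all that the spanning arguments need. *)
Inductive polynomial_part : R -> Prop :=
| pp_x k : polynomial_part (qx k)
| pp_e nu : polynomial_part (qe nu)
| pp_const d : polynomial_part (qconst d)
| pp_sub a b : polynomial_part a -> polynomial_part b -> polynomial_part (a - b)
| pp_mul a b : polynomial_part a -> polynomial_part b -> polynomial_part (a * b).

Lemma pp0 : polynomial_part 0.
Proof. rewrite -(rmorph0 qconst); exact: pp_const. Qed.
Lemma pp1 : polynomial_part 1.
Proof. rewrite -(rmorph1 qconst); exact: pp_const. Qed.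
Lemma pp_add a b : polynomial_part a -> polynomial_part b -> polynomial_part (a + b).
Proof.
move=> ha hb; have -> : a + b = a - (0 - b) by rewrite sub0r opprK.
by apply: pp_sub => //; apply: pp_sub => //; apply: pp0.
Qed.
Lemma pp_sum T (s : seq T) (P : pred T) (F : T -> R) :
  (forall j, polynomial_part (F j)) -> polynomial_part (\sum_(j <- s | P j) F j).
Proof. by move=> h; apply: big_ind => //; [exact: pp0 | exact: pp_add]. Qed.
Lemma pp_exp a m : polynomial_part a -> polynomial_part (a ^+ m).
Proof. by move=> h; elim: m => [|m IHm]; [exact: pp1|rewrite exprS; apply: pp_mul]. Qed.

Lemma pp_bieval q a b : polynomial_part a -> polynomial_part b ->
  polynomial_part (bieval qconst q a b).
Proof.
move=> ha hb; apply: pp_sum => r; apply: pp_sum => p.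
by apply: pp_mul; [exact: pp_const | apply: pp_mul; apply: pp_exp].
Qed.
Lemma pp_bidiff q a b a' : polynomial_part a -> polynomial_part b ->
  polynomial_part a' -> polynomial_part (bidiff qconst q a b a').
Proof.
move=> ha hb ha'; apply: pp_sum => r; apply: pp_sum => p.
apply: pp_mul; first exact: pp_const.
apply: pp_mul; last exact: pp_exp.
by apply: pp_sum => s; apply: pp_mul; apply: pp_exp.
Qed.
Lemma pp_ext a : (forall nu, seq_mset nu = beta -> polynomial_part (a * qe nu)) ->
  polynomial_part a.
Proof.
move=> h; rewrite -[a]mulr1 -qe_sum mulr_sumr big_seq.
apply: big_ind => [||nu]; [exact: pp0 | exact: pp_add |].
by rewrite mem_wseqs => /eqP; apply: h.
Qed.

Lemma pp_qtau_qx l k :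
  polynomial_part (qtau l * qx k - qx (swap_at l k) * qtau l).
Proof.
have [hl|hl] := boolP (1 <= l < n)%N; last first.
  by rewrite (qtau_out _ hl) mulr0 mul0r subr0; exact: pp0.
apply: pp_ext => nu hnu; have [s [i [j [t [-> <-]]]]] := wseq_split hnu hl.
(* The Kronecker deltas are integers, hence values of [qconst]. *)
rewrite qtx; apply: pp_mul (pp_e _); rewrite -(rmorph_nat qconst).
by rewrite -!(rmorph_nat qconst); do ![apply: pp_mul | apply: pp_sub]; apply: pp_const.
Qed.

Lemma pp_qtau2 l : polynomial_part (qtau l * qtau l).
Proof.
have [hl|hl] := boolP (1 <= l < n)%N; last first.
  by rewrite (qtau_out _ hl) mulr0; exact: pp0.
apply: pp_ext => nu hnu; have [s [i [j [t [-> <-]]]]] := wseq_split hnu hl.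
by rewrite -expr2 qt2; apply: pp_mul (pp_e _); apply: pp_bieval; apply: pp_x.
Qed.

Lemma wseq_split3 nu l : seq_mset nu = beta -> (1 <= l)%N -> (l.+1 < n)%N ->
  exists s i j k t, nu = s ++ [:: i, j, k & t] /\ (size s).+1 = l.
Proof.
move=> hnu l1 l2; have [|s [i [j [t [e sl]]]]] := wseq_split (l := l) hnu.
  by rewrite l1 ltnW.
have := wseq_size hnu; rewrite e size_cat /=; case: t e => [|k t] e /=; first by lia.
by move=> _; exists s, i, j, k, t.
Qed.

Lemma pp_braid l : polynomial_part
  (qtau l.+1 * qtau l * qtau l.+1 - qtau l * qtau l.+1 * qtau l).
Proof.
have [l1|l1] := boolP (1 <= l)%N; last first.
  by rewrite (@qtau_out _ _ _ _ _ l) ?(negbTE l1) // !(mulr0, mul0r) subr0; exact: pp0.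
have [l2|l2] := boolP (l.+1 < n)%N; last first.
  by rewrite (@qtau_out _ _ _ _ _ l.+1) ?l1 // !(mulr0, mul0r) subr0; exact: pp0.
apply: pp_ext => nu hnu; have [s [i [j [k [t [-> <-]]]]]] := wseq_split3 hnu l1 l2.
rewrite qbraid; apply: pp_mul (pp_e _); apply: pp_mul.
  by rewrite -(rmorph_nat qconst); apply: pp_const.
by apply: pp_bidiff; apply: pp_x.
Qed.

End QuiverHeckeAlgebra.

(** * Laurent series in 1/t *)

Section Laurent.
Variables (K : fieldType) (A : pzRingType) (c : {rmorphism K -> A}).
Hypothesis cC : forall d a, c d * a = a * c d.
Variable N : lmodType A.

(** The value at d is the coefficient of t^d. Exponents are bounded above only, which is the
    direction in which 1/(t - x) has an expansion in nonnegative powers of x. *)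
Definition laurent_pred : {pred int -> N} :=
  fun f => `[< exists B : nat, forall d : int, B%:Z <= d -> f d = 0 >].
Fact laurent_submod : submod_closed laurent_pred.
Proof.
split=> [|a f g]; first by apply/asboolP; exists 0%N.
move=> /asboolP[B hB] /asboolP[B' hB']; apply/asboolP.
exists (maxn B B') => d hd.
have h1 : B%:Z <= d by lia.
have h2 : B'%:Z <= d by lia.
have -> : (a *: f + g) d = a *: f d + g d by [].
by rewrite hB ?hB' ?scaler0 ?addr0.
Qed.
HB.instance Definition _ :=
  GRing.isSubmodClosed.Build A (int -> N) laurent_pred laurent_submod.

Record laurent : Type := Laurent { coef :> int -> N; _ : coef \in laurent_pred }.
HB.instance Definition _ := [isSub for coef].
HB.instance Definition _ := [Choice of laurent by <:].
HB.instance Definition _ := [SubChoice_isSubLmodule of laurent by <:].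

Lemma laurentP (f g : laurent) : f =1 g -> f = g.
Proof. by move=> h; apply/val_inj/funext. Qed.
Lemma coefD (f g : laurent) d : (f + g) d = f d + g d. Proof. by []. Qed.
Lemma coefB (f g : laurent) d : (f - g) d = f d - g d. Proof. by []. Qed.
Lemma coefZ a (f : laurent) d : (a *: f) d = a *: f d. Proof. by []. Qed.

(** The bound is extracted as data because the definitions of [inv_coef] and [laurent_ev] must name
    a finite range of summation. Two series carry unrelated bounds, so [inv_coefE] and [laurent_evE]
    allow any range beyond the support before sums are compared. *)
Lemma laurent_bound (f : laurent) : {B : nat | forall d : int, B%:Z <= d -> f d = 0}.
Proof. by apply: cid; case: f => f /= /asboolP. Qed.

Fact laurent_shift_mem (f : laurent) : (fun d => f (d - 1)) \in laurent_pred.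
Proof.
have [B hB] := laurent_bound f; apply/asboolP.
by exists B.+1 => d hd; apply: hB; lia.
Qed.
Definition laurent_shift (f : laurent) : laurent := Laurent (laurent_shift_mem f).
Fact laurent_shift_additive : zmod_morphism laurent_shift.
Proof. by move=> f g; apply: laurentP. Qed.
Fact laurent_shift_scale d f : laurent_shift (c d *: f) = c d *: laurent_shift f.
Proof. exact: laurentP. Qed.
Definition laurent_t : endo c laurent :=
  Endo laurent_shift_additive laurent_shift_scale.

Variable x : A.

(* [1 / (t - x) = sum_s x^s t^(-s-1)]; the sum is finite at each coefficient. *)
Definition inv_coef (f : laurent) (d : int) : N :=
  \sum_(s < `|(sval (laurent_bound f))%:Z - d|%N) x ^+ s *: f (d + 1 + s%:Z).

Lemma inv_coefE (f : laurent) d m : (forall s : nat, (m <= s)%N -> f (d + 1 + s%:Z) = 0) ->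
  inv_coef f d = \sum_(s < m) x ^+ s *: f (d + 1 + s%:Z).
Proof.
have vanish (u : nat -> N) m1 m2 : (m1 <= m2)%N ->
    (forall s, (m1 <= s)%N -> u s = 0) -> \sum_(s < m2) u s = \sum_(s < m1) u s.
  move=> h12 h; rewrite [RHS](big_ord_widen m2) // [RHS]big_mkcond; apply: eq_bigr => s _.
  by case: ltnP => // /h.
move=> hm; rewrite /inv_coef; case: laurent_bound => B hB /=; set m' := absz _.
have hm' s : (m' <= s)%N -> f (d + 1 + s%:Z) = 0.
  by move=> hs; apply: hB; rewrite /m' in hs; lia.
pose u s := x ^+ s *: f (d + 1 + Posz s).
case: (leqP m m') => hmm; [|symmetry].
  by apply: (vanish u) => // s hs; rewrite /u hm ?scaler0.
by apply: (vanish u) => [|s hs]; [exact: ltnW | rewrite /u hm' ?scaler0].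
Qed.

Fact laurent_inv_mem (f : laurent) : inv_coef f \in laurent_pred.
Proof.
have [B hB] := laurent_bound f; apply/asboolP; exists B => d hd.
rewrite (@inv_coefE _ _ 0) ?big_ord0 // => s _; apply: hB; lia.
Qed.
Definition laurent_inv (f : laurent) : laurent := Laurent (laurent_inv_mem f).
Fact laurent_inv_additive : zmod_morphism laurent_inv.
Proof.
move=> f g; apply: laurentP => d.
suff: inv_coef (f - g) d = inv_coef f d - inv_coef g d by [].
have [B hB] := laurent_bound f; have [B' hB'] := laurent_bound g.
pose m := `|(maxn B B')%:Z - d|%N.
rewrite !(@inv_coefE _ _ m) /m; try by move=> s hs; rewrite ?coefB ?hB ?hB' ?subr0 //; lia.
by rewrite -sumrB; apply: eq_bigr => s _; rewrite coefB scalerBr.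
Qed.
Fact laurent_inv_scale d f : laurent_inv (c d *: f) = c d *: laurent_inv f.
Proof.
apply: laurentP => k.
suff: inv_coef (c d *: f) k = c d *: inv_coef f k by [].
have [B hB] := laurent_bound f.
pose m := `|B%:Z - k|%N.
rewrite !(@inv_coefE _ _ m) /m; try by move=> s hs; rewrite ?coefZ ?hB ?scaler0 //; lia.
by rewrite scaler_sumr; apply: eq_bigr => s _; rewrite coefZ !scalerA cC.
Qed.
Definition laurent_G : endo c laurent := Endo laurent_inv_additive laurent_inv_scale.

Lemma laurent_tG : (laurent_t - endo_scale laurent cC x) * laurent_G = 1.
Proof.
apply: endoP => f; apply: laurentP => d.
suff: inv_coef f (d - 1) - x *: inv_coef f d = f d by [].
have [B hB] := laurent_bound f.
pose m := `|B%:Z - d|%N.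
(* With one term more at d - 1 than at d, the two sums match term by term after the shift by x, and
   only the leading f d is left. *)
rewrite (@inv_coefE _ _ m.+1) ?(@inv_coefE _ _ m) /m; try by move=> s hs; apply: hB; lia.
rewrite big_ord_recl expr0 scale1r scaler_sumr.
have -> : d - 1 + 1 + (@ord0 `|B%:Z - d|%N)%:Z = d by rewrite /=; lia.
apply/eqP; rewrite subr_eq; apply/eqP; congr (_ + _); apply: eq_bigr => s _.
by rewrite scalerA -exprS; congr (_ *: f _); rewrite /= /bump; lia.
Qed.

Lemma laurent_t_scale a :
  laurent_t * endo_scale laurent cC a = endo_scale laurent cC a * laurent_t.
Proof. by apply: endoP => f; apply: laurentP. Qed.

Lemma laurent_Gt : laurent_G * (laurent_t - endo_scale laurent cC x) = 1.
Proof.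
apply: endoP => f; apply: laurentP => d.
suff: inv_coef (laurent_shift f - x *: f) d = f d by [].
have hf k : (laurent_shift f - x *: f) k = f (k - 1) - x *: f k by [].
have [B hB] := laurent_bound f.
pose m := `|B%:Z - d|%N.
rewrite (@inv_coefE _ _ m.+1) /m; last first.
  by move=> s hs; rewrite hf !hB ?scaler0 ?subr0 //; lia.
under eq_bigr => s _ do rewrite hf scalerBr scalerA -exprSr.
rewrite sumrB big_ord_recl expr0 scale1r big_ord_recr /=.
(* Here both sums have the same length, so the telescoping leaves a last term of the second one; it
   lies beyond the bound of f. *)
rewrite (hB (d + 1 + `|_|%:Z)) ?scaler0 ?addr0; last by lia.
rewrite addrK.
under eq_bigr => s _.
  have -> : d + 1 + (bump 0 s)%:Z - 1 = d + 1 + s%:Z by rewrite /bump; lia.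
  rewrite /bump add1n.
  over.
by rewrite addrK.
Qed.

End Laurent.

(** * Substitution of an endomorphism for t *)

Section LaurentEvaluation.
Variables (K : fieldType) (A : pzRingType) (c : {rmorphism K -> A}).
Variables (N : lmodType A) (z : {linear N -> N}).
Local Notation L := (laurent N).

Fact laurent_monomial_mem k (m : N) :
  (fun d => if d == k%:Z then m else 0) \in @laurent_pred _ N.
Proof. by apply/asboolP; exists k.+1 => d hd; case: eqP => //; lia. Qed.
Definition laurent_monomial k m : L := Laurent (laurent_monomial_mem k m).

Lemma laurent_monomialZ k a m :
  laurent_monomial k (a *: m) = a *: laurent_monomial k m.
Proof.
apply: laurentP => d; rewrite coefZ /=.
by case: ifP; rewrite ?scaler0.
Qed.

Lemma laurent_monomialD k : {morph laurent_monomial k : m m' / m + m'}.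
Proof.
move=> m m'; apply: laurentP => d; rewrite coefD /=.
by case: ifP; rewrite ?addr0.
Qed.

Lemma laurent_monomialS k m :
  laurent_t c N (laurent_monomial k m) = laurent_monomial k.+1 m.
Proof.
apply: laurentP => d /=.
by have -> : (d - 1 == k%:Z) = (d == k.+1%:Z) by apply/eqP/eqP; lia.
Qed.

Lemma iter_linear k a u v : iter k z (a *: u + v) = a *: iter k z u + iter k z v.
Proof. by elim: k => //= k ->; rewrite linearP. Qed.
Lemma iter_linear0 k : iter k z 0 = 0.
Proof. by elim: k => //= k ->; rewrite linear0. Qed.

(* Substitutes [z] for [t] and forgets the negative powers of [t]. *)
Definition laurent_ev (f : L) : N :=
  \sum_(d < sval (laurent_bound f)) iter d z (f d%:Z).

Lemma laurent_evE (f : L) m : (forall d, (m <= d)%N -> f d%:Z = 0) ->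
  laurent_ev f = \sum_(d < m) iter d z (f d%:Z).
Proof.
pose u d := iter d z (f (Posz d)) => hm; rewrite /laurent_ev.
case: laurent_bound => B hB /=.
have uB d : (B <= d)%N -> u d = 0 by move=> hd; rewrite /u hB ?iter_linear0.
have um d : (m <= d)%N -> u d = 0 by move=> hd; rewrite /u hm ?iter_linear0.
have -> : \sum_(d < m) iter d z (f d%:Z) = \sum_(d < m + B) u d.
  rewrite big_split_ord /= [X in _ + X]big1 ?addr0 // => d _.
  by rewrite um ?leq_addr.
rewrite addnC big_split_ord /= [X in _ + X]big1 ?addr0 // => d _.
by rewrite uB ?leq_addr.
Qed.

(** Compatibility with t would be false in general: t^-1 m is sent to 0, while t times it is sent to
    m. See [pconv_x1] for the vectors on which it holds. *)
Fact laurent_ev_linear : linear laurent_ev.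
Proof.
move=> a f g.
have [B hB] := laurent_bound f; have [B' hB'] := laurent_bound g.
rewrite !(@laurent_evE _ (maxn B B')); try by
  move=> d hd; rewrite ?coefD ?coefZ ?hB ?hB' ?scaler0 ?addr0 //; lia.
rewrite scaler_sumr -big_split; apply: eq_bigr => d _.
by rewrite coefD coefZ iter_linear.
Qed.
HB.instance Definition _ := GRing.isLinear.Build A L N *:%R laurent_ev
  laurent_ev_linear.

Lemma laurent_ev_monomial k m : laurent_ev (laurent_monomial k m) = iter k z m.
Proof.
rewrite (@laurent_evE _ k.+1) => [|d hd /=]; last by case: eqP => //; lia.
rewrite big_ord_recr /= eqxx big1 ?add0r // => d _.
by case: eqP => [[e]|_]; [have := ltn_ord d; lia | rewrite iter_linear0].
Qed.

End LaurentEvaluation.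

(** * The entries of tau on the special strand *)

Section TwistedCommutation.
Variables (K : nzRingType) (S : pzRingType) (c : {rmorphism K -> S}).
Hypothesis cC : forall d a, c d * a = a * c d.
Variables a b u w t : S.
Hypotheses (ub : u * b = a * u + w) (wb : GRing.comm w b).

(** Any one of the p factors b may be the place where u turns into w; the powers of a to its left
    and of b to its right add up to the divided difference of the p-th power. *)
Lemma twisted_expr p :
  u * b ^+ p = a ^+ p * u + (\sum_(s < p) a ^+ (p.-1 - s) * b ^+ s) * w.
Proof.
elim: p => [|p IHp]; first by rewrite big_ord0 !expr0 mulr1 mul1r mul0r addr0.
rewrite exprSr mulrA IHp mulrDl -!mulrA ub wb mulrDr !mulrA -exprSr -addrA.
congr (_ + _); rewrite big_ord_recl subn0 expr0 mulr1 mulrDl; congr (_ + _).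
rewrite mulr_suml !mulr_suml; apply: eq_bigr => s _.
by rewrite -[_ * b ^+ s * b]mulrA -exprSr /= /bump add1n; congr (_ ^+ _ * _ * _); lia.
Qed.

Lemma twisted_bieval q : GRing.comm u t -> GRing.comm w t ->
  u * bieval c q b t = bieval c q a t * u + bidiff c q a b t * w.
Proof.
move=> ut wt; rewrite /bieval /bidiff mulr_sumr !mulr_suml -big_split.
apply: eq_bigr => r _; rewrite mulr_sumr !mulr_suml -big_split.
apply: eq_bigr => p _.
rewrite /= mulrA -cC -!mulrA -mulrDr; congr (_ * _).
rewrite -(commrX r ut) -(commrX r wt) mulrA twisted_expr mulrDl.
by rewrite -!mulrA.
Qed.

(** Multiply (t - a) u = u (t - b) + w by the inverse of t - a on the left and by that of t - b on
    the right. *)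
Lemma twisted_inv Ga Gb : Ga * (t - a) = 1 -> (t - b) * Gb = 1 ->
  GRing.comm u t -> u * Gb = Ga * u + Ga * w * Gb.
Proof.
move=> ha hb ut; have e : (t - a) * u = u * (t - b) + w.
  by rewrite mulrBl mulrBr ub -ut opprD addrA subrK.
rewrite -[u in LHS]mul1r -ha -(mulrA Ga) e mulrDr mulrDl.
by rewrite -!mulrA hb mulr1.
Qed.

End TwistedCommutation.

Lemma bidiff_sym (K : nzRingType) (S : pzRingType) (c : K -> S) q a b t :
  GRing.comm a b -> bidiff c q a b t = bidiff c q b a t.
Proof.
move=> ab; apply: eq_bigr => r _; apply: eq_bigr => p _; congr (_ * (_ * _)).
rewrite (reindex_inj rev_ord_inj); apply: eq_bigr => s _ /=.
rewrite (commrX _ (commr_sym (commrX _ (commr_sym ab)))).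
have -> : (p - s.+1 = p.-1 - s)%N by rewrite subnS -subn1 subnAC subn1.
by rewrite subKn // -ltnS (ltn_predK (ltn_ord s)) ltn_ord.
Qed.

(** * Noncommutative identities behind the braid relation *)

Section BraidEntries.
Variables (S : pzRingType) (T g1 g2 Q1 Q2 d : S).
Hypotheses (Tg1 : T * g1 = g2 * T - g1 * g2) (Tg2 : T * g2 = g1 * T + g1 * g2).
Hypotheses (TQ1 : T * Q1 = Q2 * T - d) (TQ2 : T * Q2 = Q1 * T + d).
Variables q1 q2 : S.
Hypotheses (q1E : q1 = Q1 - g1 * g1) (q2E : q2 = Q2 - g2 * g2).
Hypotheses (g21 : g2 * g1 = g1 * g2).
Hypotheses (q1g1 : q1 * g1 = g1 * q1) (q1g2 : q1 * g2 = g2 * q1).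
Hypotheses (q2g1 : q2 * g1 = g1 * q2) (q2g2 : q2 * g2 = g2 * q2).
Hypotheses (q12 : q2 * q1 = q1 * q2) (q1d : q1 * d = d * q1).

(** The square of g2 subtracted from Q2 in q2 is restored by the term that T produces in crossing
    g2. What remains, Q minus T^2 up to the factor g1, is the numerator of a divided difference. *)
Lemma braid_entry33 : q2 * g1 + g2 * T * g2 - T * g2 * T = Q2 * g1 - g1 * T * T.
Proof.
rewrite -(mulrA g2) Tg2 mulrDr mulrDl q2E mulrBl !mulrA g21 -(mulrA g2 g2 g1) g21 mulrA g21.
by rewrite (addrC (g1 * g2 * T)) addrA subrK opprD addrA [LHS]addrAC addrK.
Qed.
(** T carries q2 to q1, and q1 to q2, with opposite errors: d minus two cubic terms in the first
    case, the negative of this in the second. *)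
Let Tq2 : T * q2 = q1 * T + d - g1 * g1 * g2 - g1 * g2 * g2.
Proof.
rewrite q2E mulrBr TQ2 mulrA Tg2 mulrDl -(mulrA g1 T) Tg2 mulrDr q1E mulrBl !mulrA.
by rewrite !opprD !addrA (addrAC _ d).
Qed.
Let Tq1 : T * q1 = q2 * T - d + g1 * g1 * g2 + g1 * g2 * g2.
Proof.
rewrite q1E mulrBr TQ1 mulrA Tg1 mulrBl -(mulrA g2 T) Tg1 mulrBr q2E mulrBl !mulrA.
rewrite g21 -(mulrA g1 g2 g1) g21 !mulrA.
by rewrite !opprB !addrA (addrAC _ (g1 * g2 * g2)) (addrAC _ (g1 * g1 * g2)) (addrAC (Q2 * T)).
Qed.
(** The two cubic products present here are the ones occurring in the error of T crossing q2, so
    only d survives. *)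
Lemma braid_entry22 : T * q2 + g2 * g1 * g2 - q1 * T + g1 * g2 * g1 = d.
Proof.
rewrite Tq2 g21 subrK -(mulrA g1 g2 g1) g21 !mulrA.
by rewrite (addrAC _ (- (g1 * g1 * g2))) subrK (addrC (q1 * T)) addrK.
Qed.
Lemma braid_entry32 : g2 * T * q2 - q2 * g1 * g2 - T * q2 * g1 = 0.
Proof.
rewrite -(mulrA T) q2g1 (mulrA T) Tg1 mulrBl opprB -(mulrA g1 g2) -q2g2 (mulrA g1) -q2g1.
by rewrite addrA subrK subrr.
Qed.
Lemma braid_entry21 : - (g2 * q1 * T) + g1 * g2 * q1 + q1 * T * g1 = 0.
Proof.
rewrite -(mulrA q1) Tg1 mulrBr !mulrA q1g2 q1g1 -(mulrA g1 q1) q1g2 !mulrA.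
by rewrite addrA (addrC (- _)) subrK subrr.
Qed.
(** The errors made in crossing q2 and then q1 are opposite and commute with q1, so they cancel. *)
Lemma braid_entry13 : T * q2 * q1 = q2 * q1 * T.
Proof.
rewrite Tq2 !mulrBl mulrDl -(mulrA q1 T) Tq1 q12.
rewrite !mulrDr mulrN !mulrA q1d.
have q1m : q1 * g1 * g1 * g2 = g1 * g1 * g2 * q1 by rewrite q1g1 -!mulrA (mulrA q1) q1g1 -mulrA q1g2.
have q1m' : q1 * g1 * g2 * g2 = g1 * g2 * g2 * q1 by rewrite q1g1 -!mulrA (mulrA q1) q1g2 -mulrA q1g2.
rewrite q1m q1m' (addrAC _ _ (d * q1)) (addrAC _ _ (d * q1)) subrK.
by rewrite (addrAC _ (g1 * g2 * g2 * q1)) addrK addrK.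
Qed.
Lemma braid_entry11 : - (T * g1 * T) + g2 * q1 - g1 * T * g1 = g2 * Q1 - g2 * T * T.
Proof.
rewrite Tg1 mulrBl opprB -(mulrA g1 T) Tg1 mulrBr q1E mulrBr !mulrA g21.
rewrite -(mulrA g1 g2 g1) g21 mulrA.
by rewrite opprB !addrA subrK addrAC (addrAC (g1 * g2 * T)) subrr add0r addrC.
Qed.

End BraidEntries.

(* [t] is the variable of the special strand, of colour [i], and [G k] is
   1/(t - x_k).  [gI k] is the sum of the G_k e(mu) with mu_k = i, [Qh k] the sum
   of the Q_{mu_k,i}(x_k, t) e(mu), and [Dl l] is the divided difference that
   appears when tau_l crosses [Qh l]. *)
Section SpecialStrand.
Variables (K : fieldType) (I : choiceType) (C : cartan_datum I).
Variables (D : qh_datum K C) (i : I) (gamma : {mset I}).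
Local Notation A := (qha D gamma).
Local Notation n := (size gamma).
Variable V : lmodType A.
Local Notation c := (@qconst K I C D gamma).
Local Notation S := (endo c V).
Local Notation cS := (endo_const c V).
Local Notation phi := (endo_scale V (@qconstC K I C D gamma)).
Variables (t : S) (G : nat -> S).
Local Notation X k := (phi (qx k)).
Local Notation T l := (phi (qtau l)).
Local Notation e mu := (phi (qe mu)).
Hypothesis t_phi : forall a, t * phi a = phi a * t.
Hypothesis tG : forall k, (t - X k) * G k = 1.
Hypothesis Gt : forall k, G k * (t - X k) = 1.

Lemma cS_central d (a : S) : cS d * a = a * cS d.
Proof. exact: endo_constC. Qed.

Lemma phi_bieval q (a b : A) : phi (bieval c q a b) = bieval cS q (phi a) (phi b).
Proof.
rewrite rmorph_bieval; congr (bieval _ q (phi a) (phi b)).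
by apply/funext => d; apply: endoP.
Qed.
Lemma phi_bidiff q (a b a' : A) :
  phi (bidiff c q a b a') = bidiff cS q (phi a) (phi b) (phi a').
Proof.
rewrite rmorph_bidiff; congr (bidiff _ q (phi a) (phi b) (phi a')).
by apply/funext => d; apply: endoP.
Qed.

Lemma comm_G k (a : S) : GRing.comm a t -> GRing.comm a (X k) -> GRing.comm a (G k).
Proof.
move=> at_ aX; have h : a * (t - X k) = (t - X k) * a by rewrite mulrBr mulrBl at_ aX.
by rewrite /GRing.comm -[a in LHS]mul1r -(Gt k) -[_ * _ * a]mulrA -h -!mulrA tG mulr1.
Qed.

Lemma comm_phi (a b : A) : a * b = b * a -> GRing.comm (phi a) (phi b).
Proof. by rewrite /GRing.comm -!rmorphM => ->. Qed.
Lemma comm_tphi a : GRing.comm t (phi a). Proof. exact: t_phi. Qed.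
Lemma comm_phit a : GRing.comm (phi a) t. Proof. by rewrite /GRing.comm t_phi. Qed.
Lemma comm_XX k l : GRing.comm (X k) (X l). Proof. exact/comm_phi/qxx. Qed.
Lemma comm_Xe k mu : GRing.comm (X k) (e mu). Proof. exact/comm_phi/qxe. Qed.
Lemma comm_eX k mu : GRing.comm (e mu) (X k).
Proof. exact/commr_sym/comm_Xe. Qed.
Lemma comm_ee mu nu : GRing.comm (e mu) (e nu).
Proof. by apply: comm_phi; rewrite !qee eq_sym; case: eqP => // ->. Qed.
Lemma comm_phiG a k : a * qx k = qx k * a -> GRing.comm (phi a) (G k).
Proof. by move=> h; apply: comm_G; [exact: comm_phit | exact: comm_phi]. Qed.
Lemma comm_Gphi a k : a * qx k = qx k * a -> GRing.comm (G k) (phi a).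
Proof. by move=> /comm_phiG/commr_sym. Qed.
Lemma comm_Gt k : GRing.comm (G k) t.
Proof. by apply/commr_sym/comm_G; [exact: commr_refl | exact: comm_tphi]. Qed.
Lemma comm_GX k l : GRing.comm (G k) (X l). Proof. exact/comm_Gphi/qxx. Qed.
Lemma comm_Ge k mu : GRing.comm (G k) (e mu). Proof. exact/comm_Gphi/esym/qxe. Qed.
Lemma comm_GG k l : GRing.comm (G k) (G l).
Proof. by apply: comm_G; [exact: comm_Gt | exact: comm_GX]. Qed.

Lemma S_ext (a b : S) :
  (forall mu, seq_mset mu = gamma -> a * e mu = b * e mu) -> a = b.
Proof.
move=> h; rewrite -[a]mulr1 -[b]mulr1 -(rmorph1 phi) -qe_sum rmorph_sum !mulr_sumr.
by apply: eq_big_seq => mu; rewrite mem_wseqs => /eqP; apply: h.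
Qed.

Definition diagonal (F : seq I -> S) : S := \sum_(mu <- wseqs gamma) F mu * e mu.

Lemma diagonal_e F mu : seq_mset mu = gamma -> diagonal F * e mu = F mu * e mu.
Proof.
move=> hmu; rewrite mulr_suml (bigD1_seq mu) ?mem_wseqs ?permutations_uniq ?hmu //=.
rewrite -mulrA -rmorphM qee eqxx big1 ?addr0 // => nu /negbTE h.
by rewrite -mulrA -rmorphM qee h rmorph0 mulr0.
Qed.

Lemma comm_diagonal F (a : S) : (forall mu, GRing.comm a (F mu)) ->
  (forall mu, GRing.comm a (e mu)) -> GRing.comm a (diagonal F).
Proof. by move=> h h'; apply: comm_sum => mu; apply: commrM. Qed.

(** The default letter is [i] itself, which is why [gI] tests the length of the word before
    comparing letters. *)
Definition letter (k : nat) (mu : seq I) : I := nth i mu k.-1.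

Definition gI k : S := diagonal (fun mu =>
  if (k.-1 < size mu)%N && (letter k mu == i) then G k else 0).
Definition Qh k : S := diagonal (fun mu => bieval cS (qpol D (letter k mu) i) (X k) t).
Definition Dl l : S := diagonal (fun mu =>
  if letter l mu == letter l.+1 mu then bidiff cS (qpol D (letter l mu) i) (X l) (X l.+1) t
  else 0).

Lemma comm_Qh k (a : S) : GRing.comm a t -> GRing.comm a (X k) ->
  (forall mu, GRing.comm a (e mu)) -> GRing.comm a (Qh k).
Proof.
move=> h1 h2 h3; apply: comm_diagonal => // mu.
by apply: comm_bieval => //; exact: cS_central.
Qed.
Lemma comm_gI k (a : S) : GRing.comm a t -> GRing.comm a (X k) ->
  (forall mu, GRing.comm a (e mu)) -> GRing.comm a (gI k).
Proof.
move=> h1 h2 h3; apply: comm_diagonal => // mu.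
by case: ifP => _; [exact: comm_G | exact: commr0].
Qed.
Lemma comm_Dl k (a : S) : GRing.comm a t -> GRing.comm a (X k) -> GRing.comm a (X k.+1) ->
  (forall mu, GRing.comm a (e mu)) -> GRing.comm a (Dl k).
Proof.
move=> h1 h2 h2' h3; apply: comm_diagonal => // mu.
by case: ifP => _; [apply: comm_bidiff => //; exact: cS_central | exact: commr0].
Qed.

Lemma comm_et mu : GRing.comm (e mu) t. Proof. exact: comm_phit. Qed.
Lemma comm_gIt k : GRing.comm (gI k) t.
Proof.
by apply/commr_sym/comm_gI; [exact: commr_refl| exact: comm_tphi | move=> mu; exact: comm_tphi].
Qed.
Lemma comm_gIX k l : GRing.comm (gI k) (X l).
Proof.
apply/commr_sym/comm_gI; [exact: comm_phit| exact: comm_XX | move=> mu; exact: comm_Xe].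
Qed.
Lemma comm_gIe k mu : GRing.comm (gI k) (e mu).
Proof.
apply/commr_sym/comm_gI; [exact: comm_phit| exact: comm_eX | move=> nu; exact: comm_ee].
Qed.
Lemma comm_Qht k : GRing.comm (Qh k) t.
Proof.
by apply/commr_sym/comm_Qh; [exact: commr_refl| exact: comm_tphi | move=> mu; exact: comm_tphi].
Qed.
Lemma comm_QhX k l : GRing.comm (Qh k) (X l).
Proof.
apply/commr_sym/comm_Qh; [exact: comm_phit| exact: comm_XX | move=> mu; exact: comm_Xe].
Qed.
Lemma comm_Qhe k mu : GRing.comm (Qh k) (e mu).
Proof.
apply/commr_sym/comm_Qh; [exact: comm_phit| exact: comm_eX | move=> nu; exact: comm_ee].
Qed.
Lemma comm_gIgI k l : GRing.comm (gI k) (gI l).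
Proof. apply: comm_gI; [exact: comm_gIt | exact: comm_gIX | move=> mu; exact: comm_gIe]. Qed.
Lemma comm_QhgI k l : GRing.comm (Qh k) (gI l).
Proof. apply: comm_gI; [exact: comm_Qht | exact: comm_QhX | move=> mu; exact: comm_Qhe]. Qed.
Lemma comm_QhQh k l : GRing.comm (Qh k) (Qh l).
Proof. apply: comm_Qh; [exact: comm_Qht | exact: comm_QhX | move=> mu; exact: comm_Qhe]. Qed.
Lemma comm_QhDl k l : GRing.comm (Qh k) (Dl l).
Proof.
by apply: comm_Dl; [exact: comm_Qht | exact: comm_QhX| exact: comm_QhX | move=> mu; exact: comm_Qhe].
Qed.

Lemma gI_e k mu : seq_mset mu = gamma -> (1 <= k <= n)%N ->
  gI k * e mu = (if letter k mu == i then G k * e mu else 0).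
Proof.
move=> hmu hk; rewrite diagonal_e // (wseq_size hmu).
have -> /= : (k.-1 < n)%N by lia.
by case: ifP; rewrite ?mul0r.
Qed.
Lemma Qh_e k mu : seq_mset mu = gamma ->
  Qh k * e mu = bieval cS (qpol D (letter k mu) i) (X k) t * e mu.
Proof. exact: diagonal_e. Qed.
Lemma Dl_e l mu : seq_mset mu = gamma -> Dl l * e mu =
  (if letter l mu == letter l.+1 mu then
     bidiff cS (qpol D (letter l mu) i) (X l) (X l.+1) t * e mu else 0).
Proof. by move=> hmu; rewrite diagonal_e //; case: ifP; rewrite ?mul0r. Qed.

Lemma letter_swap_word k l mu : k != l -> k != l.+1 -> (0 < k)%N -> (0 < l)%N ->
  letter k (swap_word l mu) = letter k mu.
Proof.
case: k l => [|k] [|l] // kl kl' _ _; rewrite /letter /swap_word /=.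
rewrite -[in RHS](cat_take_drop l mu) !nth_cat; case: ltnP => // hk.
have hs : (size (take l mu) <= l)%N by rewrite size_take_min geq_minl.
case E : (drop l mu) => [|a [|b r]] //.
have sl : size (take l mu) = l.
  by apply: size_takel; have := congr1 size E; rewrite size_drop /=; lia.
rewrite sl in hk *; have -> : (k - l = (k - l).-2.+2)%N.
  by move: kl kl'; rewrite !eqSS; lia.
by [].
Qed.

Lemma letter_swap_adjacent l mu : (0 < l < size mu)%N ->
  letter l (swap_word l mu) = letter l.+1 mu /\ letter l.+1 (swap_word l mu) = letter l mu.
Proof.
case: l => // l /= hl; rewrite /letter /swap_word /=.
have sl : size (take l mu) = l by apply: size_takel; lia.
rewrite -[in nth i mu l.+1](cat_take_drop l mu) -[in nth i mu l](cat_take_drop l mu).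
rewrite !nth_cat sl ltnn subnn ltnNge leqnSn /= subSnn.
by case E : (drop l mu) => [|a [|b r]] //; have := congr1 size E; rewrite size_drop /=; lia.
Qed.

Section Adjacent.
Variables (l : nat) (mu : seq I).
Hypotheses (hl : (1 <= l < n)%N) (hmu : seq_mset mu = gamma).
Local Notation j := (letter l mu).
Local Notation k := (letter l.+1 mu).
Local Notation d := (j == k)%:R.

Lemma letter_split s a b r : (size s).+1 = l -> mu = s ++ [:: a, b & r] ->
  j = a /\ k = b.
Proof. by move=> <- ->; rewrite /letter /= !nth_cat ltnn subnn ltnNge leqnSn /= subSnn. Qed.

Lemma T_e : T l * e mu = e (swap_word l mu) * T l.
Proof. by rewrite -!(rmorphM phi) qtau_qe. Qed.

(** The form u b = a u + w with u = tau_l e(mu), to which [twisted_inv] and [twisted_bieval]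
    apply. *)
Lemma T_XS_e : T l * e mu * X l.+1 = X l * (T l * e mu) + d * e mu.
Proof.
have [s [a [b [r [Emu sl]]]]] := wseq_split hmu hl.
have [-> ->] := letter_split sl Emu.
have := qtx D gamma s a b r l.+1; rewrite -Emu sl; cbv zeta.
rewrite /swap_at eqxx (_ : l.+1 == l = false) ?subr0 ?mul1r; last by apply/eqP; lia.
move=> /(congr1 phi); rewrite mulrBl rmorphB !rmorphM rmorph_nat => /eqP.
by rewrite subr_eq -!mulrA comm_eX => /eqP ->; rewrite addrC.
Qed.

Lemma T_X_e : T l * e mu * X l = X l.+1 * (T l * e mu) - d * e mu.
Proof.
have [s [a [b [r [Emu sl]]]]] := wseq_split hmu hl.
have [-> ->] := letter_split sl Emu.
have := qtx D gamma s a b r l; rewrite -Emu sl; cbv zeta.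
rewrite /swap_at eqxx (_ : l == l.+1 = false) ?sub0r ?mulN1r; last by apply/eqP; lia.
move=> /(congr1 phi); rewrite mulrBl mulNr rmorphB rmorphN !rmorphM rmorph_nat => /eqP.
by rewrite subr_eq -!mulrA comm_eX => /eqP ->; rewrite addrC.
Qed.

Lemma T_T_e : T l * T l * e mu = bieval cS (qpol D j k) (X l) (X l.+1) * e mu.
Proof.
have [s [a [b [r [Emu sl]]]]] := wseq_split hmu hl.
have [-> ->] := letter_split sl Emu.
have := qt2 D gamma s a b r; rewrite -Emu sl; cbv zeta.
move=> /(congr1 phi); rewrite expr2 !rmorphM /= => ->; congr (_ * _).
exact: phi_bieval.
Qed.

Lemma comm_de (a : S) : GRing.comm (e mu) a -> GRing.comm (d * e mu) a.
Proof. by move=> h; apply/commr_sym/commrM; [exact: commr_nat | exact/commr_sym]. Qed.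

Lemma comm_Tet : GRing.comm (T l * e mu) t.
Proof. by rewrite -(rmorphM phi); exact: comm_phit. Qed.

Lemma T_GS_e : T l * e mu * G l.+1 =
  G l * (T l * e mu) + d * (G l * G l.+1 * e mu).
Proof.
rewrite (twisted_inv T_XS_e (Gt l) (tG l.+1) comm_Tet); congr (_ + _).
rewrite -mulrA comm_de; last exact/commr_sym/comm_Ge.
by rewrite !mulrA (commr_nat (G l * G l.+1)) -!mulrA.
Qed.
Lemma T_G_e : T l * e mu * G l =
  G l.+1 * (T l * e mu) - d * (G l * G l.+1 * e mu).
Proof.
rewrite (twisted_inv T_X_e (Gt l.+1) (tG l) comm_Tet); congr (_ + _).
rewrite mulrN mulNr -mulrA comm_de; last exact/commr_sym/comm_Ge.
by rewrite !mulrA (comm_GG l.+1) (commr_nat (G l * G l.+1)) -!mulrA.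
Qed.

Lemma T_bievalS_e q : T l * e mu * bieval cS q (X l.+1) t =
  bieval cS q (X l) t * (T l * e mu) + d * (bidiff cS q (X l) (X l.+1) t * e mu).
Proof.
rewrite (twisted_bieval cS_central T_XS_e (comm_de (comm_eX _ _)) q comm_Tet
  (comm_de (comm_et _))).
by rewrite !mulrA (commr_nat (bidiff _ _ _ _ _)).
Qed.
Lemma T_bieval_e q : T l * e mu * bieval cS q (X l) t =
  bieval cS q (X l.+1) t * (T l * e mu) - d * (bidiff cS q (X l) (X l.+1) t * e mu).
Proof.
have h (a : S) : GRing.comm (e mu) a -> GRing.comm (- (d * e mu)) a.
  by move=> /comm_de/commr_sym/commrN/commr_sym.
rewrite (twisted_bieval cS_central T_X_e (h _ (comm_eX _ _)) q comm_Tet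
  (h _ (comm_et _))).
rewrite (bidiff_sym _ _ _ (comm_XX _ _)).
by rewrite mulrN !mulrA (commr_nat (bidiff _ _ _ _ _)).
Qed.

End Adjacent.

Lemma T_qx_e l mu k : (1 <= l < n)%N -> seq_mset mu = gamma ->
  (T l * X k - X (swap_at l k) * T l) * e mu =
  ((k == l.+1)%:R - (k == l)%:R) * (letter l mu == letter l.+1 mu)%:R * e mu.
Proof.
move=> hl hmu; have [s [a [b [r [Emu sl]]]]] := wseq_split hmu hl.
have [-> ->] := letter_split sl Emu.
have := qtx D gamma s a b r k; rewrite -Emu sl; cbv zeta => /(congr1 phi).
by rewrite !(rmorphM, rmorphB, rmorph_nat).
Qed.

Lemma T_braid_e l mu : (1 <= l)%N -> (l.+1 < n)%N -> seq_mset mu = gamma ->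
  (T l.+1 * T l * T l.+1 - T l * T l.+1 * T l) * e mu =
  (letter l mu == letter l.+2 mu)%:R
  * bidiff cS (qpol D (letter l mu) (letter l.+1 mu)) (X l) (X l.+2) (X l.+1) * e mu.
Proof.
move=> h1 h2 hmu; have [s [a [b [d [r [Emu sl]]]]]] := wseq_split3 hmu h1 h2.
have [-> ->] := letter_split sl Emu.
have -> : letter l.+2 mu = d.
  by rewrite Emu -sl /letter /= -cat1s -[b :: _]cat1s !catA nth_cat !size_cat /= !addn1 ltnn subnn.
have := qbraid D gamma s a b d r; rewrite -Emu sl; cbv zeta => /(congr1 phi).
rewrite !(rmorphM, rmorphB, rmorph_nat) /= => ->; congr (_ * _ * _).
exact: phi_bidiff.
Qed.

Lemma comm_gIG k l : GRing.comm (gI k) (G l).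
Proof. by apply: comm_G; [exact: comm_gIt | exact: comm_gIX]. Qed.

Definition qI k : S := Qh k - gI k * gI k.

Lemma comm_gIDl k l : GRing.comm (gI k) (Dl l).
Proof.
by apply: comm_Dl; [exact: comm_gIt | exact: comm_gIX| exact: comm_gIX | move=> mu; exact: comm_gIe].
Qed.
Lemma comm_qIgI k k' : GRing.comm (qI k) (gI k').
Proof.
apply/commr_sym/commrB; first exact/commr_sym/comm_QhgI.
by apply/commrM; exact: comm_gIgI.
Qed.
Lemma comm_qI k (a : S) : GRing.comm a (Qh k) -> GRing.comm a (gI k) ->
  GRing.comm a (qI k).
Proof. by move=> h h'; apply: commrB => //; apply: commrM. Qed.
Lemma comm_qIqI k k' : GRing.comm (qI k) (qI k').
Proof.
apply: comm_qI; last exact: comm_qIgI.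
apply/commr_sym/comm_qI; [exact: comm_QhQh | exact: comm_QhgI].
Qed.
Lemma comm_qIX k l : GRing.comm (qI k) (X l).
Proof. apply/commr_sym/comm_qI; apply/commr_sym; [exact: comm_QhX | exact: comm_gIX]. Qed.
Lemma comm_qIt k : GRing.comm (qI k) t.
Proof. apply/commr_sym/comm_qI; apply/commr_sym; [exact: comm_Qht | exact: comm_gIt]. Qed.
Lemma comm_qIe k mu : GRing.comm (qI k) (e mu).
Proof. apply/commr_sym/comm_qI; apply/commr_sym; [exact: comm_Qhe | exact: comm_gIe]. Qed.
Lemma comm_qIDl k l : GRing.comm (qI k) (Dl l).
Proof. apply/commr_sym/comm_qI; apply/commr_sym; [exact: comm_QhDl | exact: comm_gIDl]. Qed.

Lemma T_gI_far k l : k != l -> k != l.+1 -> (1 <= k <= n)%N -> (1 <= l)%N ->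
  GRing.comm (T l) (gI k).
Proof.
move=> kl kl' hk hl; apply: S_ext => mu hmu.
rewrite -!mulrA gI_e // T_e (mulrA (gI k)) gI_e ?wseq_swap_word //.
rewrite letter_swap_word ?(andP hk).1 //; case: ifP => _; rewrite ?mulr0 ?mul0r //.
rewrite mulrA comm_phiG; last exact: qtau_qx.
by rewrite -!mulrA T_e.
Qed.

Lemma T_Qh_far k l : k != l -> k != l.+1 -> (1 <= k <= n)%N -> (1 <= l)%N ->
  GRing.comm (T l) (Qh k).
Proof.
move=> kl kl' hk hl; apply: S_ext => mu hmu.
rewrite -!mulrA Qh_e // T_e (mulrA (Qh k)) Qh_e ?wseq_swap_word //.
rewrite letter_swap_word ?(andP hk).1 // mulrA comm_bieval -?mulrA ?T_e //.
- exact: cS_central.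
- exact/comm_phi/qtau_qx.
- exact: comm_phit.
Qed.

Lemma T_qI_far k l : k != l -> k != l.+1 -> (1 <= k <= n)%N -> (1 <= l)%N ->
  GRing.comm (T l) (qI k).
Proof. by move=> *; apply: comm_qI; [exact: T_Qh_far | exact: T_gI_far]. Qed.

Section AdjacentGlobal.
Variable l : nat.
Hypothesis hl : (1 <= l < n)%N.

Let hl1 : (1 <= l <= n)%N. Proof. lia. Qed.
Let hl2 : (1 <= l.+1 <= n)%N. Proof. lia. Qed.
Let swapP mu : seq_mset mu = gamma -> [/\ seq_mset (swap_word l mu) = gamma,
  letter l (swap_word l mu) = letter l.+1 mu & letter l.+1 (swap_word l mu) = letter l mu].
Proof.
move=> hmu; rewrite wseq_swap_word; have [|-> ->] := @letter_swap_adjacent l mu => //.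
by rewrite (wseq_size hmu); lia.
Qed.

Lemma gIgI_e mu : seq_mset mu = gamma -> gI l * gI l.+1 * e mu =
  if (letter l mu == i) && (letter l.+1 mu == i) then G l * G l.+1 * e mu else 0.
Proof.
move=> hmu; rewrite -mulrA gI_e //; case: eqP => hk; last by rewrite mulr0 andbF.
rewrite mulrA comm_gIG -mulrA gI_e // andbT.
by case: ifP; rewrite ?mulr0 // mulrA (comm_GG l).
Qed.

(** The Kronecker delta of [T_GS_e] is absorbed: once one of the two letters is [i], their equality
    says that both are, and this is what the product of the two [gI] detects. *)
Lemma T_gIS : T l * gI l.+1 = gI l * T l + gI l * gI l.+1.
Proof.
apply: S_ext => mu hmu; have [hs h1 h2] := swapP hmu.
rewrite mulrDl gIgI_e // -!mulrA gI_e // T_e // (mulrA (gI l)) gI_e // h1.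
case: eqP => hk; last by rewrite andbF !(mulr0, mul0r, addr0).
rewrite [in LHS]comm_Ge [LHS]mulrA T_GS_e // T_e // -!mulrA andbT hk; congr (_ + _).
by case: ifP; rewrite ?mul0r ?mul1r.
Qed.

Lemma T_gI : T l * gI l = gI l.+1 * T l - gI l * gI l.+1.
Proof.
apply: S_ext => mu hmu; have [hs h1 h2] := swapP hmu.
rewrite mulrBl gIgI_e // -!mulrA gI_e // T_e // (mulrA (gI l.+1)) gI_e // h2.
case: eqP => hk; last by rewrite !(mulr0, mul0r, subr0).
rewrite [in LHS]comm_Ge [LHS]mulrA T_G_e // T_e // -!mulrA hk /= eq_sym; congr (_ - _).
by case: ifP; rewrite ?mul0r ?mul1r.
Qed.

Lemma comm_e_bieval mu q k : GRing.comm (bieval cS q (X k) t) (e mu).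
Proof.
by apply/commr_sym/comm_bieval; do ![exact: cS_central | exact: comm_eX | exact: comm_et].
Qed.

Lemma T_QhS : T l * Qh l.+1 = Qh l * T l + Dl l.
Proof.
apply: S_ext => mu hmu; have [hs h1 h2] := swapP hmu.
rewrite mulrDl Dl_e // -!mulrA Qh_e // T_e // (mulrA (Qh l)) Qh_e // h1.
rewrite [in LHS]comm_e_bieval [LHS]mulrA T_bievalS_e // T_e // -!mulrA; congr (_ + _).
by case: eqP => [->|_]; rewrite ?mul0r ?mul1r.
Qed.

Lemma T_Qh : T l * Qh l = Qh l.+1 * T l - Dl l.
Proof.
apply: S_ext => mu hmu; have [hs h1 h2] := swapP hmu.
rewrite mulrBl Dl_e // -!mulrA Qh_e // T_e // (mulrA (Qh l.+1)) Qh_e // h2.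
rewrite [in LHS]comm_e_bieval [LHS]mulrA T_bieval_e // T_e // -!mulrA; congr (_ - _).
by case: eqP => [->|_]; rewrite ?mul0r ?mul1r.
Qed.

Lemma bieval_qpolC j k (a b : S) : GRing.comm a b ->
  bieval cS (qpol D j k) a b = bieval cS (qpol D k j) b a.
Proof. by move=> h; rewrite (qpol_sym D j) bieval_swapXY. Qed.

(** On a word, tau_l^2 is Q(x_l, x_(l+1)) and [Qh] is Q(x_(l+1), t). When the letter at l is [i],
    symmetry makes both values of one polynomial, at t and at x_l, so that their difference is
    divisible by t - x_l; [gI] performs the division. *)
Lemma braid_right mu : seq_mset mu = gamma ->
  (Qh l.+1 * gI l - gI l * T l * T l) * e mu =
  if letter l mu == i
  then bidiff cS (qpol D i (letter l.+1 mu)) (X l) t (X l.+1) * e mu else 0.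
Proof.
move=> hmu; rewrite mulrBl comm_QhgI -!mulrA (mulrA (T l)) T_T_e // -mulrBr.
rewrite Qh_e // -mulrBl; set B := (_ - _).
have Be : GRing.comm B (e mu).
  by apply/commr_sym/commrB; apply: comm_bieval;
    do ![exact: cS_central | exact: comm_eX | exact: comm_et].
rewrite Be mulrA gI_e //; case: eqP => hi; last by rewrite mul0r.
rewrite -mulrA -Be mulrA; congr (_ * _).
rewrite /B hi (bieval_qpolC _ _ (comm_phit _)) -opprB.
have tX : GRing.comm (X l) t by apply: comm_phit.
(* The divided difference is taken with x_l first, so the numerator is x_l - t times it, and the
   sign has to be reversed before G_l cancels. *)
rewrite -(bidiffP _ _ cS_central tX) -mulNr opprB mulrA Gt mul1r.
by [].
Qed.

(** The same division with t - x_(l+1) in place of t - x_l; both polynomials are first rewritten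
    with [i] as their first colour. *)
Lemma braid_left mu : seq_mset mu = gamma ->
  (gI l.+1 * Qh l - gI l.+1 * T l * T l) * e mu =
  if letter l.+1 mu == i
  then bidiff cS (qpol D i (letter l mu)) t (X l.+1) (X l) * e mu else 0.
Proof.
move=> hmu; rewrite mulrBl -!mulrA (mulrA (T l)) T_T_e // -mulrBr.
rewrite Qh_e // -mulrBl; set B := (_ - _).
have Be : GRing.comm B (e mu).
  by apply/commr_sym/commrB; apply: comm_bieval;
    do ![exact: cS_central | exact: comm_eX | exact: comm_et].
rewrite Be mulrA gI_e //; case: eqP => hi; last by rewrite mul0r.
rewrite -mulrA -Be mulrA; congr (_ * _).
rewrite /B hi (bieval_qpolC _ _ (comm_phit _)) (bieval_qpolC _ i (comm_XX _ _)).
have tX : GRing.comm t (X l.+1) by apply: comm_tphi.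
by rewrite -(bidiffP _ _ cS_central tX) mulrA Gt mul1r.
Qed.

Lemma entry33 mu : seq_mset mu = gamma ->
  (qI l.+1 * gI l + gI l.+1 * T l * gI l.+1 - T l * gI l.+1 * T l) * e mu =
  if letter l mu == i
  then bidiff cS (qpol D i (letter l.+1 mu)) (X l) t (X l.+1) * e mu else 0.
Proof.
move=> hmu; rewrite -braid_right // (@braid_entry33 _ _ _ _ (Qh l.+1)) //.
- exact: T_gIS.
- exact: comm_gIgI.
Qed.

Lemma entry11 mu : seq_mset mu = gamma ->
  (- (T l * gI l * T l) + gI l.+1 * qI l - gI l * T l * gI l) * e mu =
  if letter l.+1 mu == i
  then bidiff cS (qpol D i (letter l mu)) t (X l.+1) (X l) * e mu else 0.
Proof.
move=> hmu; rewrite -braid_left // (@braid_entry11 _ _ _ _ (Qh l)) //.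
- exact: T_gI.
- exact: comm_gIgI.
Qed.

Lemma entry22 : T l * qI l.+1 + gI l.+1 * gI l * gI l.+1 - qI l * T l
  + gI l * gI l.+1 * gI l = Dl l.
Proof.
apply: (@braid_entry22 _ _ _ _ (Qh l) (Qh l.+1)) => //.
- exact: T_gIS.
- exact: T_QhS.
- exact: comm_gIgI.
Qed.

Lemma entry32 : gI l.+1 * T l * qI l.+1 - qI l.+1 * gI l * gI l.+1
  - T l * qI l.+1 * gI l = 0.
Proof.
apply: braid_entry32 => //.
- exact: T_gI.
- exact: comm_qIgI.
- exact: comm_qIgI.
Qed.

Lemma entry21 : - (gI l.+1 * qI l * T l) + gI l * gI l.+1 * qI l
  + qI l * T l * gI l = 0.
Proof.
apply: braid_entry21 => //.
- exact: T_gI.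
- exact: comm_qIgI.
- exact: comm_qIgI.
Qed.

Lemma entry13 : T l * qI l.+1 * qI l = qI l.+1 * qI l * T l.
Proof.
apply: (@braid_entry13 _ _ (gI l) (gI l.+1) (Qh l) (Qh l.+1) (Dl l)) => //.
- exact: T_gI.
- exact: T_gIS.
- exact: T_Qh.
- exact: T_QhS.
- exact: comm_gIgI.
- exact: comm_qIgI.
- exact: comm_qIgI.
- exact: comm_qIqI.
- exact: comm_qIDl.
Qed.

End AdjacentGlobal.

End SpecialStrand.

(** * The representation of R(beta) on Laurent series *)

Section SwapInsert.
Variable (I : eqType) (i : I).
Implicit Types (s mu : seq I).

Lemma swap_word_catr l s mu : (size s < l)%N ->
  swap_word l (s ++ mu) = s ++ swap_word (l - size s) mu.
Proof.
move=> h; rewrite /swap_word take_cat drop_cat.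
have -> : (l.-1 < size s)%N = false by lia.
have -> : (l.-1 - size s = (l - size s).-1)%N by lia.
by rewrite -catA.
Qed.

Lemma swap_word_catl l s mu : (0 < l < size s)%N ->
  swap_word l (s ++ mu) = swap_word l s ++ mu.
Proof.
move=> h; rewrite /swap_word take_cat drop_cat.
have -> : (l.-1 < size s)%N by lia.
rewrite -catA; congr (_ ++ _).
case E : (drop _ _) => [|a [|b r]] //; have := congr1 size E; rewrite size_drop /=; lia.
Qed.

Definition ins b mu := take b.-1 mu ++ i :: drop b.-1 mu.

Lemma size_ins b mu : size (ins b mu) = (size mu).+1.
Proof. by rewrite /ins size_cat /= addnS -size_cat cat_take_drop. Qed.

(** The inserted letter stands before the two swapped ones, so removing it lowers their positions by
    one. This is the combinatorial source of [T l.-1] in [tauW_fun]. *)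
Lemma swap_ins_lt l b mu : (0 < b < l)%N -> (b <= (size mu).+1)%N ->
  swap_word l (ins b mu) = ins b (swap_word l.-1 mu).
Proof.
move=> hl hb; have e : mu = take b.-1 mu ++ drop b.-1 mu by rewrite cat_take_drop.
have sz : size (take b.-1 mu) = b.-1 by rewrite size_takel; lia.
rewrite /ins swap_word_catr ?sz; last by lia.
rewrite [in RHS]e swap_word_catr ?sz; last by lia.
rewrite take_size_cat ?drop_size_cat //; congr (_ ++ _).
by rewrite -cat1s swap_word_catr /=; [congr (_ :: swap_word _ _) |]; lia.
Qed.

Lemma swap_ins_gt l b mu : (0 < l)%N -> (l.+1 < b <= (size mu).+1)%N ->
  swap_word l (ins b mu) = ins b (swap_word l mu).
Proof.
move=> hl hb; have e : mu = take b.-1 mu ++ drop b.-1 mu by rewrite cat_take_drop.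
have sz : size (take b.-1 mu) = b.-1 by rewrite size_takel; lia.
have szs : size (swap_word l (take b.-1 mu)) = b.-1.
  rewrite -[in RHS]sz /swap_word -[in RHS](cat_take_drop l.-1 (take _ mu)) !size_cat.
  by case: (drop _ _) => [|? [|? ?]].
rewrite /ins swap_word_catl ?sz; last by lia.
rewrite [in RHS]e swap_word_catl ?sz; last by lia.
by rewrite take_size_cat ?drop_size_cat.
Qed.

Lemma swap_ins_eq l mu : (0 < l <= size mu)%N -> swap_word l (ins l mu) = ins l.+1 mu.
Proof.
case: l => // l hl; have e : mu = take l mu ++ drop l mu by rewrite cat_take_drop.
have sz : size (take l mu) = l by rewrite size_takel; lia.
have := size_drop l mu; case E : (drop l mu) => [|a r] /= hs; first by lia.
rewrite /ins /= E -{1}sz swap_word_cat.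
have {}e : mu = take l mu ++ a :: r by rewrite -E cat_take_drop.
move: (take l mu) sz e => p sz ->.
rewrite take_cat drop_cat sz ltnNge leqnSn /= subSnn /= drop0 -catA.
by rewrite take0.
Qed.

Lemma nth_ins x0 k b mu : (0 < b <= (size mu).+1)%N -> (0 < k)%N ->
  nth x0 (ins b mu) k.-1 =
  if (k < b)%N then nth x0 mu k.-1 else if k == b then i else nth x0 mu k.-2.
Proof.
case: b k => // b [] // k /= hb _.
have sz : size (take b mu) = b by rewrite size_takel; lia.
rewrite /ins nth_cat sz /= ltnS eqSS.
case: ltngtP => h.
- by rewrite nth_take.
- have -> : (k - b = (k.-1 - b).+1)%N by lia.
  by rewrite /= nth_drop; congr nth; lia.
- by rewrite h subnn.
Qed.

End SwapInsert.

Lemma seq_mset_ins (I : choiceType) (i : I) b mu :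
  seq_mset (ins i b mu) = seq_mset (i :: mu).
Proof.
by apply/eq_seq_msetP; rewrite perm_catC /= perm_cons perm_catC cat_take_drop.
Qed.

(* The basis vectors are normalised so that the entry l of tau_l w contains w(l+1)
   with coefficient 1; tau_l^2 then forces the entry [q l] = Qh_l - g_l^2 in the
   other direction.  Only the positions 1, ..., n+1 of [W] matter, and 1 acts by
   the projection [eW] onto them. *)
Section SpecialStrandModule.
Variables (K : fieldType) (I : choiceType) (C : cartan_datum I).
Variables (D : qh_datum K C) (i : I) (beta gamma : {mset I}).
Hypothesis hbeta : forall mu, (seq_mset (i :: mu) == beta) = (seq_mset mu == gamma).
Hypothesis size_beta : size beta = (size gamma).+1.
Local Notation A := (qha D gamma).
Local Notation n := (size gamma).
Variable V : lmodType A.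
Local Notation c := (@qconst K I C D gamma).
Local Notation S := (endo c V).
Local Notation cS := (endo_const c V).
Local Notation phi := (endo_scale V (@qconstC K I C D gamma)).
Variables (t : S) (G : nat -> S).
Local Notation X k := (phi (qx k)).
Local Notation T l := (phi (qtau l)).
Local Notation e mu := (phi (qe mu)).
Hypothesis t_phi : forall a, t * phi a = phi a * t.
Hypothesis tG : forall k, (t - X k) * G k = 1.
Hypothesis Gt : forall k, G k * (t - X k) = 1.
Local Notation g k := (gI i G k).
Local Notation q k := (qI i t G k).
Local Notation W := (nat -> V).
Local Notation SW := (endo c W).
Local Notation cW := (endo_const c W).
Local Notation inr b := (1 <= b <= n.+1)%N.

Definition diagW_fun (F : nat -> S) (w : W) : W := fun b =>
  if inr b then F b (w b) else 0.
Fact diagW_additive F : zmod_morphism (diagW_fun F).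
Proof.
move=> w w'; apply/funext => b.
suff: diagW_fun F (w - w') b = diagW_fun F w b - diagW_fun F w' b by [].
by rewrite /diagW_fun; case: ifP; rewrite ?subr0 // -efunB.
Qed.
Fact diagW_scale F d w : diagW_fun F (c d *: w) = c d *: diagW_fun F w.
Proof.
apply/funext => b.
suff: diagW_fun F (c d *: w) b = c d *: diagW_fun F w b by [].
by rewrite /diagW_fun; case: ifP; rewrite ?scaler0 // -endoZ.
Qed.
Definition diagW F : SW := Endo (diagW_additive F) (diagW_scale F).

(** If the special strand is at b < l, the crossing involves strands l - 1 and l of the remaining
    word; if b > l + 1, it keeps its number. On positions l and l + 1 the matrix has rows (-g, 1)
    and (q, g). *)
Definition tauW_fun (l : nat) (w : W) : W := fun b =>
  if ~~ inr b then 0 else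
  if (b < l)%N then T l.-1 (w b) else
  if b == l then w l.+1 - g l (w l) else
  if b == l.+1 then q l (w l) + g l (w l.+1) else T l (w b).
Fact tauW_additive l : zmod_morphism (tauW_fun l).
Proof.
move=> w w'; apply/funext => b.
suff: tauW_fun l (w - w') b = tauW_fun l w b - tauW_fun l w' b by [].
have e k : (w - w') k = w k - w' k by [].
rewrite /tauW_fun !e; move: (q l) (g l) => ql gl; case: ifP => _; first by rewrite subr0.
case: ifP => _; first by rewrite efunB.
case: ifP => _; first by rewrite efunB !opprB addrACA [RHS]addrACA (addrC (- w' _)).
case: ifP => _; last by rewrite efunB.
by rewrite !efunB opprD addrACA.
Qed.
Fact tauW_scale l d w : tauW_fun l (c d *: w) = c d *: tauW_fun l w.
Proof.
apply/funext => b.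
suff: tauW_fun l (c d *: w) b = c d *: tauW_fun l w b by [].
have e k : (c d *: w) k = c d *: w k by [].
rewrite /tauW_fun !e; move: (q l) (g l) => ql gl; case: ifP => _; first by rewrite scaler0.
case: ifP => _; first by rewrite endoZ.
case: ifP => _; first by rewrite endoZ scalerBr.
case: ifP => _; last by rewrite endoZ.
by rewrite !endoZ scalerDr.
Qed.
Definition tauW l : SW := Endo (@tauW_additive l) (@tauW_scale l).

Definition xop k b : S := if (k < b)%N then X k else if k == b then t else X k.-1.
Definition eop nu b : S := phi (qeP (fun mu => ins i b mu == nu)).

Definition genW (x : qgen I) : SW :=
  match x with
  | GE nu => diagW (eop nu)
  | GX k => if (1 <= k <= n.+1)%N then diagW (xop k) else 0
  | GT l => if (1 <= l < n.+1)%N then tauW l else 0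
  end.

Definition eW : SW := diagW (fun=> 1).

Lemma SW_ext (f f' : SW) : (forall w b, f w b = f' w b) -> f = f'.
Proof. by move=> h; apply: endoP => w; apply/funext. Qed.

Lemma diagWM F F' : diagW F * diagW F' = diagW (fun b => F b * F' b).
Proof. by apply: SW_ext => w b; rewrite /= /diagW_fun; case: ifP => // ->. Qed.

Lemma diagW_eq F F' : (forall b, inr b -> F b = F' b) -> diagW F = diagW F'.
Proof. by move=> h; apply: SW_ext => w b; rewrite /= /diagW_fun; case: ifP => // /h ->. Qed.

Lemma eW_eW : eW * eW = eW.
Proof. by rewrite diagWM; apply: diagW_eq => b _; rewrite mulr1. Qed.

Lemma eW_gen x : eW * genW x = genW x.
Proof.
case: x => [nu|k|l] /=.
- by rewrite diagWM; apply: diagW_eq => b _; rewrite mul1r.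
- by case: ifP; rewrite ?mulr0 // diagWM => _; apply: diagW_eq => b _; rewrite mul1r.
- case: ifP; rewrite ?mulr0 // => _; apply: SW_ext => w b.
  by rewrite /= /diagW_fun /tauW_fun; case: (0 < b <= n.+1)%N.
Qed.
Lemma gen_eW x : genW x * eW = genW x.
Proof.
case: x => [nu|k|l] /=.
- by rewrite diagWM; apply: diagW_eq => b _; rewrite mulr1.
- by case: ifP; rewrite ?mul0r // diagWM => _; apply: diagW_eq => b _; rewrite mulr1.
- case: ifP; rewrite ?mul0r // => hl; apply: SW_ext => w b.
  rewrite /= /diagW_fun /tauW_fun; case: ifP => // /negbFE hb.
  have -> : (0 < l <= n.+1)%N by lia.
  have -> : (0 < l.+1 <= n.+1)%N by lia.
  by rewrite hb.
Qed.

Lemma cWC d (f : SW) : cW d * f = f * cW d. Proof. exact: endo_constC. Qed.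

Local Notation ev := (corner_ev cW eW genW).
Let evM := corner_evM cWC eW_eW eW_gen gen_eW.
Let evD := corner_evD cWC eW_eW eW_gen gen_eW.
Let evB := corner_evB cWC eW_eW eW_gen gen_eW.
Let evg := corner_ev_gen cWC eW_eW eW_gen gen_eW.

Definition dlt (a : nat) (u : V) : W := fun b => if b == a then u else 0.

Lemma dltD a : {morph dlt a : u u' / u + u'}.
Proof.
move=> u u'; apply/funext => b.
suff: dlt a (u + u') b = dlt a u b + dlt a u' b by [].
by rewrite /dlt; case: ifP; rewrite ?addr0.
Qed.
Lemma dlt0 a : dlt a 0 = 0.
Proof. by apply/funext => b; rewrite /dlt; case: ifP. Qed.

(** Reduces every defining relation to vectors of a fixed word placed at one position: all letters
    are then known, and each idempotent keeps or kills the vector. *)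
Lemma SW_eq0 (f : SW) : f * eW = f -> eW * f = f ->
    (forall a mu u b, inr a -> seq_mset mu = gamma -> e mu u = u -> inr b ->
       f (dlt a u) b = 0) ->
  f = 0.
Proof.
move=> fe ef h; rewrite -fe; apply: endoP => w; rewrite endoM_app endo0_app.
have -> : eW w = \sum_(1 <= a < n.+2) dlt a (w a).
  apply/funext => b; rewrite [LHS]/= /diagW_fun.
  have -> : (\sum_(1 <= a < n.+2) dlt a (w a)) b = \sum_(1 <= a < n.+2) dlt a (w a) b.
    by elim/big_rec2: _ => // a x y _ <-.
  case: ifP => hb.
    rewrite (bigD1_seq b) ?mem_index_iota ?iota_uniq //= /dlt eqxx big1 ?addr0 //.
    by move=> a; rewrite eq_sym => /negbTE ->.
  rewrite big_nat big1 // => a ha; rewrite /dlt; case: eqP => // ab; subst b; lia.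
rewrite raddf_sum big_nat big1 // => a ha.
have -> : w a = (1 : S) (w a) by [].
rewrite -(rmorph1 phi) -qe_sum rmorph_sum endo_sum_app.
rewrite (big_morph _ (dltD a) (dlt0 a)) raddf_sum big_seq big1 // => mu.
rewrite mem_wseqs => /eqP hmu; apply/funext => b.
suff: f (dlt a (e mu (w a))) b = 0 by [].
have [hb|hb] := boolP (inr b).
  by rewrite (h a mu) // -endoM_app -rmorphM qee eqxx.
by rewrite -ef endoM_app /= /diagW_fun (negbTE hb).
Qed.

Lemma tauW_lt l w b : inr b -> (b < l)%N -> tauW l w b = T l.-1 (w b).
Proof. by move=> hb hl; rewrite /= /tauW_fun hb hl. Qed.
Lemma tauW_eq l w : inr l -> tauW l w l = w l.+1 - g l (w l).
Proof. by move=> hl; rewrite /= /tauW_fun hl ltnn eqxx. Qed.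
Lemma tauW_eqS l w : inr l.+1 -> tauW l w l.+1 = q l (w l) + g l (w l.+1).
Proof.
move=> hl; rewrite /= /tauW_fun hl eqxx ltnNge leqnSn /=.
by have -> : (l.+1 == l) = false by apply/eqP; lia.
Qed.
Lemma tauW_gt l w b : inr b -> (l.+1 < b)%N -> tauW l w b = T l (w b).
Proof.
move=> hb hl; rewrite /= /tauW_fun hb.
have -> : (b < l)%N = false by lia.
have -> : b == l = false by apply/eqP; lia.
by have -> : b == l.+1 = false by apply/eqP; lia.
Qed.
Lemma diagW_app F w b : inr b -> diagW F w b = F b (w b).
Proof. by move=> hb; rewrite /= /diagW_fun hb. Qed.

(** The operators diagonal at b form a ring mapping to [S]. The lemmas that follow carry polynomials
    and divided differences in the x_k from [W] to a single entry. *)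
Definition acts_at b (f : SW) (s : S) := forall w, f w b = s (w b).

Section ActsAt.
Variable b : nat.
Implicit Types (f : SW) (s : S).
Lemma acts0 : acts_at b 0 0. Proof. by []. Qed.
Lemma actsD f f' s s' : acts_at b f s -> acts_at b f' s' -> acts_at b (f + f') (s + s').
Proof. by move=> h h' w; rewrite [RHS]endoD_app -h -h'. Qed.
Lemma actsB f f' s s' : acts_at b f s -> acts_at b f' s' -> acts_at b (f - f') (s - s').
Proof. by move=> h h' w; rewrite [RHS]endoD_app endoN_app -h -h'. Qed.
Lemma actsM f f' s s' : acts_at b f s -> acts_at b f' s' -> acts_at b (f * f') (s * s').
Proof. by move=> h h' w; rewrite !endoM_app h h'. Qed.
Lemma acts_exp f s m : acts_at b f s -> acts_at b (f ^+ m) (s ^+ m).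
Proof. by move=> h; elim: m => [|m IHm]; rewrite ?exprS //; apply: actsM. Qed.
Lemma acts_sum m (F : 'I_m -> SW) (F' : 'I_m -> S) :
  (forall j, acts_at b (F j) (F' j)) -> acts_at b (\sum_j F j) (\sum_j F' j).
Proof. by move=> h; elim/big_rec2: _ => [|j x y _ hxy]; [exact: acts0 | apply: actsD]. Qed.
Lemma acts_nat m : acts_at b m%:R m%:R.
Proof. by elim: m => [|m IHm]; rewrite ?mulrS //; apply: actsD. Qed.
Lemma acts_bieval p f f' s s' : acts_at b f s -> acts_at b f' s' ->
  acts_at b (bieval cW p f f') (bieval cS p s s').
Proof.
move=> h h'; apply: acts_sum => r; apply: acts_sum => k.
by apply: actsM => //; apply: actsM; apply: acts_exp.
Qed.
Lemma acts_bidiff p f f' f1 s s' s1 : acts_at b f s -> acts_at b f' s' ->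
  acts_at b f1 s1 -> acts_at b (bidiff cW p f f' f1) (bidiff cS p s s' s1).
Proof.
move=> h h' h1; apply: acts_sum => r; apply: acts_sum => k.
apply: actsM => //; apply: actsM; last exact: acts_exp.
by apply: acts_sum => j; apply: actsM; apply: acts_exp.
Qed.
End ActsAt.

Lemma acts_x b k : inr b -> (1 <= k <= n.+1)%N -> acts_at b (genW (GX k)) (xop k b).
Proof. by move=> hb hk w; rewrite /= hk diagW_app. Qed.
Lemma acts_e b nu : inr b -> acts_at b (genW (GE nu)) (eop nu b).
Proof. by move=> hb w; rewrite diagW_app. Qed.

Lemma seq_mset_insE b mu : seq_mset mu = gamma -> seq_mset (ins i b mu) = beta.
Proof. by move=> hmu; apply/eqP; rewrite seq_mset_ins hbeta hmu. Qed.

Lemma eop_out nu b : seq_mset nu != beta -> eop nu b = 0.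
Proof.
move=> hnu; rewrite /eop (_ : qeP _ = 0) ?rmorph0 //.
apply: qe_ext => mu hmu; rewrite qeP_e mul0r; case: eqP => // h.
by rewrite -h seq_mset_insE ?eqxx in hnu.
Qed.

Lemma eop_u nu b mu u : e mu u = u -> eop nu b u = if ins i b mu == nu then u else 0.
Proof.
move=> hu; rewrite -{1}hu -endoM_app -rmorphM qeP_e.
by case: ifP => _; rewrite ?rmorph0.
Qed.

Lemma e_dlt nu a mu u : inr a -> e mu u = u ->
  genW (GE nu) (dlt a u) = if ins i a mu == nu then dlt a u else 0.
Proof.
move=> ha hu; apply/funext => b.
have -> : (if ins i a mu == nu then dlt a u else 0) b =
  if ins i a mu == nu then dlt a u b else 0 by case: ifP.
rewrite [LHS]/= /diagW_fun /dlt; case: (eqVneq b a) => [->|_].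
  by rewrite ha (eop_u _ _ hu).
by case: ifP => _; case: ifP; rewrite ?efun0.
Qed.

Lemma comm_xop k k' b : GRing.comm (xop k b) (xop k' b).
Proof.
rewrite /xop; case: ifP => _; last case: ifP => _; case: ifP => _; try case: ifP => _;
  by do ?[exact: comm_XX | exact: commr_refl
  | exact: comm_tphi | exact: comm_phit].
Qed.
Lemma comm_xop_eop k nu b : GRing.comm (xop k b) (eop nu b).
Proof.
rewrite /xop; case: ifP => _; [|case: ifP => _]; do ?exact: comm_tphi;
  by apply: comm_phi; rewrite qePx.
Qed.

Lemma ev_gen_x k : ev (fgen K (GX k)) = genW (GX k) * eW.
Proof. by rewrite evg gen_eW. Qed.

Let gX k l : GRing.comm (g k) (X l). Proof. exact: comm_gIX. Qed.
Let gt k : GRing.comm (g k) t. Proof. exact: comm_gIt. Qed.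
Let qX k l : GRing.comm (q k) (X l). Proof. exact: comm_qIX. Qed.
Let qt k : GRing.comm (q k) t. Proof. exact: comm_qIt. Qed.

Lemma app_comm (x y : S) u : GRing.comm x y -> x (y u) = y (x u).
Proof. by move=> h; rewrite -!endoM_app h. Qed.

Lemma dlt_eq a u : dlt a u a = u. Proof. by rewrite /dlt eqxx. Qed.
Lemma dlt_neq a b u : b != a -> dlt a u b = 0.
Proof. by rewrite /dlt => /negbTE ->. Qed.

Lemma gI_u k mu u : seq_mset mu = gamma -> (1 <= k <= n)%N -> e mu u = u ->
  g k u = if letter i k mu == i then G k u else 0.
Proof.
move=> hmu hk hu; rewrite -{1}hu -endoM_app gI_e //.
by case: ifP => _ //; rewrite endoM_app hu.
Qed.

Lemma app_e (x : S) mu u : GRing.comm x (e mu) -> e mu u = u -> e mu (x u) = x u.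
Proof. by move=> h hu; rewrite -(app_comm _ h) hu. Qed.

Lemma T_e_u l mu u : e mu u = u -> e (swap_word l mu) (T l u) = T l u.
Proof. by move=> hu; rewrite -endoM_app -T_e endoM_app hu. Qed.

(** Every nonzero entry of the image has the swapped word as its type; this is the relation between
    tau_l and the e(nu) seen on one vector. *)
Lemma tauW_dlt_type l a mu u b : (1 <= l < n.+1)%N -> inr a -> inr b ->
    seq_mset mu = gamma -> e mu u = u ->
  tauW l (dlt a u) b = 0 \/
  exists mu', e mu' (tauW l (dlt a u) b) = tauW l (dlt a u) b
    /\ ins i b mu' = swap_word l (ins i a mu).
Proof.
move=> hl ha hb hmu hu; have sz := wseq_size hmu.
have swl : swap_word l (ins i l mu) = ins i l.+1 mu by apply: swap_ins_eq; rewrite sz; lia.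
have swS : swap_word l (ins i l.+1 mu) = ins i l mu by rewrite -swl swap_wordK.
(* A diagonal entry keeps the special strand in place, which would contradict the swapped type. But
   g_l u is nonzero only if the letter at l is [i], and inserting [i] before or after it gives the
   same word. *)
have gi : g l u = 0 \/ ins i l mu = ins i l.+1 mu.
  rewrite (gI_u hmu _ hu); last by lia.
  case: eqP => [hc|_]; [right|by left].
  have d1 : drop l.-1 mu = i :: drop l mu.
    by rewrite (drop_nth i) ?sz; [congr (_ :: drop _ _) => //; lia | lia].
  have t1 : take l mu = rcons (take l.-1 mu) i.
    by rewrite -[in RHS]hc /letter -take_nth ?sz ?prednK //; lia.
  by rewrite /ins d1 t1 cat_rcons.
case: (ltngtP b l) => hbl.
- rewrite tauW_lt // ; have [ab|ab] := eqVneq b a; last by left; rewrite dlt_neq // efun0.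
  subst b; rewrite dlt_eq; right; exists (swap_word l.-1 mu).
  by rewrite T_e_u // swap_ins_lt // ?sz; lia.
- have [bl|bl] := eqVneq b l.+1.
    subst b; rewrite tauW_eqS //; have [al|al] := eqVneq l a.
      subst a; rewrite dlt_eq dlt_neq ?efun0 ?addr0; last by apply/eqP; lia.
      by right; exists mu; rewrite swl app_e //; exact: comm_qIe.
    rewrite dlt_neq // efun0 add0r; have [al'|al'] := eqVneq l.+1 a.
      subst a; rewrite dlt_eq swS; case: gi => [->|gi]; first by left.
      by right; exists mu; rewrite -gi app_e //; exact: comm_gIe.
    by left; rewrite dlt_neq // efun0.
  rewrite tauW_gt //; last by lia.
  have [ab|ab] := eqVneq b a; last by left; rewrite dlt_neq // efun0.
  subst b; rewrite dlt_eq; right; exists (swap_word l mu).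
  by rewrite T_e_u // swap_ins_gt // ?sz; lia.
- subst b; rewrite tauW_eq //; have [al|al] := eqVneq l a.
    subst a; rewrite dlt_eq dlt_neq ?sub0r; last by apply/eqP; lia.
    case: gi => [->|gi]; first by left; rewrite oppr0.
    right; exists mu; rewrite swl -gi efunN app_e //; exact: comm_gIe.
  rewrite (dlt_neq _ al) efun0 subr0; have [al'|al'] := eqVneq l.+1 a.
    by subst a; rewrite dlt_eq swS; right; exists mu.
  by left; rewrite dlt_neq.
Qed.

Lemma tauW_e l a mu u nu : (1 <= l < n.+1)%N -> inr a ->
    seq_mset mu = gamma -> e mu u = u ->
  genW (GE nu) (tauW l (dlt a u)) =
  if swap_word l (ins i a mu) == nu then tauW l (dlt a u) else 0.
Proof.
move=> hl ha hmu hu; apply/funext => b.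
have -> : (if swap_word l (ins i a mu) == nu then tauW l (dlt a u) else 0) b =
  if swap_word l (ins i a mu) == nu then tauW l (dlt a u) b else 0 by case: ifP.
have [hb|hb] := boolP (inr b); last first.
  by rewrite /= /diagW_fun /tauW_fun (negbTE hb) /= if_same.
rewrite [LHS]diagW_app //.
have [->|[mu' [hu' <-]]] := tauW_dlt_type hl ha hb hmu hu.
  by rewrite efun0 if_same.
exact: eop_u.
Qed.

Ltac tau_rows := repeat first
  [ rewrite tauW_eq; last by lia
  | rewrite tauW_eqS; last by lia
  | rewrite tauW_lt; [|by lia|by lia]
  | rewrite tauW_gt; [|by lia|by lia] ].

Ltac tau_far := rewrite -?endoM_app; congr (efun _ _);
  first [ by apply: comm_phi; apply: qtt; lia
        | by apply: T_gI_far => //; lia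
        | by apply/commr_sym/T_gI_far => //; lia
        | by apply: T_qI_far => //; lia
        | by apply/commr_sym/T_qI_far => //; lia ].

(** The position pairs {k, k+1} and {l, l+1} are disjoint, so at every position it is enough that
    the entries of one tau commute with what the other does there. *)
Lemma tauW_comm k l : (1 <= k)%N -> (k.+1 < l < n.+1)%N ->
  tauW k * tauW l = tauW l * tauW k.
Proof.
move=> hk hl; apply: SW_ext => w b; rewrite !endoM_app.
have [hb|hb] := boolP (inr b); last by rewrite /= /tauW_fun hb.
have [h1|h1] := ltnP b k; first by tau_rows; tau_far.
have [h2|h2] := eqVneq b k; first by subst b; tau_rows; rewrite efunB; congr (_ - _); tau_far.
have [h3|h3] := eqVneq b k.+1.
  by subst b; tau_rows; rewrite efunD; congr (_ + _); tau_far.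
have [h4|h4] := ltnP b l; first by tau_rows; tau_far.
have [h5|h5] := eqVneq b l; first by subst b; tau_rows; rewrite efunB; congr (_ - _); tau_far.
have [h6|h6] := eqVneq b l.+1.
  by subst b; tau_rows; rewrite efunD; congr (_ + _); tau_far.
by tau_rows; tau_far.
Qed.

Lemma eq_app (x y : S) mu u : x * e mu = y * e mu -> e mu u = u -> x u = y u.
Proof. by move=> h hu; rewrite -hu -!endoM_app h. Qed.

Lemma letter_ins k a mu : inr a -> seq_mset mu = gamma -> (0 < k)%N ->
  letter i k (ins i a mu) = if (k < a)%N then letter i k mu
    else if k == a then i else letter i k.-1 mu.
Proof. by move=> ha hmu hk; apply: nth_ins; rewrite // (wseq_size hmu). Qed.

Lemma xop_lt k b : (k < b)%N -> xop k b = X k. Proof. by rewrite /xop => ->. Qed.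
Lemma xop_eq b : xop b b = t. Proof. by rewrite /xop ltnn eqxx. Qed.
Lemma xop_gt k b : (b < k)%N -> xop k b = X k.-1.
Proof.
move=> h; rewrite /xop; have -> : (k < b)%N = false by lia.
by have -> : (k == b) = false by apply/eqP; lia.
Qed.

Ltac eqF := repeat match goal with
  |- context [@eq_op _ ?x ?y] => rewrite (_ : (x == y) = false); last by apply/eqP; lia
  end.
Ltac letters ha hmu := rewrite ?(@letter_ins _ _ _ ha hmu); try by lia.

Lemma qI_sq k : q k + g k * g k = Qh i t k. Proof. by rewrite subrK. Qed.

Lemma comm_qg k : q k * g k = g k * q k. Proof. exact: comm_qIgI. Qed.

Lemma Qh_u mu u l : seq_mset mu = gamma -> e mu u = u -> Qh i t l u =
  bieval cS (qpol D i (letter i l mu)) t (X l) u.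
Proof.
move=> hmu hu; apply: (eq_app _ hu); rewrite Qh_e //.
by rewrite bieval_qpolC //; exact: comm_phit.
Qed.

Lemma comm_with_xop (x : S) m b : GRing.comm x t -> (forall k, GRing.comm x (X k)) ->
  GRing.comm x (xop m b).
Proof. by move=> h h'; rewrite /xop; case: ifP => _; last case: ifP. Qed.

Section TauRelations.
Variables (l a b : nat) (mu : seq I) (u : V).
Hypotheses (hl : (1 <= l < n.+1)%N) (ha : inr a) (hb : inr b).
Hypotheses (hmu : seq_mset mu = gamma) (hu : e mu u = u).
Local Notation j := (letter i l (ins i a mu)).
Local Notation k := (letter i l.+1 (ins i a mu)).

(** Away from l and l + 1 this is tau^2 in R(gamma). On these two positions it is the square of a
    matrix of trace zero: [comm_qg] cancels an off-diagonal entry and [qI_sq] gives the diagonal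
    ones. *)
Lemma tauW_sq : tauW l (tauW l (dlt a u)) b =
  bieval cS (qpol D j k) (xop l b) (xop l.+1 b) (dlt a u b).
Proof.
have [h1|h1] := ltnP b l.
  tau_rows; rewrite !xop_gt //; try lia; have [ab|ab] := eqVneq b a; last first.
    by rewrite dlt_neq // !efun0.
  subst b; rewrite dlt_eq -endoM_app; letters ha hmu.
  have -> : (l < a)%N = false by lia.
  have -> : (l.+1 < a)%N = false by lia.
  have -> : (l == a) = false by apply/eqP; lia.
  have -> : (l.+1 == a) = false by apply/eqP; lia.
  apply: (eq_app _ hu); rewrite (@T_T_e _ _ _ _ i) //; last by lia.
  by rewrite prednK //; lia.
have [h2|h2] := ltnP l.+1 b.
  tau_rows; rewrite !xop_lt //; try lia; have [ab|ab] := eqVneq b a; last first.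
    by rewrite dlt_neq // !efun0.
  subst b; rewrite dlt_eq -endoM_app; letters ha hmu.
  have -> : (l < a)%N by lia.
  have -> : (l.+1 < a)%N by lia.
  by apply: (eq_app _ hu); rewrite (@T_T_e _ _ _ _ i) //; lia.
have lSl : l.+1 != l by apply/eqP; lia.
have lSl' : l != l.+1 by apply/eqP; lia.
have [h3|h3] := eqVneq b l.
  subst b; tau_rows; rewrite xop_eq xop_gt //.
  have [al|al] := eqVneq l a; last first.
    by rewrite (dlt_neq _ al) !efun0 subr0 add0r subrr.
  subst a; rewrite dlt_eq dlt_neq // efun0 addr0 sub0r efunN opprK.
  rewrite -endoM_app -endoD_app qI_sq (Qh_u _ hmu hu); letters ha hmu.
  by rewrite ltnn eqxx (_ : (l.+1 < l)%N = false) ?(negbTE lSl); last by lia.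
have {}h3 : b = l.+1 by lia.
subst b; tau_rows; rewrite xop_eq xop_lt //.
have [al|al] := eqVneq l a.
  subst a; rewrite dlt_eq dlt_neq // !efun0 sub0r addr0 efunN -!endoM_app comm_qg addNr.
  by [].
rewrite (dlt_neq _ al) !efun0 subr0 add0r; have [al'|al'] := eqVneq l.+1 a; last first.
  by rewrite dlt_neq // !efun0 addr0.
subst a; rewrite dlt_eq -endoM_app -endoD_app qI_sq; letters ha hmu.
rewrite ltnSn ltnn eqxx; apply: (eq_app _ hu); exact: Qh_e.
Qed.

Lemma tauW_x_comm m : (1 <= m <= n.+1)%N ->
  tauW l (diagW (xop m) (dlt a u)) b - xop (swap_at l m) b (tauW l (dlt a u) b) =
  (((m == l.+1)%:R - (m == l)%:R) * (j == k)%:R : S) (dlt a u b).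
Proof.
move=> hm; have hs : (1 <= swap_at l m <= n.+1)%N.
  by rewrite /swap_at; case: ifP => _; [lia | case: ifP => _; lia].
have xsE c : inr c -> diagW (xop m) (dlt a u) c = xop m c (dlt a u c) by apply: diagW_app.
have [h1|h1] := ltnP b l.
  tau_rows; rewrite xsE //; have [ab|ab] := eqVneq b a; last first.
    by rewrite dlt_neq // !efun0 subr0.
  subst b; rewrite dlt_eq -!endoM_app -endoN_app -endoD_app; letters ha hmu.
  have -> : (l < a)%N = false by lia.
  have -> : (l.+1 < a)%N = false by lia.
  have -> : (l == a) = false by apply/eqP; lia.
  have -> : (l.+1 == a) = false by apply/eqP; lia.
  apply: (eq_app _ hu); have hl1 : (1 <= l.-1 < n)%N by lia.
  case: (ltngtP m a) => ham.
  - have e0 : swap_at l m = m by rewrite /swap_at; eqF.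
    rewrite e0 !xop_lt //; have := @T_qx_e _ _ _ _ i _ V _ _ m hl1 hmu.
    have -> : swap_at l.-1 m = m by rewrite /swap_at; eqF.
    move=> ->; rewrite prednK; last by lia.
    by eqF; rewrite !subrr !mul0r.
  - have -> : xop m a = X m.-1 by rewrite xop_gt.
    have -> : xop (swap_at l m) a = X (swap_at l.-1 m.-1).
      rewrite xop_gt; last by rewrite /swap_at; case: eqP; [lia | case: eqP; lia].
      by congr (phi (qx _)); rewrite /swap_at; do 4 (case: eqP; try lia).
    rewrite (@T_qx_e _ _ _ _ i) // prednK; last by lia.
    congr ((_ - _) * _ * _); congr (_%:R); congr (nat_of_bool _); apply/eqP/eqP; lia.
  - subst m; have -> : swap_at l a = a by rewrite /swap_at; eqF.
    rewrite xop_eq t_phi subrr mul0r; eqF.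
    by rewrite subrr !mul0r.
have [h2|h2] := ltnP l.+1 b.
  tau_rows; rewrite xsE //; have [ab|ab] := eqVneq b a; last first.
    by rewrite dlt_neq // !efun0 subr0.
  subst b; rewrite dlt_eq -!endoM_app -endoN_app -endoD_app; letters ha hmu.
  have -> : (l < a)%N by lia.
  have -> : (l.+1 < a)%N by lia.
  apply: (eq_app _ hu); have hl1 : (1 <= l < n)%N by lia.
  case: (ltngtP m a) => ham.
  - have hsa : (swap_at l m < a)%N by rewrite /swap_at; case: eqP; [lia | case: eqP; lia].
    by rewrite !xop_lt // (@T_qx_e _ _ _ _ i).
  - have e0 : swap_at l m = m by rewrite /swap_at; eqF.
    rewrite e0 !xop_gt //; have := @T_qx_e _ _ _ _ i _ V _ _ m.-1 hl1 hmu.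
    have -> : swap_at l m.-1 = m.-1 by rewrite /swap_at; eqF.
    by move=> ->; eqF; rewrite !subrr !mul0r.
  - subst m; have -> : swap_at l a = a by rewrite /swap_at; eqF.
    rewrite xop_eq t_phi subrr mul0r; eqF.
    by rewrite subrr !mul0r.
(* Moving the special strand across the crossing has the same effect on the x_m as the transposition
   of their indices, so the off-diagonal entries satisfy the relation with no correction. *)
have swx : xop (swap_at l m) l = xop m l.+1 /\ xop (swap_at l m) l.+1 = xop m l.
  rewrite /swap_at; have [->|hml] := eqVneq m l.
    by rewrite !xop_eq xop_gt // xop_lt.
  have [->|hml'] := eqVneq m l.+1; first by rewrite !xop_eq xop_lt // xop_gt.
  case: (ltngtP m l) => hh.
  - by rewrite !xop_lt //; lia.
  - by rewrite !xop_gt //; lia.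
  - by rewrite hh eqxx in hml.
have lSl : l.+1 != l by apply/eqP; lia.
have lSl' : l != l.+1 by apply/eqP; lia.
have gxx y : (y != l) -> (y != l.+1) -> xop y l.+1 = xop y l.
  by move=> y1 y2; rewrite /xop (negbTE y1) (negbTE y2); case: ifP; case: ifP => //; lia.
have hgl : g l * e mu = if letter i l mu == i then G l * e mu else 0.
  by apply: gI_e => //; lia.
(* The only source of Kronecker deltas on these rows: (t - x_l) g_l is the projection to words with
   letter [i] at l. *)
have gt1 : (t * g l - g l * X l) * e mu = (letter i l mu == i)%:R * e mu.
  rewrite gX -mulrBl -mulrA hgl; case: eqP => _; last by rewrite mulr0 mul0r.
  by rewrite mulrA tG.
have gx y : GRing.comm (g l) (xop y l) by apply: comm_with_xop.
have gt2 : t * g l = g l * t by rewrite gt.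
have gt3 : X l * g l = g l * X l by rewrite gX.
have [h3|h3] := eqVneq b l.
  subst b; tau_rows; rewrite !xsE; try lia; rewrite swx.1.
  have [al|al] := eqVneq l a; last first.
    by rewrite (dlt_neq _ al) !efun0 !subr0 subrr.
  subst a; rewrite dlt_eq dlt_neq // !efun0 !sub0r efunN opprK; letters ha hmu.
  rewrite ltnn eqxx (_ : (l.+1 < l)%N = false) ?(negbTE lSl); last by lia.
  rewrite -!endoM_app -endoN_app -endoD_app; apply: (eq_app _ hu).
  rewrite (eq_sym i); have [-> |hml] := eqVneq m l.
    rewrite xop_eq xop_lt // (negbTE lSl') sub0r mulN1r [in RHS]mulNr -gt1 -[in RHS]mulNr opprB.
    by rewrite gt3 gt2 (addrC _ (g l * X l)).
  have [-> |hml'] := eqVneq m l.+1.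
    by rewrite xop_eq xop_gt // subr0 mul1r -gt1 addrC.
  by rewrite gxx // gx addNr subrr !mul0r.
have {}h3 : b = l.+1 by lia.
subst b; tau_rows; rewrite !xsE; try lia; rewrite swx.2.
have [al|al] := eqVneq l a.
  subst a; rewrite dlt_eq dlt_neq // !efun0 !addr0 -!endoM_app.
  have -> : q l * xop m l = xop m l * q l.
    exact: comm_with_xop.
  by rewrite subrr.
rewrite (dlt_neq _ al) !efun0 !add0r; have [al'|al'] := eqVneq l.+1 a; last first.
  by rewrite dlt_neq // !efun0 subrr.
subst a; rewrite dlt_eq; letters ha hmu.
rewrite ltnSn ltnn eqxx -!endoM_app -endoN_app -endoD_app; apply: (eq_app _ hu).
have [-> |hml] := eqVneq m l.
  rewrite xop_eq xop_lt // (negbTE lSl') sub0r mulN1r [in RHS]mulNr -gt1 -[in RHS]mulNr opprB.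
  by [].
have [-> |hml'] := eqVneq m l.+1.
  by rewrite xop_eq xop_gt // subr0 mul1r -gt1 -gt2 gt3.
by rewrite gxx // gx !subrr !mul0r.
Qed.

End TauRelations.

Ltac ltnFT := repeat match goal with
  |- context [leq ?x ?y] => first [ rewrite (_ : leq x y = false); last by lia
                                  | rewrite (_ : leq x y = true); last by lia ]
  end.

Lemma tauW_braid l a b mu u : (1 <= l)%N -> (l.+1 < n.+1)%N -> inr a -> inr b ->
    seq_mset mu = gamma -> e mu u = u ->
  tauW l.+1 (tauW l (tauW l.+1 (dlt a u))) b
  - tauW l (tauW l.+1 (tauW l (dlt a u))) b =
  ((letter i l (ins i a mu) == letter i l.+2 (ins i a mu))%:R
   * bidiff cS (qpol D (letter i l (ins i a mu)) (letter i l.+1 (ins i a mu)))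
       (xop l b) (xop l.+2 b) (xop l.+1 b) : S) (dlt a u b).
Proof.
move=> l1 l2 ha hb hmu hu.
have [h1|h1] := ltnP b l.
  tau_rows; rewrite !xop_gt //; try lia; have [ab|ab] := eqVneq b a; last first.
    by rewrite dlt_neq // !efun0 subrr.
  subst b; rewrite dlt_eq -!endoM_app -endoN_app -endoD_app; letters ha hmu.
  ltnFT.
  eqF.
  apply: (eq_app _ hu).
  have := @T_braid_e _ _ _ _ i _ V l.-1 mu; rewrite prednK; last by lia.
  by move=> -> //; lia.
have [h2|h2] := ltnP l.+2 b.
  tau_rows; rewrite !xop_lt //; try lia; have [ab|ab] := eqVneq b a; last first.
    by rewrite dlt_neq // !efun0 subrr.
  subst b; rewrite dlt_eq -!endoM_app -endoN_app -endoD_app; letters ha hmu.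
  ltnFT.
  apply: (eq_app _ hu).
  have := @T_braid_e _ _ _ _ i _ V l mu.
  by move=> -> //; lia.
(* Opaque names for the entries, so that the rewriting of rows does not look inside them. *)
have [qa qaE] : {qa | qa = q l} by exists (q l).
have [qb qbE] : {qb | qb = q l.+1} by exists (q l.+1).
have [ga gaE] : {ga | ga = g l} by exists (g l).
have [gb gbE] : {gb | gb = g l.+1} by exists (g l.+1).
have pl : l.+1.-1 = l by [].
have hln : (1 <= l < n)%N by lia.
pose simp := (efunD, efunB, efunN, efun0, sub0r, subr0, add0r, addr0, opprK, oppr0, subrr).
have lE : (l == l.+1) = false by apply/eqP; lia.
have lE2 : (l == l.+2) = false by apply/eqP; lia.
have lE3 : (l.+1 == l.+2) = false by apply/eqP; lia.
have [lE' [lE2' lE3']] : [/\ (l.+1 == l) = false, (l.+2 == l) = false & (l.+2 == l.+1) = false].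
  by split; apply/eqP; lia.
(* Nine cases, with source a and target b in {l, l+1, l+2}. For a = b the entry is the divided
   difference of the braid relation; otherwise the right-hand side is zero and the two products have
   to agree. *)
have [a1|a1] := eqVneq a l.
  subst a; have d1 : dlt l u l = u by rewrite dlt_eq.
  have d2 : dlt l u l.+1 = 0 by rewrite /dlt lE'.
  have d3 : dlt l u l.+2 = 0 by rewrite /dlt lE2'.
  have [b1|b1] := eqVneq b l.
    subst b; tau_rows; rewrite ?pl -?qaE -?qbE -?gaE -?gbE !(d1, d2, d3) !simp; letters ha hmu.
    rewrite opprD opprK addrA; ltnFT; eqF; rewrite !eqxx.
    have := entry11 i t_phi tG Gt hln hmu; rewrite -gaE -gbE -qaE => E.
    transitivity ((- (T l * ga * T l) + gb * qa - ga * T l * ga) u); first by [].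
    rewrite !xop_eq !xop_gt //; try lia; apply: (eq_app _ hu).
    by rewrite E (eq_sym i); case: ifP => _; rewrite ?mul1r ?mul0r.
  have [b2|b2] := eqVneq b l.+1.
    subst b; tau_rows; rewrite ?pl -?qaE -?qbE -?gaE -?gbE !(d1, d2, d3) !simp.
    have := entry21 i t_phi tG Gt hln; rewrite -gaE -gbE -qaE => E.
    transitivity ((- (gb * qa * T l) + ga * gb * qa + qa * T l * ga) u); last by rewrite E.
    by rewrite !opprD !opprK (addrC (qa _)) addrA.
  have b3 : b = l.+2 by lia.
  subst b; tau_rows; rewrite ?pl -?qaE -?qbE -?gaE -?gbE !(d1, d2, d3) !simp.
  have := entry13 i t_phi tG Gt hln; rewrite -qbE -qaE => E.
  by rewrite -!endoM_app [T l * _]mulrA E subrr.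
have [a2|a2] := eqVneq a l.+1.
  subst a; have d1 : dlt l.+1 u l = 0 by rewrite /dlt lE.
  have d2 : dlt l.+1 u l.+1 = u by rewrite dlt_eq.
  have d3 : dlt l.+1 u l.+2 = 0 by rewrite /dlt lE3'.
  have [b1|b1] := eqVneq b l.
    subst b; tau_rows; rewrite ?pl -?qaE -?qbE -?gaE -?gbE !(d1, d2, d3) !simp.
    have := T_gIS i t_phi tG Gt hln; rewrite -gaE -gbE => E.
    rewrite -[T l (gb u)]endoM_app E endoD_app !endoM_app opprD.
    rewrite -[gb (ga u)]endoM_app gaE gbE (comm_gIgI i t_phi tG Gt l.+1 l) endoM_app.
    by rewrite opprD !opprK addrA subrK addNr.
  have [b2|b2] := eqVneq b l.+1.
    subst b; tau_rows; rewrite ?pl -?qaE -?qbE -?gaE -?gbE !(d1, d2, d3) !simp; letters ha hmu.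
    have := entry22 i t_phi tG Gt hln; rewrite -gaE -gbE -qaE -qbE => E.
    transitivity ((T l * qb + gb * ga * gb - qa * T l + ga * gb * ga) u).
      by rewrite opprB addrA addrAC.
    rewrite E; ltnFT; eqF; rewrite !eqxx xop_lt // xop_eq xop_gt //.
    apply: (eq_app _ hu); rewrite Dl_e //.
    by case: ifP => _; rewrite ?mul1r ?mul0r.
  have b3 : b = l.+2 by lia.
  subst b; tau_rows; rewrite ?pl -?qaE -?qbE -?gaE -?gbE !(d1, d2, d3) !simp.
  have := entry32 i t_phi tG Gt hln; rewrite -gaE -gbE -qbE => E.
  transitivity ((gb * T l * qb - qb * ga * gb - T l * qb * ga) u); last by rewrite E.
  by rewrite (addrC (- _)).
have [a3|a3] := eqVneq a l.+2.
  subst a; have d1 : dlt l.+2 u l = 0 by rewrite /dlt lE2.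
  have d2 : dlt l.+2 u l.+1 = 0 by rewrite /dlt lE3.
  have d3 : dlt l.+2 u l.+2 = u by rewrite dlt_eq.
  have [b1|b1] := eqVneq b l.
    subst b; tau_rows; rewrite ?pl -?qaE -?qbE -?gaE -?gbE !(d1, d2, d3) !simp.
    by [].
  have [b2|b2] := eqVneq b l.+1.
    subst b; tau_rows; rewrite ?pl -?qaE -?qbE -?gaE -?gbE !(d1, d2, d3) !simp.
    have := T_gIS i t_phi tG Gt hln; rewrite -gaE -gbE => E.
    rewrite -[T l (gb u)]endoM_app E endoD_app !endoM_app gaE gbE.
    rewrite -[gI i G l.+1 _]endoM_app (comm_gIgI i t_phi tG Gt l.+1 l) endoM_app.
    by rewrite addrK subrr.
  have b3 : b = l.+2 by lia.
  subst b; tau_rows; rewrite ?pl -?qaE -?qbE -?gaE -?gbE !(d1, d2, d3) !simp; letters ha hmu.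
  have := entry33 i t_phi tG Gt hln hmu; rewrite -gaE -gbE -qbE => E.
  transitivity ((qb * ga + gb * T l * gb - T l * gb * T l) u); first by [].
  ltnFT; eqF; rewrite !eqxx xop_eq !xop_lt //; apply: (eq_app _ hu).
  by rewrite E; case: eqP => [->|_]; rewrite ?mul1r ?mul0r.
(* Now a lies outside the block and b inside it, so all the entries that are read vanish. *)
have d1 : dlt a u l = 0 by rewrite dlt_neq // eq_sym.
have d2 : dlt a u l.+1 = 0 by rewrite dlt_neq // eq_sym.
have d3 : dlt a u l.+2 = 0 by rewrite dlt_neq // eq_sym.
have [b1|b1] := eqVneq b l; first by subst b; tau_rows; rewrite ?pl -?qaE -?qbE -?gaE -?gbE !(d1, d2, d3) !simp.
have [b2|b2] := eqVneq b l.+1; first by subst b; tau_rows; rewrite ?pl -?qaE -?qbE -?gaE -?gbE !(d1, d2, d3) !simp.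
have b3 : b = l.+2 by lia.
by subst b; tau_rows; rewrite ?pl -?qaE -?qbE -?gaE -?gbE !(d1, d2, d3) !simp.
Qed.

Lemma letter_cat s (x : I) r : letter i (size s).+1 (s ++ x :: r) = x.
Proof. by rewrite /letter /= nth_cat ltnn subnn. Qed.
Lemma letter_catS s (x y : I) r : letter i (size s).+2 (s ++ [:: x, y & r]) = y.
Proof. by rewrite /letter /= nth_cat ltnNge leqnSn /= subSnn. Qed.
Lemma letter_catSS s (x y z : I) r : letter i (size s).+3 (s ++ [:: x, y, z & r]) = z.
Proof. by rewrite /letter /= nth_cat ltnNge leqW ?leqW //= -addn2 addKn. Qed.

Lemma SW_if0 (P : bool) (f : SW) w : f (if P then w else 0) = if P then f w else 0.
Proof. by case: P; rewrite ?efun0. Qed.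

Lemma genW_tau l : (1 <= l < n.+1)%N -> genW (GT l) = tauW l.
Proof. by move=> hl; rewrite /= hl. Qed.
Lemma genW_x k : (1 <= k <= n.+1)%N -> genW (GX k) = diagW (xop k).
Proof. by move=> hk; rewrite /= hk. Qed.

Lemma genW_tau_out l : ~~ (1 <= l < n.+1)%N -> genW (GT l) = 0.
Proof. by move=> hl; rewrite /= (negbTE hl). Qed.
Lemma genW_x_out k : ~~ (1 <= k <= n.+1)%N -> genW (GX k) = 0.
Proof. by move=> hk; rewrite /= (negbTE hk). Qed.

Lemma relW a : qrel D beta a -> ev a = 0.
Proof.
have exl k : eW * genW (GX k) = genW (GX k) * eW by rewrite eW_gen gen_eW.
have evn m : ev m%:R = m%:R * eW := corner_ev_nat cWC eW_eW eW_gen gen_eW m.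
move=> ra; apply: SW_eq0; [exact: (corner_evr _ eW_eW gen_eW)|
  exact: (corner_evl cWC eW_eW eW_gen) |].
move: a ra => _ [nu hnu|k hk|l hl|nu nu'||k nu|k l|s j k r l|k l hkl
  |s j k r l nu|s j k r m l nu|s j k k' r l nu] a mu u b ha hmu hu hb.
- by rewrite evg [LHS]diagW_app // eop_out.
- by rewrite evg /= -size_beta (negbTE hk).
- by rewrite evg /= -size_beta (negbTE hl).
- rewrite evB evM !evg (_ : ev (if _ then _ else _)
    = if nu == nu' then genW (GE nu) else 0); last first.
    by case: ifP => _; rewrite ?evg ?(corner_ev0 cWC eW_eW eW_gen gen_eW).
  rewrite endoD_app endoN_app endoM_app (e_dlt _ ha hu) SW_if0 (e_dlt _ ha hu).
  case: (eqVneq nu nu') => [<-|h]; first by rewrite (e_dlt _ ha hu); case: ifP => [->|_]; rewrite subrr.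
  rewrite endo0_app subr0; case: (ins i a mu =P nu') => // ->.
  by rewrite eq_sym (negbTE h).
- rewrite evB (corner_ev_sum cWC eW_eW eW_gen gen_eW).
  rewrite (corner_ev1 cWC eW_eW eW_gen gen_eW) endoD_app endoN_app endo_sum_app.
  under eq_bigr => nu _ do rewrite evg (e_dlt _ ha hu).
  rewrite (bigD1_seq (ins i a mu)) ?mem_wseqs ?seq_mset_insE ?permutations_uniq //=.
  rewrite eqxx big1 ?addr0 => [|nu]; last by rewrite eq_sym => /negbTE ->.
  suff: dlt a u b - diagW_fun (fun=> 1) (dlt a u) b = 0 by [].
  by rewrite /diagW_fun hb subrr.
- rewrite evB !evM !evg; apply/eqP; rewrite endoD_app endoN_app; apply/eqP.
  suff: genW (GX k) (genW (GE nu) (dlt a u)) b - genW (GE nu) (genW (GX k) (dlt a u)) b = 0 by [].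
  have [hk|hk] := boolP (1 <= k <= n.+1)%N; last first.
    by rewrite (genW_x_out hk) efun0 subrr.
  rewrite acts_x // [genW (GE nu) _ _]acts_e // [genW (GE nu) (genW _ _) _]acts_e // acts_x //.
  by rewrite (app_comm _ (comm_xop_eop _ _ _)) subrr.
- rewrite evB !evM !evg.
  suff: genW (GX k) (genW (GX l) (dlt a u)) b - genW (GX l) (genW (GX k) (dlt a u)) b = 0 by [].
  have [hk|hk] := boolP (1 <= k <= n.+1)%N; last first.
    by rewrite (genW_x_out hk) efun0 subrr.
  have [hl|hl] := boolP (1 <= l <= n.+1)%N; last first.
    by rewrite (genW_x_out hl) efun0 subrr.
  by rewrite !acts_x // (app_comm _ (comm_xop _ _ _)) subrr.
- rewrite evB !evM !evg.
  suff: genW (GT l) (genW (GE (s ++ [:: j, k & r])) (dlt a u)) b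
    - genW (GE (s ++ [:: k, j & r])) (genW (GT l) (dlt a u)) b = 0 by [].
  have [hl|hl] := boolP (1 <= l < n.+1)%N; last first.
    by rewrite (genW_tau_out hl) efun0 subrr.
  rewrite genW_tau // (e_dlt _ ha hu) SW_if0 (tauW_e _ hl ha hmu hu).
  rewrite -(swap_word_cat s j k r) (inj_eq (can_inj (swap_wordK _))).
  by case: ifP; rewrite subrr.
- rewrite evB !evM !evg.
  suff: genW (GT k) (genW (GT l) (dlt a u)) b - genW (GT l) (genW (GT k) (dlt a u)) b = 0 by [].
  have [hk|hk] := boolP (1 <= k < n.+1)%N; last first.
    by rewrite (genW_tau_out hk) efun0 subrr.
  have [hl|hl] := boolP (1 <= l < n.+1)%N; last first.
    by rewrite (genW_tau_out hl) efun0 subrr.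
  rewrite !genW_tau // -[tauW k (tauW l _)]endoM_app -[tauW l (tauW k _)]endoM_app.
  by case/orP: hkl => h; [rewrite (@tauW_comm k l)|rewrite (@tauW_comm l k)]; rewrite ?subrr //; lia.
- rewrite evB expr2 !evM !(evg (GE _)) !(evg (GT _)).
  rewrite (corner_ev_bieval cWC eW_eW eW_gen gen_eW _ (a' := genW (GX l))
    (b' := genW (GX l.+1))) ?ev_gen_x ?exl // -[_ * eW * _]mulrA eW_gen.
  set B := bieval _ _ _ _.
  suff: genW (GT l) (genW (GT l) (genW (GE nu) (dlt a u))) b
    - B (genW (GE nu) (dlt a u)) b = 0 by [].
  (* Only the word of the test vector contributes; its length n + 1 then puts l in range. *)
  rewrite (e_dlt _ ha hu); case: eqP => hnu; last by rewrite !efun0 subrr.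
  have hs : size nu = n.+1 by rewrite -hnu size_ins (wseq_size hmu).
  have hl : (1 <= l < n.+1)%N by rewrite -hs /l /nu size_cat /=; lia.
  rewrite genW_tau // (tauW_sq hl ha hb hmu hu) hnu /nu /l letter_cat letter_catS -/l.
  by rewrite (acts_bieval _ (acts_x hb _) (acts_x hb _)) ?subrr //; lia.
- rewrite !(evB, evM) !evn !(evg (GE _)) !(evg (GT _)) !(evg (GX _)) -!mulrA !eW_gen.
  suff: genW (GT l) (genW (GX m) (genW (GE nu) (dlt a u))) b
    - genW (GX (swap_at l m)) (genW (GT l) (genW (GE nu) (dlt a u))) b
    - ((m == l.+1)%:R - (m == l)%:R : SW) (((j == k)%:R : SW) (genW (GE nu) (dlt a u))) b = 0.
    by rewrite -mulrBl -[_ * eW * _]mulrA [eW * (_ * _)]mulrA (commr_nat eW)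
      -[_ * eW * _]mulrA eW_gen.
  rewrite (e_dlt _ ha hu); case: eqP => hnu; last by rewrite !efun0 !subrr.
  have hs : size nu = n.+1 by rewrite -hnu size_ins (wseq_size hmu).
  have hl : (1 <= l < n.+1)%N by rewrite -hs /l /nu size_cat /=; lia.
  have hA : acts_at b (((m == l.+1)%:R - (m == l)%:R) * (j == k)%:R)
     (((m == l.+1)%:R - (m == l)%:R) * (j == k)%:R).
    by apply: actsM; [apply: actsB |]; apply: acts_nat.
  rewrite -[(_ - _ : SW) _]endoM_app hA.
  have [hm|hm] := boolP (1 <= m <= n.+1)%N.
    rewrite genW_tau // genW_x // genW_x; last first.
      by rewrite /swap_at; case: ifP => _; [lia | case: ifP => _; lia].
    rewrite [diagW (xop (swap_at _ _)) _ _]diagW_app // (tauW_x_comm hl ha hb hmu hu hm).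
    by rewrite hnu /nu /l letter_cat letter_catS subrr.
  have -> : swap_at l m = m by rewrite /swap_at; eqF.
  rewrite (genW_x_out hm) efun0 endo0_app; eqF.
  by rewrite [_%:R - _]subrr mul0r subrr subr0.
- have bE : ev ((j == k')%:R * bidiff (@fconst K _) (qpol D j k)
        (fgen K (GX l)) (fgen K (GX l.+2)) (fgen K (GX l.+1)))
      = (j == k')%:R * bidiff cW (qpol D j k) (genW (GX l))
          (genW (GX l.+2)) (genW (GX l.+1)) * eW.
    rewrite evM evn -[LHS]mulrA (corner_evl cWC eW_eW eW_gen) -[RHS]mulrA.
    by rewrite (corner_ev_bidiff cWC eW_eW eW_gen gen_eW _
      (a1' := genW (GX l)) (a2' := genW (GX l.+2))
      (b' := genW (GX l.+1))) ?ev_gen_x ?exl.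
  rewrite evB [Y in _ - Y]evM bE !(evB, evM) !(evg (GE _)) !(evg (GT _)) -[_ * eW * _]mulrA eW_gen.
  set B := bidiff _ _ _ _ _.
  suff: genW (GT l.+1) (genW (GT l) (genW (GT l.+1) (genW (GE nu) (dlt a u)))) b
    - genW (GT l) (genW (GT l.+1) (genW (GT l) (genW (GE nu) (dlt a u)))) b
    - ((j == k')%:R * B) (genW (GE nu) (dlt a u)) b = 0 by [].
  rewrite (e_dlt _ ha hu); case: eqP => hnu; last by rewrite !efun0 !subrr.
  have hs : size nu = n.+1 by rewrite -hnu size_ins (wseq_size hmu).
  have hl : (1 <= l)%N /\ (l.+1 < n.+1)%N by rewrite -hs /l /nu size_cat /=; lia.
  rewrite !genW_tau //; try lia.
  rewrite (tauW_braid hl.1 hl.2 ha hb hmu hu) hnu /nu /l letter_cat letter_catS letter_catSS -/l.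
  have hB := acts_bidiff (qpol D j k) (acts_x (k := l) hb _) (acts_x (k := l.+2) hb _) (acts_x (k := l.+1) hb _).
  by rewrite (actsM (acts_nat b _) (hB _ _ _)) ?subrr //; lia.
Qed.

Definition rho (a : qha D beta) : SW := ev (ring_repr a).

Lemma rho_qpr a : rho (qpr D beta a) = ev a.
Proof. exact: (corner_ev_repr cWC eW_eW eW_gen gen_eW relW). Qed.
Lemma rhoD : {morph rho : a b / a + b}.
Proof.
elim/ring_projW=> a; elim/ring_projW=> b.
rewrite -[ring_proj _ a]/(qpr D beta a) -[ring_proj _ b]/(qpr D beta b).
by rewrite -rmorphD !rho_qpr evD.
Qed.
Lemma rhoM : {morph rho : a b / a * b}.
Proof.
elim/ring_projW=> a; elim/ring_projW=> b.
rewrite -[ring_proj _ a]/(qpr D beta a) -[ring_proj _ b]/(qpr D beta b).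
by rewrite -rmorphM !rho_qpr evM.
Qed.
Lemma rho1 : rho 1 = eW.
Proof.
by rewrite -(rmorph1 (qpr D beta)) rho_qpr (corner_ev1 cWC eW_eW eW_gen gen_eW).
Qed.
Lemma rho0 : rho 0 = 0.
Proof. by apply: (addIr (rho 0)); rewrite -rhoD !add0r. Qed.
Lemma rho_const d : rho (qconst d) = cW d * eW.
Proof. by rewrite rho_qpr (corner_ev_const cWC eW_eW eW_gen gen_eW). Qed.
Lemma rho_e nu : rho (qe nu) = genW (GE nu).
Proof. by rewrite rho_qpr evg. Qed.
Lemma rho_x k : rho (qx k) = genW (GX k).
Proof. by rewrite rho_qpr evg. Qed.
Lemma rho_tau l : rho (qtau l) = genW (GT l).
Proof. by rewrite rho_qpr evg. Qed.
Lemma rho_sum T (s : seq T) (P : pred T) F :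
  rho (\sum_(j <- s | P j) F j) = \sum_(j <- s | P j) rho (F j).
Proof. exact: (big_morph _ rhoD rho0). Qed.

Lemma rho_qeP P w b : inr b ->
  rho (qeP P) w b = phi (qeP (fun mu => P (ins i b mu))) (w b).
Proof.
move=> hb; rewrite rho_sum.
have -> : (\sum_(nu <- wseqs beta | P nu) rho (qe nu)) w b =
    (\sum_(nu <- wseqs beta | P nu) eop nu b) (w b).
  rewrite !endo_sum_app; under eq_bigr => nu _ do rewrite rho_e.
  elim/big_rec2: _ => // nu x y _ <-; congr (_ + _); exact: acts_e.
congr (efun _ _); rewrite -rmorph_sum; congr (phi _).
apply: qe_ext => mu hmu; rewrite qeP_e mulr_suml.
under eq_bigr => nu _ do rewrite qeP_e.
case: ifP => hP; last first.
  by rewrite big1 // => nu hnu; case: eqP => // h; rewrite h hnu in hP.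
rewrite big_mkcond (bigD1_seq (ins i b mu)) ?mem_wseqs ?seq_mset_insE ?permutations_uniq //=.
rewrite hP eqxx big1 ?addr0 // => nu; rewrite eq_sym => /negbTE ->.
by case: ifP.
Qed.

Lemma rho_qeP_dlt P a u : inr a ->
  rho (qeP P) (dlt a u) = dlt a (phi (qeP (fun mu => P (ins i a mu))) u).
Proof.
move=> ha; apply/funext => b; have [hb|hb] := boolP (inr b).
  rewrite rho_qeP // /dlt; case: eqP => [->|_]; by rewrite ?efun0.
rewrite /dlt; case: eqP => [eb|_]; first by rewrite eb ha in hb.
rewrite -[qeP P]mul1r rhoM rho1 endoM_app /= /diagW_fun.
by rewrite (negbTE hb).
Qed.

Lemma rho_x_dlt k a u : inr a -> (1 <= k <= n.+1)%N ->
  rho (qx k) (dlt a u) = dlt a (xop k a u).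
Proof.
move=> ha hk; rewrite rho_x genW_x //; apply/funext => b; rewrite /= /diagW_fun /dlt.
case: (eqVneq b a) => [->|_]; first by rewrite ha.
by case: ifP; rewrite ?efun0.
Qed.

Lemma rho_tau_dlt l a u : (l.+1 < a <= n.+1)%N -> (1 <= l)%N ->
  rho (qtau l) (dlt a u) = dlt a (T l u).
Proof.
move=> ha hl; rewrite rho_tau genW_tau; last by lia.
apply/funext => b; have [hb|hb] := boolP (inr b); last first.
  rewrite /= /tauW_fun hb /dlt; case: eqP => // eb; subst b; lia.
have [h1|h1] := ltnP b l; first by tau_rows; rewrite !dlt_neq ?efun0 //; apply/eqP; lia.
have [h2|h2] := eqVneq b l.
  by subst b; tau_rows; rewrite !dlt_neq ?efun0 ?subr0 //; apply/eqP; lia.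
have [h3|h3] := eqVneq b l.+1.
  by subst b; tau_rows; rewrite !dlt_neq ?efun0 ?addr0 //; apply/eqP; lia.
tau_rows; have [h4|h4] := eqVneq b a; first by subst b; rewrite !dlt_eq.
by rewrite !dlt_neq // efun0.
Qed.

Definition Tprod a b : S := \prod_(a <= l < b) T l.

Lemma Tprod_nil a b : (b <= a)%N -> Tprod a b = 1.
Proof. by move=> h; rewrite /Tprod big_geq. Qed.
Lemma TprodSr a b : (a <= b)%N -> Tprod a b.+1 = Tprod a b * T b.
Proof. by move=> h; rewrite /Tprod big_nat_recr. Qed.
Lemma TprodSl a b : (a < b)%N -> Tprod a b = T a * Tprod a.+1 b.
Proof. by move=> h; rewrite /Tprod big_ltn. Qed.
Lemma comm_Tprod (x : S) a b : (forall l, (a <= l < b)%N -> GRing.comm x (T l)) ->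
  GRing.comm x (Tprod a b).
Proof.
move=> h; rewrite /Tprod big_nat; apply: big_ind => [||l /h //]; [exact: commr1 | exact: commrM].
Qed.

(** Moving g_m to the left through the product by [T_gIS] leaves one correction at each step. These
    corrections are the ones that must cancel in [dual_bases] when a < c. *)
Lemma telescope_gI a m : (1 <= a)%N -> (a <= m <= n)%N ->
  Tprod a m * g m - g a * Tprod a m =
  \sum_(a.+1 <= d < m.+1) g d * Tprod d m * Tprod a d.-1 * g d.-1.
Proof.
move=> a1 /andP[]; elim: m => [|m IHm] am mn; first by lia.
have [{}am|am'] := leqP a m; last first.
  have -> : a = m.+1 by lia.
  by rewrite Tprod_nil // mul1r mulr1 subrr big_geq.
rewrite big_nat_recr //= TprodSr // -(mulrA _ (T m)) (T_gIS i t_phi tG Gt) //; last by lia.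
rewrite mulrDr !mulrA addrAC -mulrBl IHm //; last by lia.
congr (_ + _).
  rewrite mulr_suml; apply: eq_big_nat => d hd; rewrite TprodSr; last by lia.
  have h1 : GRing.comm (T m) (Tprod a d.-1).
    by apply: comm_Tprod => l hl; apply: comm_phi; apply: qtt; lia.
  have h2 : GRing.comm (T m) (g d.-1) by apply: T_gI_far => //; try apply/eqP; lia.
  rewrite -!mulrA; do 2 congr (_ * _).
  by rewrite -h2 !mulrA h1.
rewrite (@Tprod_nil m.+1) // mulr1 -!mulrA.
rewrite (comm_gIgI i t_phi tG Gt m m.+1) !mulrA; congr (_ * _).
symmetry; apply: comm_Tprod => l hl.
by apply/commr_sym/T_gI_far => //; try apply/eqP; lia.
Qed.

Definition bW a m : W := rho (\prod_(a <= l < n.+1) qtau l) (dlt n.+1 m).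

Lemma bW_last m : bW n.+1 m = dlt n.+1 m.
Proof.
rewrite /bW big_geq // rho1; apply/funext => b; rewrite /= /diagW_fun /dlt.
by case: eqP => [->|_]; case: ifP => //; lia.
Qed.
Lemma bW_step a m : (1 <= a < n.+1)%N -> bW a m = tauW a (bW a.+1 m).
Proof.
move=> ha; rewrite /bW big_ltn; last by lia.
by rewrite rhoM rho_tau genW_tau // endoM_app.
Qed.

(** By descending induction on a: tau_a copies the entry a + 1, which is m, to position a, leaves
    g_a m behind, and multiplies the later entries by T_a. The entry a is still zero before this, so
    q is never met. *)
Lemma bW_coord a m b : (1 <= a <= n.+1)%N -> inr b ->
  bW a m b = if (b < a)%N then 0 else
             if b == a then m else Tprod a b.-1 (g b.-1 m).
Proof.
move=> /andP[a1 an]; have [k ak] : exists k, (a + k = n.+1)%N by exists (n.+1 - a)%N; lia.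
elim: k a a1 an ak b => [|k IHk] a a1 an ak b hb.
  have -> : a = n.+1 by lia.
  rewrite bW_last /dlt; case: ltngtP => //; lia.
rewrite bW_step; last by lia.
have IH b' := IHk a.+1 isT _ _ b'.
have [h1|h1] := ltnP b a.
  by tau_rows; rewrite IH //; try lia; rewrite (_ : (b < a.+1)%N) ?efun0 //; lia.
have [h2|h2] := eqVneq b a.
  by subst b; tau_rows; rewrite !IH; try lia; rewrite ltnn eqxx ltnSn efun0 subr0.
have [h3|h3] := eqVneq b a.+1.
  subst b; tau_rows; rewrite !IH; try lia; rewrite ltnn eqxx ltnSn efun0 add0r.
  by rewrite /= Tprod_nil.
tau_rows; rewrite IH //; try lia.
have -> : (b < a.+1)%N = false by lia.
rewrite (negbTE h3) [in RHS]TprodSl //; lia.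
Qed.

(** Peeling off the rightmost tau uses only its rows up to its own index; these contain no q, which
    is why the formula involves g and T alone. *)
Lemma first_coord c w : inr c ->
  rho (\prod_(1 <= l < c) qtau l) w 1%N =
  w c - \sum_(1 <= d < c) g d (Tprod d c.-1 (w d)).
Proof.
case: c => // c; elim: c w => [|c IHc] w hc.
  by rewrite !big_geq // rho1 subr0 diagW_app.
rewrite big_nat_recr //= rhoM endoM_app rho_tau genW_tau; last by lia.
rewrite IHc; last by lia.
rewrite tauW_eq; last by lia.
rewrite [in RHS]big_nat_recr //= Tprod_nil // -addrA -opprD; congr (_ - _).
rewrite addrC; congr (_ + _); apply: eq_big_nat => d hd.
rewrite -[tauW_fun _ _ _]/(tauW c.+1 w d) tauW_lt; try lia.
by rewrite TprodSr ?endoM_app //; lia.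
Qed.

(** For c < a all entries that are read vanish, for c = a only the entry m is left, and for c > a
    the contributions cancel by [telescope_gI] taken at c - 1. *)
Lemma dual_bases a c m : inr a -> inr c ->
  rho (\prod_(1 <= l < c) qtau l) (bW a m) 1%N = if a == c then m else 0.
Proof.
move=> ha hc; rewrite first_coord // bW_coord //.
have e1 : \sum_(1 <= d < c) g d (Tprod d c.-1 (bW a m d)) =
   \sum_(a <= d < c) g d (Tprod d c.-1 (if d == a then m else Tprod a d.-1 (g d.-1 m))).
  have [ac|ac] := leqP a c; last first.
    rewrite [RHS]big_geq; last by lia.
    rewrite big_nat big1 // => d hd; rewrite bW_coord //; try lia.
    by rewrite (_ : (d < a)%N = true) ?efun0 //; lia.
  rewrite (@big_cat_nat _ _ _ a) //=; last by lia.
  rewrite big_nat big1 ?add0r => [|d hd]; last first.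
    rewrite bW_coord //; try lia.
    by rewrite (_ : (d < a)%N = true) ?efun0 //; lia.
  apply: eq_big_nat => d hd; rewrite bW_coord //; try lia.
  by rewrite (_ : (d < a)%N = false) //; lia.
rewrite {}e1; case: (ltngtP c a) => ac.
- by rewrite big_geq ?subr0 //; lia.
- rewrite big_ltn // eqxx.
  have h := @telescope_gI a c.-1; rewrite prednK in h; last by lia.
  have e2 : \sum_(a.+1 <= d < c) g d (Tprod d c.-1 (if d == a then m else Tprod a d.-1 (g d.-1 m)))
    = (\sum_(a.+1 <= d < c) g d * Tprod d c.-1 * Tprod a d.-1 * g d.-1) m.
    rewrite endo_sum_app; apply: eq_big_nat => d hd.
    by rewrite (_ : d == a = false) //; apply/eqP; lia.
  rewrite e2 -h; try lia.
  by rewrite endoD_app endoN_app !endoM_app (addrC (g a _)) subrK subrr.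
- by rewrite ac big_geq ?subr0.
Qed.

Lemma rho_x1_coord w : rho (qx 1) w 1%N = t (w 1%N).
Proof. by rewrite rho_x genW_x // diagW_app. Qed.

Lemma rho_const_coord d w b : inr b -> rho (qconst d) w b = c d *: w b.
Proof.
move=> hb; rewrite rho_const; suff: c d *: eW w b = c d *: w b by [].
by rewrite diagW_app.
Qed.

Lemma rho_out a w b : ~~ inr b -> rho a w b = 0.
Proof.
move=> hb; rewrite -[a]mul1r rhoM rho1 endoM_app /= /diagW_fun.
by rewrite (negbTE hb).
Qed.

Lemma rho_const_dlt d a u : inr a -> rho (qconst d) (dlt a u) = dlt a (c d *: u).
Proof.
move=> ha; apply/funext => b; have [hb|hb] := boolP (inr b).
  by rewrite rho_const_coord // /dlt; case: ifP; rewrite ?scaler0.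
by rewrite rho_out // dlt_neq //; apply: contra hb => /eqP ->.
Qed.

Lemma rho_e_coord nu w b : inr b ->
  rho (qe nu) w b = phi (qeP (fun mu => ins i b mu == nu)) (w b).
Proof. by move=> hb; rewrite rho_e acts_e. Qed.

Lemma rho_e_dlt nu a u : inr a ->
  rho (qe nu) (dlt a u) = dlt a (phi (qeP (fun mu => ins i a mu == nu)) u).
Proof.
move=> ha; apply/funext => b; have [hb|hb] := boolP (inr b).
  by rewrite rho_e_coord // /dlt; case: eqP => [->|_]; rewrite ?efun0.
by rewrite rho_out // dlt_neq //; apply: contra hb => /eqP ->.
Qed.

Lemma rho_x_coord k w b : inr b -> (1 <= k <= n.+1)%N ->
  rho (qx k) w b = xop k b (w b).
Proof. by move=> hb hk; rewrite rho_x acts_x. Qed.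

Lemma rho_tau_lt l w b : inr b -> (b < l < n.+1)%N -> rho (qtau l) w b = T l.-1 (w b).
Proof. by move=> hb hl; rewrite rho_tau genW_tau ?tauW_lt //; lia. Qed.
End SpecialStrandModule.

(** * Spanning sets *)

(* An abstract form of the argument, used once for left multiplication on
   N o <i> and once for right multiplication on e(i, * )R(beta). *)
Section ShuffleSpan.
Variables (V : zmodType) (J : Type) (n : nat).
Variables (X T : nat -> V -> V) (E : J -> V -> V).
Hypothesis XB : forall k, zmod_morphism (X k).
Hypothesis TB : forall l, zmod_morphism (T l).
Hypothesis EB : forall j, zmod_morphism (E j).

(** Plays the part of a module over the polynomial subalgebra. The relations of the tau_l enter
    [T_near] only through errors lying in every such subgroup that contains v. *)
Definition xe_stable (U : V -> Prop) :=
  [/\ U 0, forall v w, U v -> U w -> U (v - w), forall k v, U v -> U (X k v)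
    & forall j v, U v -> U (E j v)].

Hypothesis T_far : forall k l v, (k.+1 < l)%N -> T k (T l v) = T l (T k v).
Hypothesis TX_far : forall k l v, k != l -> k != l.+1 -> X k (T l v) = T l (X k v).
Hypothesis ET : forall j l, exists j', forall v, E j (T l v) = T l (E j' v).
Hypothesis T_near : forall U, xe_stable U -> forall l v, U v ->
  [/\ U (X l (T l v) - T l (X l.+1 v)), U (X l.+1 (T l v) - T l (X l v)),
      U (T l (T l v)) & U (T l.+1 (T l (T l.+1 v)) - T l (T l.+1 (T l v)))].
Hypothesis T_out : forall l v, ~~ (1 <= l < n)%N -> T l v = 0.

Variable G : V -> Prop.
Hypothesis G_stable : xe_stable G.
Hypothesis GT : forall l v, (l.+1 < n)%N -> G v -> G (T l v).

Definition shuffle_word a v := foldr T v (iota a (n - a)).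

Lemma shuffle_word_last v : shuffle_word n v = v.
Proof. by rewrite /shuffle_word subnn. Qed.
Lemma shuffle_wordS a v : (a < n)%N -> shuffle_word a v = T a (shuffle_word a.+1 v).
Proof.
by move=> h; rewrite /shuffle_word (_ : (n - a)%N = (n - a.+1).+1) //; lia.
Qed.

(** The parameter c filters the span by the leftmost tau allowed, to make descending induction
    possible. *)
Inductive shuffle_span (c : nat) : V -> Prop :=
| sspan_gen a v : (c <= a <= n)%N -> G v -> shuffle_span c (shuffle_word a v)
| sspan_0 : shuffle_span c 0
| sspan_sub v w : shuffle_span c v -> shuffle_span c w -> shuffle_span c (v - w).

Lemma sspan_add c v w : shuffle_span c v -> shuffle_span c w -> shuffle_span c (v + w).
Proof.
move=> hv hw; rewrite -[w]opprK -[- w]sub0r; apply: sspan_sub => //.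
by apply: sspan_sub => //; apply: sspan_0.
Qed.

Lemma sspan_map (f : V -> V) c (U : V -> Prop) : zmod_morphism f ->
    U 0 -> (forall v w, U v -> U w -> U (v - w)) ->
    (forall a v, (c <= a <= n)%N -> G v -> U (f (shuffle_word a v))) ->
  forall v, shuffle_span c v -> U (f v).
Proof.
move=> fB U0 UB Uf v; elim=> [a w ha hw||w w' _ hw _ hw'].
- exact: Uf.
- by rewrite -(subrr 0) fB subrr.
- by rewrite fB; apply: UB.
Qed.

Lemma sspan_mono c d v : (d <= c)%N -> shuffle_span c v -> shuffle_span d v.
Proof.
move=> dc; elim=> [a w ha hw||w w' _ hw _ hw'].
- by apply: sspan_gen => //; lia.
- exact: sspan_0.
- exact: sspan_sub.
Qed.

Lemma T_shuffle_word l a v : (l.+1 < a <= n)%N ->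
  T l (shuffle_word a v) = shuffle_word a (T l v).
Proof.
move=> h; rewrite /shuffle_word; move: (n - a)%N => m.
elim: m a h => //= m IHm a h.
rewrite T_far; last by lia.
have [an|an] := ltnP a n; first by rewrite IHm //; lia.
by rewrite !(@T_out a) //; lia.
Qed.

Lemma T_span_pred c v : (1 <= c < n)%N -> shuffle_span c.+1 v -> shuffle_span c (T c v).
Proof.
move=> hc; apply: (@sspan_map (T c) c.+1 (shuffle_span c)); [exact: TB | exact: sspan_0 | exact: sspan_sub |].
move=> a w ha hw; have [->|ac] := eqVneq a c.+1.
  by rewrite -shuffle_wordS; [apply: sspan_gen => //; lia | lia].
rewrite T_shuffle_word; last by lia.
by apply: sspan_gen; [lia | apply: GT => //; lia].
Qed.

(** Going down from n, the level c consists of level c + 1 and words T_c w with w in it. Relations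
    move an operator past T_c up to errors in level c + 1, which is stable by induction. *)
Lemma shuffle_span_stable c : (1 <= c <= n)%N ->
  xe_stable (shuffle_span c) /\
  (forall l v, (c <= l)%N -> shuffle_span c v -> shuffle_span c (T l v)).
Proof.
move=> /andP[c1 cn]; have [k ck] : exists k, (c + k = n)%N by exists (n - c)%N; lia.
have [G0 GB GX GE] := G_stable.
elim: k c c1 cn ck => [|k IHk] c c1 cn ck.
  have {ck} -> : c = n by lia.
  have sn a : (n <= a <= n)%N -> a = n by lia.
  split; [split|]; first exact: sspan_0.
  - exact: sspan_sub.
  - move=> k; apply: (@sspan_map (X k) n (shuffle_span n)); [exact: XB | exact: sspan_0 | exact: sspan_sub |].
    move=> a w /sn -> hw; rewrite shuffle_word_last -(shuffle_word_last (X k w)).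
    by apply: sspan_gen; [rewrite leqnn | apply: GX].
  - move=> j; apply: (@sspan_map (E j) n (shuffle_span n)); [exact: EB | exact: sspan_0 | exact: sspan_sub |].
    move=> a w /sn -> hw; rewrite shuffle_word_last -(shuffle_word_last (E j w)).
    by apply: sspan_gen; [rewrite leqnn | apply: GE].
  - by move=> l v hl _; rewrite T_out; [exact: sspan_0 | lia].
have cn' : (c < n)%N by lia.
have [st ht] : xe_stable (shuffle_span c.+1) /\
    (forall l v, (c.+1 <= l)%N -> shuffle_span c.+1 v -> shuffle_span c.+1 (T l v)).
  by apply: IHk => //; lia.
have [_ _ stX stE] := st.
have up v : shuffle_span c.+1 v -> shuffle_span c v by apply: sspan_mono; lia.
have cc : (1 <= c < n)%N by lia.
have gen v : G v -> shuffle_span c.+1 (shuffle_word c.+1 v).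
  by move=> hv; apply: sspan_gen => //; lia.
split; [split|]; first exact: sspan_0.
- exact: sspan_sub.
- move=> m; apply: (@sspan_map (X m) c (shuffle_span c)); [exact: XB | exact: sspan_0 | exact: sspan_sub |].
  move=> a w ha hw; have [ac|ac] := eqVneq a c; last first.
    by apply/up/stX/sspan_gen => //; lia.
  rewrite {}ac shuffle_wordS //; have hg := gen w hw.
  have [n1 n2 _ _] := T_near st c hg.
  have [-> |mc] := eqVneq m c.
    rewrite -[X c _](subrK (T c (X c.+1 (shuffle_word c.+1 w)))).
    by apply: sspan_add; [exact: up | apply/T_span_pred/stX].
  have [-> |mc'] := eqVneq m c.+1.
    rewrite -[X c.+1 _](subrK (T c (X c (shuffle_word c.+1 w)))).
    by apply: sspan_add; [exact: up | apply/T_span_pred/stX].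
  by rewrite TX_far //; apply/T_span_pred/stX.
- move=> j; apply: (@sspan_map (E j) c (shuffle_span c)); [exact: EB | exact: sspan_0 | exact: sspan_sub |].
  move=> a w ha hw; have [ac|ac] := eqVneq a c; last first.
    by apply/up/stE/sspan_gen => //; lia.
  rewrite {}ac shuffle_wordS //; have hg := gen w hw.
  by have [j' ->] := ET j c; apply/T_span_pred/stE.
- move=> l v hl; move: v; apply: (@sspan_map (T l) c (shuffle_span c)); [exact: TB | exact: sspan_0 | exact: sspan_sub |].
  move=> a w ha hw; have [ac|ac] := eqVneq a c; last first.
    have hs : shuffle_span c.+1 (shuffle_word a w) by apply: sspan_gen => //; lia.
    have [->|lc] := eqVneq l c; first exact: T_span_pred.
    by apply/up/ht => //; lia.
  rewrite {}ac shuffle_wordS //; have hg := gen w hw.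
  have [->|lc] := eqVneq l c.
    by have [_ _ h _] := T_near st c hg; apply: up.
  have [->|lc'] := eqVneq l c.+1; last first.
    by rewrite -T_far; [apply/T_span_pred/ht => //; lia | lia].
  have [cSn|cSn] := ltnP c.+1 n; last by rewrite T_out; [exact: sspan_0 | lia].
  rewrite shuffle_wordS //.
  have hg' : shuffle_span c.+1 (shuffle_word c.+2 w).
    by apply: sspan_gen => //; lia.
  have [_ _ _ h] := T_near st c hg'.
  (* By the braid relation, T_(c+1) T_c T_(c+1) becomes T_c T_(c+1) T_c; the last T_c then passes
     through the remaining word and is absorbed by [G]. *)
  rewrite -[T c.+1 _](subrK (T c (T c.+1 (T c (shuffle_word c.+2 w))))).
  apply: sspan_add; first exact: up.
  rewrite T_shuffle_word; last by lia.
  by rewrite -!shuffle_wordS //; apply: sspan_gen; [lia | apply: GT].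
Qed.

Lemma shuffle_span_full : (1 <= n)%N ->
  [/\ forall k v, shuffle_span 1 v -> shuffle_span 1 (X k v),
      forall j v, shuffle_span 1 v -> shuffle_span 1 (E j v)
    & forall l v, shuffle_span 1 v -> shuffle_span 1 (T l v)].
Proof.
move=> n1; have [|[_ _ hX hE] hT] := @shuffle_span_stable 1; first by rewrite n1.
split=> // l v; case: l => [|l] hv; last exact: hT.
by rewrite T_out //; exact: sspan_0.
Qed.

End ShuffleSpan.

(** * Shuffle spanning for left modules *)

Section ModuleSpan.
Variables (K : fieldType) (I : choiceType) (C : cartan_datum I).
Variables (D : qh_datum K C) (beta : {mset I}).
Local Notation R := (qha D beta).
Local Notation n := (size beta).
Variable V : lmodType R.

Definition opX (k : nat) (v : V) : V := qx k *: v.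
Definition opT (l : nat) (v : V) : V := qtau l *: v.
(** Idempotents and ground-field scalars share one index because both pass tau_l without error, the
    former after a change of word. *)
Definition opE (j : seq I + K) (v : V) : V :=
  match j with inl nu => (qe nu : R) *: v | inr d => (qconst d : R) *: v end.

Lemma pp_stable (U : V -> Prop) : xe_stable opX opE U ->
  forall a v, polynomial_part a -> U v -> U (a *: v).
Proof.
move=> [U0 UB UX UE] a v ha; elim: ha v => [k|nu|d|x y _ IHx _ IHy|x y _ IHx _ IHy] v hv.
- exact: UX.
- exact: (UE (inl nu)).
- exact: (UE (inr d)).
- by rewrite scalerBl; apply: UB; [apply: IHx | apply: IHy].
- by rewrite -scalerA; apply/IHx/IHy.
Qed.

Lemma pp_opp (a : R) : polynomial_part a -> polynomial_part (- a).
Proof. by move=> h; rewrite -sub0r; apply: pp_sub => //; apply: pp0. Qed.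

Lemma pp_qtau_qxl l : polynomial_part (qtau l * qx l - qx l.+1 * qtau l : R).
Proof. by have := pp_qtau_qx D beta l l; rewrite /swap_at eqxx. Qed.
Lemma pp_qtau_qxSl l : polynomial_part (qtau l * qx l.+1 - qx l * qtau l : R).
Proof.
have := pp_qtau_qx D beta l l.+1; rewrite /swap_at eqxx.
by have -> : (l.+1 == l) = false by apply/eqP; lia.
Qed.

Lemma module_span (G : V -> Prop) : (1 <= n)%N -> xe_stable opX opE G ->
    (forall l v, (l.+1 < n)%N -> G v -> G (opT l v)) ->
  forall (a : R) v, shuffle_span n opT G 1 v -> shuffle_span n opT G 1 (a *: v).
Proof.
move=> n1 Gst GT.
have [|||||||| hX hE hT] := @shuffle_span_full V (seq I + K)%type n opX opT opE _ _ _ _ _ _ _ _ G Gst GT n1.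
- by move=> k u v; rewrite /opX scalerBr.
- by move=> k u v; rewrite /opT scalerBr.
- by case=> j u v; rewrite /= scalerBr.
- by move=> k l v kl; rewrite /opT !scalerA qtt // kl.
- by move=> k l v h1 h2; rewrite /opT /opX !scalerA qtau_qx.
- case=> [nu|d] l.
    by exists (inl (swap_word l nu)) => v; rewrite /opT /= !scalerA qe_qtau.
  by exists (inr d) => v; rewrite /opT /= !scalerA qconstC.
- move=> U hU l v hv; rewrite /opT /opX !scalerA -!scalerBl; have h := pp_stable hU.
  split; apply: h => //.
  + by rewrite -opprB; apply/pp_opp/pp_qtau_qxSl.
  + by rewrite -opprB; apply/pp_opp/pp_qtau_qxl.
  + exact: pp_qtau2.
  + exact: pp_braid.
- by move=> l v hl; rewrite /opT qtau_out ?scale0r.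
move=> a; elim/qha_ind: a => [d|nu|k|l|a b IHa IHb|a b IHa IHb] v hv.
- exact: (hE (inr d)).
- exact: (hE (inl nu)).
- exact: hX.
- exact: hT.
- by rewrite scalerDl; apply: sspan_add; [apply: IHa | apply: IHb].
- by rewrite -scalerA; apply/IHa/IHb.
Qed.

Lemma shuffle_word_prod a v :
  shuffle_word n opT a v = (\prod_(a <= l < n) (qtau l : R)) *: v.
Proof.
rewrite /shuffle_word /index_iota; elim: (iota _ _) => [|l s IHs] /=.
  by rewrite big_nil scale1r.
by rewrite big_cons -scalerA IHs.
Qed.

End ModuleSpan.

(** * Spanning of e(i, * )R(beta) by right multiplications *)

Section RightSpan.
Variables (K : fieldType) (I : choiceType) (C : cartan_datum I).
Variables (D : qh_datum K C) (i : I) (beta : {mset I}).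
Hypothesis hi : i \in beta.
Local Notation R := (qha D beta).
Local Notation n := (size beta).
Local Notation shift := (@shift_map K I C D i beta).
Local Notation ei := (qei D i beta).

Lemma msetD1_mem (mu : seq I) : (seq_mset (i :: mu) == beta) = (seq_mset mu == beta `\ i).
Proof.
apply/eqP/eqP => [<-|h]; first by rewrite mset_cons msetD1K.
by rewrite mset_cons h msetB1K.
Qed.

Lemma size_msetD1 : n = (size (beta `\ i)).+1.
Proof.
have h : seq_mset (i :: (beta `\ i : seq I)) = beta by apply/eqP; rewrite msetD1_mem seq_mset_id.
by rewrite -{1}h (perm_size (perm_eq_seq_mset _)).
Qed.

Local Notation sblock := (@starts_with_block I i beta).
Local Notation sswap := (@starts_with_swap I i beta).

Lemma shift_map0 : shift 0 = 0.
Proof. by apply: (addIr (shift 0)); rewrite -shift_mapD !add0r. Qed.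
Lemma shift_map_const d : shift (qconst d) = qconst d * ei.
Proof. by apply: block_map_const; [exact: sblock | exact: sswap]. Qed.
Lemma shift_map_e nu : shift (qe nu) = qe (i :: nu).
Proof.
rewrite /shift_map block_map_e; [|exact: sblock|exact: sswap].
apply: qe_ext => mu hmu; rewrite qeP_e qee.
case: mu hmu => [|j mu] hmu.
  by have := wseq_size hmu; rewrite size_msetD1.
rewrite eqseq_cons /starts_with /= /block drop1 /= take_oversize; last first.
  by have := wseq_size hmu; rewrite size_msetD1 /= => -[->].
rewrite (eq_sym i) (eq_sym nu) -[Some j == Some i]/(j == i).
by case: (j =P i) => [->|] //=; case: (mu =P nu) => [->|].
Qed.
Lemma shift_map_x k : (1 <= k < n)%N -> shift (qx k) = qx k.+1 * ei.
Proof. by move=> hk; apply: block_map_x; [exact: sblock|exact: sswap|rewrite size_msetD1 in hk]. Qed.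
Lemma shift_map_tau l : (1 <= l)%N -> (l.+1 < n)%N -> shift (qtau l) = qtau l.+1 * ei.
Proof.
move=> h1 h2; apply: block_map_tau; [exact: sblock|exact: sswap|].
by rewrite size_msetD1 in h2; lia.
Qed.

(** The image of R(alpha_i) and R(beta - alpha_i) in the corner of e(i, * ): x_1 acts on the first
    strand and commutes with the shifted algebra on the others. *)
Inductive shift_span : R -> Prop :=
| shsp_gen k a : shift_span (qx 1 ^+ k * shift a)
| shsp_sub a b : shift_span a -> shift_span b -> shift_span (a - b).

Lemma shsp_0 : shift_span 0.
Proof. by rewrite -(subrr (qx 1 ^+ 0 * shift 1)); apply: shsp_sub; apply: shsp_gen. Qed.

Lemma shsp_map (f : R -> R) : zmod_morphism f ->
    (forall k a, shift_span (f (qx 1 ^+ k * shift a))) ->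
  forall v, shift_span v -> shift_span (f v).
Proof.
by move=> fB h v; elim=> [k a|a b _ ha _ hb]; [exact: h | rewrite fB; apply: shsp_sub].
Qed.

(* Right multiplications, with the strands numbered from right to left. *)
Definition ropX (k : nat) (v : R) : R := v * qx (n.+1 - k).
Definition ropT (l : nat) (v : R) : R := v * qtau (n - l).
Definition ropE (j : seq I + K) (v : R) : R :=
  match j with inl nu => v * qe nu | inr d => v * qconst d end.

Lemma pp_rstable (U : R -> Prop) : xe_stable ropX ropE U ->
  forall a v, polynomial_part a -> U v -> U (v * a).
Proof.
move=> [U0 UB UX UE] a v ha; elim: ha v => [k|nu|d|x y _ IHx _ IHy|x y _ IHx _ IHy] v hv.
(* The reversal k -> n + 1 - k is an involution only up to n + 1, by truncated subtraction; beyond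
   that x_k is zero. *)
- have [hk|hk] := leqP k n.+1; last by rewrite qx_out ?mulr0 //; lia.
  by have := UX (n.+1 - k)%N _ hv; rewrite /ropX subKn.
- exact: (UE (inl nu)).
- exact: (UE (inr d)).
- by rewrite mulrBr; apply: UB; [apply: IHx | apply: IHy].
- by rewrite mulrA; apply/IHy/IHx.
Qed.

Lemma ei_qe nu : ei * qe nu = if starts_with i nu then qe nu else 0.
Proof. exact: qeP_e. Qed.

Lemma shsp_stable : xe_stable ropX ropE shift_span.
Proof.
split; [exact: shsp_0 | exact: shsp_sub | move=> k | case=> [nu|d]].
- apply: shsp_map => [u v|m a]; rewrite /ropX ?mulrBl //.
  move: (n.+1 - k)%N => {}k; have [hk|hk] := boolP (1 <= k <= n)%N; last first.
    by rewrite (@qx_out _ _ _ _ _ k) // !mulr0; exact: shsp_0.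
  (* The first strand raises the power of x_1; any other strand is absorbed in the shifted
     factor. *)
  rewrite -mulrA; have [->|k1] := eqVneq k 1%N.
    by rewrite shift_map_x1 mulrA -exprSr; exact: shsp_gen.
  have -> : shift a * qx k = shift (a * qx k.-1).
    rewrite shift_mapM shift_map_x ?prednK; try lia.
    by rewrite -qePx mulrA shift_mapr.
  exact: shsp_gen.
- apply: shsp_map => [u v|m a]; rewrite /= ?mulrBl //.
  rewrite -mulrA -shift_mapr -[_ * ei * _]mulrA ei_qe.
  case: ifP; last by rewrite !mulr0 => _; exact: shsp_0.
  case: nu => // j nu /eqP[->].
  by rewrite -shift_map_e -shift_mapM; exact: shsp_gen.
- apply: shsp_map => [u v|m a]; rewrite /= ?mulrBl //.
  rewrite -mulrA -shift_mapr -[_ * ei * _]mulrA -qconstC -shift_map_const -shift_mapM.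
  exact: shsp_gen.
Qed.

Lemma shsp_T l v : (l.+1 < n)%N -> shift_span v -> shift_span (ropT l v).
Proof.
move=> hl; move: v; apply: shsp_map => [u v|m a]; rewrite /ropT ?mulrBl //.
have hk : (2 <= n - l)%N by lia.
move: (n - l)%N hk => k hk; have [kn|kn] := ltnP k n; last first.
  by rewrite qtau_out ?mulr0; [exact: shsp_0 | lia].
rewrite -mulrA; have -> : shift a * qtau k = shift (a * qtau k.-1).
  rewrite shift_mapM shift_map_tau ?prednK; try lia.
  have -> : qtau k * ei = ei * qtau k.
    by symmetry; apply: qtau_qeP => -[|? s] x y t //=; lia.
  by rewrite mulrA shift_mapr.
exact: shsp_gen.
Qed.

(** Reversing products and strand numbers preserves the shape of the relations up to signs and
    polynomial errors, so right multiplications fit the abstract argument. *)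
Lemma right_span (a v : R) : shuffle_span n ropT shift_span 1 v ->
  shuffle_span n ropT shift_span 1 (v * a).
Proof.
have n1 : (1 <= n)%N by rewrite size_msetD1.
have [|||||||| hX hE hT] := @shuffle_span_full R (seq I + K)%type n ropX ropT ropE _ _ _ _ _ _ _ _ shift_span shsp_stable shsp_T n1.
- by move=> k u w; rewrite /ropX mulrBl.
- by move=> k u w; rewrite /ropT mulrBl.
- by case=> j u w; rewrite /= mulrBl.
- move=> k l w kl; rewrite /ropT -!mulrA; congr (_ * _).
  have [hl|hl] := ltnP l n; last by rewrite (@qtau_out _ _ _ _ _ (n - l)) ?mulr0 ?mul0r //; lia.
  by apply: qtt; lia.
- move=> k l w h1 h2; rewrite /ropT /ropX -!mulrA; congr (_ * _).
  have [hl|hl] := ltnP l n; last by rewrite (@qtau_out _ _ _ _ _ (n - l)) ?mulr0 ?mul0r //; lia.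
  by rewrite qtau_qx //; apply/eqP; lia.
- case=> [nu|d] l.
    exists (inl (swap_word (n - l) nu)) => w; rewrite /ropT /= -!mulrA.
    by rewrite qtau_qe.
  by exists (inr d) => w; rewrite /ropT /= -!mulrA qconstC.
- move=> U hU l w hw; rewrite /ropT /ropX -!mulrA -!mulrBr; have h := pp_rstable hU.
  have [hl|hl] := ltnP l n; last first.
    have t0 : qtau (n - l) = 0 :> R by apply: qtau_out; lia.
    have [U0 _ _ _] := hU.
    by rewrite t0 !(mulr0, mul0r) subr0 mulr0.
  split; apply: h => //.
  + have -> : (n.+1 - l = (n - l).+1)%N by lia.
    rewrite subSS; exact: pp_qtau_qxSl.
  + rewrite subSS; have -> : (n.+1 - l = (n - l).+1)%N by lia.
    exact: pp_qtau_qxl.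
  + exact: pp_qtau2.
  (* The reversal exchanges the two sides of the braid relation, hence the sign. *)
  + have -> : (n - l = (n - l.+1).+1)%N by lia.
    by rewrite !mulrA -opprB; apply/pp_opp/pp_braid.
- by move=> l w hl; rewrite /ropT qtau_out ?mulr0 //; lia.
move: v; elim/qha_ind: a => [d|nu|k|l|a b IHa IHb|a b IHa IHb] v hv.
- exact: (hE (inr d)).
- exact: (hE (inl nu)).
- have [hk|hk] := leqP k n.+1; last by rewrite qx_out ?mulr0; [exact: sspan_0 | lia].
  by have := hX (n.+1 - k)%N _ hv; rewrite /ropX subKn.
- have [hk|hk] := leqP l n; last by rewrite qtau_out ?mulr0; [exact: sspan_0 | lia].
  by have := hT (n - l)%N _ hv; rewrite /ropT subKn.
- by rewrite mulrDr; apply: sspan_add; [apply: IHa | apply: IHb].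
- by rewrite mulrA; apply/IHb/IHa.
Qed.

Lemma shuffle_word_rprod a v : (a <= n)%N ->
  shuffle_word n ropT a v = v * \prod_(1 <= l < (n - a).+1) qtau l.
Proof.
move=> han; have [k ak] : exists k, (a + k = n)%N by exists (n - a)%N; lia.
elim: k a han ak => [|k IHk] a han ak.
  have -> : a = n by lia.
  by rewrite shuffle_word_last subnn big_geq ?mulr1.
rewrite shuffle_wordS; last by lia.
rewrite IHk; try lia.
have -> : (n - a = (n - a.+1).+1)%N by lia.
by rewrite [in RHS]big_nat_recr //= mulrA /ropT; congr (_ * qtau _); lia.
Qed.

(** Spanning in the form of an induction principle: a property stable under left multiplication by
    x_1 and by shifted elements has to be checked only on tau_1 ... tau_(c-1). *)
Lemma qei_ind (P : R -> Prop) : P 0 -> (forall a b, P a -> P b -> P (a - b)) ->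
    (forall a, P a -> P (qx 1 * a)) -> (forall a b, P b -> P (shift a * b)) ->
    (forall c, (1 <= c <= n)%N -> P (\prod_(1 <= l < c) qtau l)) ->
  forall a, P (ei * a).
Proof.
move=> P0 PB Px Psh Pb a.
have Pgen w c : (1 <= c <= n)%N -> shift_span w -> P (w * \prod_(1 <= l < c) qtau l).
  move=> hc; elim=> [k b|b b' _ hb _ hb']; last by rewrite mulrBl; apply: PB.
  elim: k => [|k IHk]; first by rewrite mul1r; apply/Psh/Pb.
  by rewrite exprS -!mulrA; apply: Px; rewrite mulrA.
have n1 : (1 <= n)%N by rewrite size_msetD1.
have h : shuffle_span n ropT shift_span 1 (ei * a).
  apply: right_span; rewrite -[ei](shuffle_word_last n ropT); apply: sspan_gen.
    by rewrite n1 leqnn.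
  by rewrite -shift_map1 -[shift 1]mul1r -(expr0 (qx 1)); apply: shsp_gen.
elim: h => [b w hb hw||v w _ hv _ hw].
- by rewrite shuffle_word_rprod; [apply: Pgen => //; lia | lia].
- exact: P0.
- exact: PB.
Qed.

End RightSpan.

Lemma seq_mset_seq1 (I : choiceType) (i : I) : seq_mset [:: i] = [mset i].
Proof.
apply/msetP => j; rewrite mset_seqE msetnE /= addn0 eq_sym.
by case: (j == i).
Qed.

(** * The shuffle projection *)

Section ShuffleProjection.
Variables (K : fieldType) (I : choiceType) (C : cartan_datum I).
Variables (D : qh_datum K C) (i : I) (beta : {mset I}).
Hypothesis hi : i \in beta.
Local Notation R := (qha D beta).
Local Notation n := (size beta).
Local Notation gamma := (beta `\ i).
Local Notation A := (qha D gamma).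
Local Notation B := (qha D [mset i]).
Variables (N : lmodType A) (z : {linear N -> N}).
Local Notation Li := (Li D i).
Local Notation iL := (@iotaL K I C D beta gamma [mset i]).
Local Notation iR := (@iotaR K I C D beta gamma [mset i]).
Local Notation split := (splits_as gamma [mset i]).
Local Notation E := (qeP split : R).
Local Notation CV := (conv beta N Li).
Local Notation pure m y := (tpure beta (1 : R) (m : N) (y : Li)).

Lemma splits_asE (mu : seq I) : seq_mset mu = gamma -> split (mu ++ [:: i]).
Proof.
move=> h; have s := wseq_size h; rewrite /splits_as -s take_size_cat // drop_size_cat // h eqxx /=.
by rewrite seq_mset_seq1.
Qed.

Lemma splits_as_inv (nu : seq I) : split nu ->
  exists2 mu, seq_mset mu = gamma & nu = mu ++ [:: i].
Proof.
case/andP=> /eqP h1 /eqP h2; exists (take (size gamma) nu) => //.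
rewrite -{1}(cat_take_drop (size gamma) nu); congr (_ ++ _).
have : perm_eq (drop (size gamma) nu) [:: i].
  by apply/eq_seq_msetP; rewrite h2 seq_mset_seq1.
by move/perm_small_eq => ->.
Qed.

Lemma size_mset1 : size [mset i] = 1%N. Proof. by rewrite -seq_mset_seq1 (perm_size (perm_eq_seq_mset _)). Qed.
Local Notation blL := (@splits_as_blockL I beta gamma [mset i]).
Local Notation swL := (@splits_as_swapL I gamma [mset i]).
Local Notation blR := (@splits_as_blockR I beta gamma [mset i]).
Local Notation swR := (@splits_as_swapR I gamma [mset i]).

Lemma iLD : {morph iL : a b / a + b}. Proof. by apply: block_mapD; [exact: blL | exact: swL]. Qed.
Lemma iLM : {morph iL : a b / a * b}. Proof. by apply: block_mapM; [exact: blL | exact: swL]. Qed.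
Lemma iL1 : iL 1 = E. Proof. by apply: block_map1; [exact: blL | exact: swL]. Qed.
Lemma iRD : {morph iR : a b / a + b}. Proof. by apply: block_mapD; [exact: blR | exact: swR]. Qed.
Lemma iRM : {morph iR : a b / a * b}. Proof. by apply: block_mapM; [exact: blR | exact: swR]. Qed.
Lemma iR1 : iR 1 = E. Proof. by apply: block_map1; [exact: blR | exact: swR]. Qed.
Lemma EiL a : E * iL a = iL a. Proof. exact: (block_mapl beta swL). Qed.
Lemma iLE a : iL a * E = iL a. Proof. exact: block_mapr. Qed.
Lemma EiR a : E * iR a = iR a. Proof. exact: (block_mapl beta swR). Qed.
Lemma iL_const d : iL (qconst d) = qconst d * E. Proof. by apply: block_map_const; [exact: blL | exact: swL]. Qed.
Lemma iR_const d : iR (qconst d) = qconst d * E. Proof. by apply: block_map_const; [exact: blR | exact: swR]. Qed.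
Lemma iL_x k : (1 <= k <= size gamma)%N -> iL (qx k) = qx k * E.
Proof. by apply: block_map_x => //; [exact: blL | exact: swL]. Qed.
Lemma iL_tau l : (1 <= l < size gamma)%N -> iL (qtau l) = qtau l * E.
Proof. by apply: block_map_tau => //; [exact: blL | exact: swL]. Qed.
Lemma iR_x : iR (qx 1) = qx n * E.
Proof. by rewrite /iotaR (block_map_x _ blR swR) ?size_mset1 // addn1 -(size_msetD1 hi). Qed.
Lemma iL_e nu : iL (qe nu) = qe (nu ++ [:: i]).
Proof.
rewrite /iotaL (block_map_e _ blL swL); apply: qe_ext => mu _; rewrite qeP_e qee.
case: ifP.
  case/andP=> /splits_as_inv[mu' h ->] /eqP <-.
  rewrite /block drop0 take_size_cat ?eqxx //; exact: wseq_size.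
move=> /negbT; rewrite negb_and; case: (nu ++ [:: i] =P mu) => // <-.
have [/eqP h|h] := boolP (seq_mset nu == gamma).
  by rewrite splits_asE // /block drop0 take_size_cat ?eqxx // (wseq_size h).
rewrite qe_out //; apply: contra h => /eqP h.
by rewrite -(msetD1_mem hi) -h; apply/eqP/eq_seq_msetP; rewrite perm_sym perm_catC.
Qed.

Lemma qe_Li nu : (qe nu : B) = if nu == [:: i] then 1 else 0.
Proof.
have h mu : seq_mset mu = [mset i] -> mu = [:: i].
  move=> hmu; have : perm_eq mu [:: i].
    by apply/eq_seq_msetP; rewrite hmu seq_mset_seq1.
  by move/perm_small_eq => ->.
apply: qe_ext => mu /h ->; case: eqP => [->|hn]; first by rewrite mul1r qee eqxx.
by rewrite qee mul0r; case: eqP.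
Qed.
Lemma qx_Li k : k != 1%N -> (qx k : B) = 0.
Proof. by move=> h; apply: qx_out; rewrite size_mset1; lia. Qed.
Lemma qtau_Li l : (qtau l : B) = 0.
Proof. by apply: qtau_out; rewrite size_mset1; lia. Qed.

Lemma iL0 : iL 0 = 0.
Proof. by apply: (addIr (iL 0)); rewrite -iLD !add0r. Qed.
Lemma iR0 : iR 0 = 0.
Proof. by apply: (addIr (iR 0)); rewrite -iRD !add0r. Qed.

(** Besides scalars and idempotents, R(alpha_i) has only the generator x_1, which goes to x_n and
    commutes with everything on the first n - 1 strands. *)
Lemma iL_iR a b : iL a * iR b = iR b * iL a.
Proof.
have szE := size_msetD1 hi.
elim/qha_ind: b => [d|nu|k|l|b b' IHb IHb'|b b' IHb IHb'].
- by rewrite iR_const mulrA -qconstC -!mulrA iLE EiL.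
- by rewrite qe_Li; case: ifP; rewrite ?iR1 ?iR0 ?mulr0 ?mul0r // iLE EiL.
- have [->|h] := eqVneq k 1%N; last by rewrite qx_Li // iR0 mulr0 mul0r.
  have xE : qx n * E = E * qx n by rewrite qePx.
  rewrite iR_x -mulrA EiL xE mulrA iLE.
  apply: corner_ev_comm; [exact: qconstC|exact: qeP_idem| | |exact: qePx|].
  + by apply: block_El; exact: swL.
  + exact: block_Er.
  + case=> [mu|m|m] /=; first exact: qePx.
      case: ifP => _; rewrite ?mulr0 ?mul0r //.
      by rewrite -mulrA qePx !mulrA qxx.
    case: ifP => hl; rewrite ?mulr0 ?mul0r //.
    by rewrite -mulrA qePx !mulrA qtau_qx //; apply/eqP; lia.
- by rewrite qtau_Li iR0 mulr0 mul0r.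
- by rewrite iRD mulrDr mulrDl IHb IHb'.
- by rewrite iRM mulrA IHb -mulrA IHb' mulrA.
Qed.

(** Balancing with the two units replaces the factor 1 by [E], so only the product of a with [E]
    matters. *)
Lemma pureZl (a : R) (a' : A) m y : a * E = iL a' -> a *: pure m y = pure (a' *: m) y.
Proof.
move=> h; rewrite tpureZ mulr1 -[in RHS](scale1r y) -tpure_balanced mul1r iR1.
rewrite -h -[m in LHS]scale1r -[y in LHS]scale1r -tpure_balanced iL1 iR1.
by rewrite -?mulrA !qeP_idem.
Qed.
Lemma pureZr (a : R) (b : B) m y : a * E = iR b -> a *: pure m y = pure m (b *: y).
Proof.
move=> h; rewrite tpureZ mulr1 -[in RHS](scale1r m) -tpure_balanced mul1r iL1.
rewrite EiR -h -[m in LHS]scale1r -[y in LHS]scale1r -tpure_balanced iL1 iR1.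
by rewrite -?mulrA !qeP_idem.
Qed.

Definition x1pow k : Li := (qx 1 : B) ^+ k.

Inductive pure_span : CV -> Prop :=
| psp_gen m k : pure_span (pure m (x1pow k))
| psp_sub v w : pure_span v -> pure_span w -> pure_span (v - w).

Lemma psp_0 : pure_span 0.
Proof. by rewrite -(subrr (pure 0 (x1pow 0))); apply: psp_sub; apply: psp_gen. Qed.
Lemma psp_map (a : R) : (forall m k, pure_span (a *: pure m (x1pow k))) ->
  forall v, pure_span v -> pure_span (a *: v).
Proof.
by move=> h v; elim=> [m k|u w _ hu _ hw]; [exact: h | rewrite scalerBr; apply: psp_sub].
Qed.

Lemma tpure0m r y : tpure beta (r : R) (0 : N) (y : Li) = 0.
Proof. by apply: (addIr (tpure beta r 0 y)); rewrite -tpureDm !add0r. Qed.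
Lemma tpurem0 r m : tpure beta (r : R) (m : N) (0 : Li) = 0.
Proof. by apply: (addIr (tpure beta r m 0)); rewrite -tpureDr !add0r. Qed.

Lemma pure_x m k : qx n *: pure m (x1pow k) = pure m (x1pow k.+1).
Proof. by rewrite (@pureZr _ (qx 1)) ?iR_x // /x1pow exprS. Qed.

Lemma psp_stable : xe_stable (@opX _ _ _ D beta CV) (@opE _ _ _ D beta CV) pure_span.
Proof.
split; [exact: psp_0 | exact: psp_sub | move=> k | case=> [nu|d]].
- have [hk|hk] := boolP (1 <= k <= n)%N; last first.
    by move=> v _; rewrite /opX qx_out // scale0r; exact: psp_0.
  apply: psp_map => m j; have [->|kn] := eqVneq k n; first by rewrite pure_x; exact: psp_gen.
  rewrite (@pureZl _ (qx k)); first exact: psp_gen.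
  by rewrite iL_x //; have := size_msetD1 hi; lia.
- apply: psp_map => m j.
  have [/splits_as_inv[mu h ->]|h] := boolP (split nu).
    rewrite (@pureZl _ (qe mu)); first exact: psp_gen.
    by rewrite iL_e e_qeP splits_asE.
  rewrite (@pureZl _ 0) ?scale0r ?tpure0m; first exact: psp_0.
  by rewrite iL0 e_qeP (negbTE h).
- apply: psp_map => m j; rewrite (@pureZl _ (qconst d)); first exact: psp_gen.
  by rewrite iL_const.
Qed.

Lemma psp_T l v : (l.+1 < n)%N -> pure_span v -> pure_span (opT l v).
Proof.
move=> hl; move: v; have [l1|l1] := leqP 1 l; last first.
  by move=> v _; rewrite /opT qtau_out ?scale0r; [exact: psp_0 | lia].
apply: psp_map => m j; rewrite (@pureZl _ (qtau l)); first exact: psp_gen.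
by rewrite iL_tau //; have := size_msetD1 hi; lia.
Qed.

Lemma pure_in_span m y : pure_span (pure m y).
Proof.
(* All m' are taken at once because a scalar occurring in <i>_z is moved across the tensor and
   changes m'. *)
suff h (b : B) (y' : Li) : (forall m', pure_span (pure m' y')) ->
    forall m', pure_span (pure m' (b *: y')).
  rewrite -[y]mulr1; apply: (h (y : B) (1 : B)) => m'.
  exact: (psp_gen m' 0).
elim/qha_ind: b y' => [d|nu|k|l|b b' IHb IHb'|b b' IHb IHb'] y' hy m'.
- rewrite -(@pureZr (qconst d)) ?iR_const // (@pureZl _ (qconst d)) ?iL_const //.
- by rewrite qe_Li; case: ifP; rewrite ?scale1r // scale0r tpurem0 => _; exact: psp_0.
- have [->|hk] := eqVneq k 1%N; last by rewrite qx_Li // scale0r tpurem0; exact: psp_0.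
  have [_ _ hX _] := psp_stable.
  by rewrite -(@pureZr (qx n)) ?iR_x //; apply: (hX n).
- by rewrite qtau_Li scale0r tpurem0; exact: psp_0.
- rewrite scalerDl tpureDr -[pure m' (b' *: y')]opprK -[- pure m' _]sub0r.
  by apply: psp_sub; [exact: IHb | apply: psp_sub; [exact: psp_0 | exact: IHb']].
- by rewrite -scalerA; apply: IHb => m''; apply: IHb'.
Qed.

Lemma conv_shuffle_ind (P : CV -> Prop) : P 0 ->
    (forall v w, P v -> P w -> P (v - w)) ->
    (forall a m k, (1 <= a <= n)%N ->
       P ((\prod_(a <= l < n) (qtau l : R)) *: pure m (x1pow k))) ->
  forall w, P w.
Proof.
move=> P0 PB Pgen w; have n1 : (1 <= n)%N by rewrite (size_msetD1 hi).
have Pspan v : shuffle_span n (@opT _ _ _ D beta CV) pure_span 1 v -> P v.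
  elim=> [a u ha hu||u u' _ hu _ hu']; [| exact: P0 | exact: PB].
  rewrite shuffle_word_prod; elim: hu => [m k|u1 u2 _ h1 _ h2]; first exact: Pgen.
  by rewrite scalerBr; apply: PB.
elim/conv_ind: w => [|v w hv hw|v hv|r m y].
- exact: P0.
- by rewrite -[w]opprK; apply: (PB) => //; rewrite -sub0r; apply: PB.
- by rewrite -sub0r; apply: PB.
- have -> : tpure beta r m y = r *: pure m y by rewrite tpureZ mulr1.
  apply/Pspan/(module_span n1 psp_stable psp_T).
  rewrite -(shuffle_word_last n (@opT _ _ _ D beta CV) (pure m y)).
  by apply: sspan_gen; [rewrite n1 leqnn | exact: pure_in_span].
Qed.

Local Notation V := (laurent N).
Local Notation cA := (@qconstC K I C D gamma).
Local Notation c := (@qconst K I C D gamma).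
Local Notation tV := (laurent_t c N).
Local Notation GV := (fun k => laurent_G cA N (qx k)).
Local Notation W := (nat -> V).

Let t_phi a : tV * endo_scale V cA a = endo_scale V cA a * tV.
Proof. exact: laurent_t_scale. Qed.
Let tG k : (tV - endo_scale V cA (qx k)) * GV k = 1.
Proof. exact: laurent_tG. Qed.
Let Gt k : GV k * (tV - endo_scale V cA (qx k)) = 1.
Proof. exact: laurent_Gt. Qed.
Let hbeta := msetD1_mem hi.
Let size_beta := size_msetD1 hi.
Local Notation gn := (size gamma).

Local Notation rhoV := (@rho K I C D i beta gamma V tV GV).
Local Notation rhoM' := (rhoM hbeta size_beta t_phi tG Gt).
Local Notation rhoD' := (rhoD hbeta size_beta t_phi tG Gt).

Lemma rho_E_dlt (u : V) : rhoV E (dlt gn.+1 u) = dlt gn.+1 u.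
Proof.
rewrite (rho_qeP_dlt hbeta size_beta t_phi tG Gt) ?leqnn //.
rewrite (_ : qeP _ = 1) ?rmorph1 //; apply: qe_ext => mu hmu; rewrite qeP_e mul1r.
by rewrite /ins /= take_oversize ?drop_oversize ?(wseq_size hmu) // splits_asE.
Qed.

Lemma rho_iL_dlt a (u : V) : rhoV (iL a) (dlt gn.+1 u) = dlt gn.+1 (a *: u).
Proof.
have n0 : (1 <= gn.+1 <= gn.+1)%N by rewrite leqnn.
elim/qha_ind: a u => [d|nu|k|l|a b IHa IHb|a b IHa IHb] u.
- rewrite iL_const rhoM' endoM_app rho_E_dlt.
  exact: (rho_const_dlt hbeta size_beta t_phi tG Gt).
- rewrite iL_e (rho_e_dlt hbeta size_beta t_phi tG Gt) //.
  rewrite (_ : qeP _ = qe nu) //; apply: qe_ext => mu hmu; rewrite qeP_e qee.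
  rewrite /ins /= take_oversize ?drop_oversize ?(wseq_size hmu) //.
  by rewrite !cats1 eqseq_rcons eqxx andbT eq_sym; case: eqP => [->|].
- have [hk|hk] := boolP (1 <= k <= gn)%N; last first.
    by rewrite qx_out // iL0 (rho0 hbeta size_beta t_phi tG Gt) scale0r dlt0.
  rewrite iL_x // rhoM' endoM_app rho_E_dlt (rho_x_dlt hbeta size_beta t_phi tG Gt) //; last by lia.
  by rewrite xop_lt //; lia.
- have [hl|hl] := boolP (1 <= l < gn)%N; last first.
    by rewrite qtau_out // iL0 (rho0 hbeta size_beta t_phi tG Gt) scale0r dlt0.
  rewrite iL_tau // rhoM' endoM_app rho_E_dlt (rho_tau_dlt hbeta size_beta t_phi tG Gt) //; lia.
- by rewrite iLD rhoD' endoD_app IHa IHb scalerDl dltD.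
- by rewrite iLM rhoM' endoM_app IHb IHa scalerA.
Qed.

(** A map out of an induced module is given by the image of N and <i>_z. On vectors supported at the
    last position [iL] acts as R(gamma) does and x_n acts as t, so m with x_1^k goes to m t^k. *)
Definition ptW_fun (r : R) (m : N) (y : Li) : W :=
  rhoV (r * iR y) (dlt gn.+1 (laurent_monomial 0 m)).

Fact ptW_Dl m y : {morph (fun r => ptW_fun r m y) : r r' / r + r'}.
Proof. by move=> r r'; rewrite /ptW_fun mulrDl rhoD'. Qed.
Fact ptW_Dm r y : {morph (fun m => ptW_fun r m y) : m m' / m + m'}.
Proof. by move=> m m'; rewrite /ptW_fun laurent_monomialD dltD efunD. Qed.
Fact ptW_Dr r m : {morph ptW_fun r m : y y' / y + y'}.
Proof. by move=> y y'; rewrite /ptW_fun iRD mulrDr rhoD'. Qed.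
Fact ptW_B r a b m y : ptW_fun (r * (iL a * iR b)) m y = ptW_fun r (a *: m) (b *: y).
Proof.
rewrite /ptW_fun laurent_monomialZ -rho_iL_dlt -endoM_app -rhoM'.
have -> : iR (b *: y) = iR b * iR y by exact: iRM.
by rewrite -!mulrA -(iL_iR a y) (mulrA (iR b)) -(iL_iR a b) -!mulrA.
Qed.

Definition ptW : CV -> W := tlift ptW_fun.

Lemma ptW_pure r m y : ptW (tpure beta r m y) = ptW_fun r m y.
Proof. exact: (tlift_pure ptW_Dl ptW_Dm ptW_Dr ptW_B). Qed.
Lemma ptW_zmod : zmod_morphism ptW.
Proof. exact: (tlift_zmod ptW_Dl ptW_Dm ptW_Dr ptW_B). Qed.
HB.instance Definition _ := GRing.isZmodMorphism.Build CV W ptW ptW_zmod.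

Lemma ptW0 : ptW 0 = 0. Proof. exact: raddf0. Qed.
Lemma ptWD : {morph ptW : v w / v + w}. Proof. exact: raddfD. Qed.
Lemma ptWN : {morph ptW : v / - v}. Proof. exact: raddfN. Qed.

Lemma ptWZ a w : ptW (a *: w) = rhoV a (ptW w).
Proof.
elim/conv_ind: w => [|v w hv hw|v hv|r m y].
- by rewrite scaler0 ptW0 efun0.
- by rewrite scalerDr !ptWD hv hw efunD.
- by rewrite scalerN !ptWN hv efunN.
- by rewrite tpureZ !ptW_pure /ptW_fun -mulrA rhoM'.
Qed.

Lemma rho_iR_x1 k (u : V) : rhoV (iR (x1pow k)) (dlt gn.+1 u) =
  dlt gn.+1 (iter k tV u).
Proof.
elim: k u => [|k IHk] u; first by rewrite /x1pow expr0 iR1 rho_E_dlt.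
rewrite /x1pow exprSr iRM rhoM' endoM_app iR_x rhoM' endoM_app rho_E_dlt.
rewrite (rho_x_dlt hbeta size_beta t_phi tG Gt) ?size_beta ?leqnn //.
by rewrite xop_eq IHk -iterSr.
Qed.

Lemma iter_monomial k (m : N) :
  iter k tV (laurent_monomial 0 m) = laurent_monomial k m.
Proof. by elim: k => [|k IHk] //; rewrite iterS IHk laurent_monomialS. Qed.

Lemma ptW_gen a m k : (1 <= a <= n)%N ->
  ptW ((\prod_(a <= l < n) (qtau l : R)) *: pure m (x1pow k)) =
  @bW K I C D i beta gamma V tV GV a (laurent_monomial k m).
Proof.
move=> ha; rewrite ptWZ ptW_pure /ptW_fun mul1r rho_iR_x1 iter_monomial.
by rewrite /bW size_beta.
Qed.

(* The coefficient of tau_1 ... tau_(n-1), where x_1^k in <i> counts as z^k *)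
Definition pconv (w : CV) : N := laurent_ev z (ptW w 1%N).

Lemma pconv_zmod : zmod_morphism pconv.
Proof. by move=> v w; rewrite /pconv raddfB -[(_ - _) 1%N]/(_ - _) raddfB. Qed.
HB.instance Definition _ := GRing.isZmodMorphism.Build CV N pconv pconv_zmod.

Lemma pconv0 : pconv 0 = 0. Proof. exact: raddf0. Qed.
Lemma pconvB : {morph pconv : v w / v - w}. Proof. exact: raddfB. Qed.

Lemma pconv_dual b a m k : (1 <= a <= n)%N -> (1 <= b <= n)%N ->
  pconv ((\prod_(1 <= l < b) (qtau l : R)) *:
    ((\prod_(a <= l < n) (qtau l : R)) *: pure m (x1pow k))) =
  if a == b then iter k z m else 0.
Proof.
move=> ha hb; rewrite /pconv ptWZ ptW_gen //.
rewrite (dual_bases hbeta size_beta t_phi tG Gt) -?size_beta //.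
by case: eqP => _; rewrite ?laurent_ev_monomial ?raddf0.
Qed.

Lemma pconv_gen a m k : (1 <= a <= n)%N ->
  pconv ((\prod_(a <= l < n) (qtau l : R)) *: pure m (x1pow k)) =
  if a == 1%N then iter k z m else 0.
Proof.
move=> ha; have n1 : (1 <= 1 <= n)%N by rewrite size_beta.
by have := pconv_dual m k ha n1; rewrite big_geq // scale1r.
Qed.

(** When the special strand comes first, the shifted algebra acts on exactly the remaining strands;
    reading off the first entry is therefore R(gamma)-linear. *)
Lemma rho_shift a (w : W) : rhoV (shift_map a) w 1%N = a *: w 1%N.
Proof.
have n1 : (1 <= 1 <= gn.+1)%N by [].
have eiE (u : W) : rhoV (qei D i beta) u 1%N = u 1%N.
  rewrite (rho_qeP hbeta size_beta t_phi tG Gt) //.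
  rewrite (_ : qeP _ = 1) ?rmorph1 //; apply: qe_ext => mu hmu; rewrite qeP_e mul1r.
  by rewrite /ins /= take0 /starts_with /= eqxx.
elim/qha_ind: a w => [d|nu|k|l|a b IHa IHb|a b IHa IHb] w.
- rewrite shift_map_const // rhoM' endoM_app (rho_const_coord hbeta size_beta t_phi tG Gt) //.
  by rewrite eiE.
- rewrite shift_map_e // (rho_e_coord hbeta size_beta t_phi tG Gt) //.
  rewrite (_ : qeP _ = qe nu) //; apply: qe_ext => mu hmu; rewrite qeP_e qee.
  by rewrite /ins /= take0 drop0 eqseq_cons eqxx /= eq_sym; case: eqP => // ->.
- have [hk|hk] := boolP (1 <= k <= gn)%N; last first.
    by rewrite (@qx_out _ _ _ _ _ k) // shift_map0 (rho0 hbeta size_beta t_phi tG Gt) scale0r.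
  rewrite shift_map_x // ?size_beta; last by lia.
  rewrite rhoM' endoM_app (rho_x_coord hbeta size_beta t_phi tG Gt) //; last by lia.
  by rewrite (xop_gt size_beta); [rewrite eiE | lia].
- have [hl|hl] := boolP (1 <= l < gn)%N; last first.
    by rewrite (@qtau_out _ _ _ _ _ l) // shift_map0 (rho0 hbeta size_beta t_phi tG Gt) scale0r.
  rewrite shift_map_tau ?size_beta //; try lia.
  rewrite rhoM' endoM_app (rho_tau_lt hbeta size_beta t_phi tG Gt) //.
  by rewrite eiE.
- by rewrite shift_mapD rhoD' [LHS]/(rhoV _ w 1%N + rhoV _ w 1%N) IHa IHb scalerDl.
- by rewrite shift_mapM rhoM' endoM_app IHa IHb scalerA.
Qed.

Lemma rho_ei_coord (w : W) : rhoV (qei D i beta) w 1%N = w 1%N.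
Proof. by rewrite -shift_map1 rho_shift scale1r. Qed.

Lemma pconv_ei w : pconv (qei D i beta *: w) = pconv w.
Proof. by rewrite /pconv ptWZ rho_ei_coord. Qed.
Lemma pconv_shift a w : pconv (shift_map a *: w) = a *: pconv w.
Proof. by rewrite /pconv ptWZ rho_shift linearZ. Qed.
(** Checked on shuffle generators because the evaluation does not carry t to z on negative powers;
    the first entry of a generator is zero or a monomial m t^k with k nonnegative. *)
Lemma pconv_x1 w : pconv (qx 1 *: w) = z (pconv w).
Proof.
elim/conv_shuffle_ind: w => [|v w hv hw|a m k ha].
- by rewrite scaler0 pconv0 linear0.
- by rewrite scalerBr !pconvB hv hw linearB.
- rewrite pconv_gen // /pconv ptWZ (rho_x1_coord hbeta size_beta t_phi tG Gt) ptW_gen //.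
  rewrite (bW_coord hbeta size_beta t_phi tG Gt) -?size_beta //; last by rewrite size_beta.
  case: (ltngtP 1%N a) => ha1.
  - by rewrite efun0 !linear0.
  - by have := ha; lia.
  - by rewrite laurent_monomialS laurent_ev_monomial.
Qed.

Local Notation idLi := (idfun : Li -> Li).
Local Notation LiZ := (@Li_z K I C D i).

Definition coker_rel (w : CV) : CV := conv_map z idLi w - conv_map idfun LiZ w.
Fact coker_rel_linear : linear coker_rel.
Proof.
move=> a v w; rewrite /coker_rel.
have -> : conv_map z idLi (a *: v + w) = a *: conv_map z idLi v + conv_map z idLi w :> CV.
  exact: linearP.
have -> : conv_map idfun LiZ (a *: v + w) = a *: conv_map idfun LiZ v + conv_map idfun LiZ w :> CV.
  exact: linearP.
by rewrite scalerBr opprD addrACA.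
Qed.
HB.instance Definition _ := GRing.isLinear.Build R CV CV *:%R coker_rel coker_rel_linear.

(** On generators both terms of the difference have the same value: x_1^k over z m and x_1^(k+1)
    over m count as z^(k+1) m. *)
Lemma pconv_coker w : pconv (coker_rel w) = 0.
Proof.
elim/conv_shuffle_ind: w => [|v w hv hw|a m k ha].
- by rewrite linear0 pconv0.
- by rewrite linearB pconvB hv hw subrr.
- rewrite linearZ /= /coker_rel !conv_map_pure scalerBr pconvB pconv_gen //.
  apply/eqP; rewrite subr_eq0; apply/eqP.
  suff: (if a == 1%N then iter k z (z m) else 0) =
      pconv ((\prod_(a <= l < n) (qtau l : R)) *: pure m (x1pow k.+1)).
    by rewrite /x1pow exprSr.
  by rewrite pconv_gen // iterSr.
Qed.

Local Notation CL := (conv_Li i z).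
Local Notation toCL := (mod_proj (fun v : CV => exists u, v = coker_rel u) : CV -> CL).

Lemma pure_LiE v : pure_Li i z v = toCL (pure v (x1pow 0)).
Proof. by []. Qed.

Lemma toCLZ a v : toCL (a *: v) = a *: toCL v.
Proof. exact: linearZ. Qed.
Lemma toCLB v w : toCL (v - w) = toCL v - toCL w.
Proof. exact: raddfB. Qed.

Lemma toCL_surj (w : CL) : exists v, w = toCL v.
Proof. by elim/mod_projW: w => v; exists v. Qed.

Lemma coker_rel0 : coker_rel 0 = 0. Proof. exact: linear0. Qed.
Lemma coker_relB u w : coker_rel (u - w) = coker_rel u - coker_rel w.
Proof. exact: linearB. Qed.
Lemma coker_relZ a w : coker_rel (a *: w) = a *: coker_rel w.
Proof. exact: linearZ. Qed.

Lemma coker_span v : submodule_span (fun v : CV => exists u, v = coker_rel u) v ->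
  exists u, v = coker_rel u.
Proof.
elim=> [//||u w _ [u' ->] _ [w' ->]|a u _ [u' ->]].
- by exists 0; rewrite coker_rel0.
- by exists (u' - w'); rewrite coker_relB.
- by exists (a *: u'); rewrite coker_relZ.
Qed.

Lemma toCL_eq v w : toCL v = toCL w -> exists u, v - w = coker_rel u.
Proof. by move/mod_projP/coker_span. Qed.

Lemma toCL_coker u : toCL (coker_rel u) = 0.
Proof.
rewrite -(_ : toCL 0 = 0); last exact: raddf0.
by apply/mod_projP; rewrite subr0; apply: span_gen; exists u.
Qed.

Lemma toCL_x1pow m k : toCL (pure m (x1pow k)) = pure_Li i z (iter k z m).
Proof.
elim: k m => [|k IHk] m; first exact: pure_LiE.
rewrite iterSr -IHk; apply/eqP; rewrite eq_sym -subr_eq0 -toCLB; apply/eqP.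
rewrite -(toCL_coker (pure m (x1pow k))); congr (toCL _).
rewrite /coker_rel !conv_map_pure; congr (_ - _).
by rewrite /x1pow exprSr.
Qed.

Lemma conv_Li_ind (P : CL -> Prop) : P 0 -> (forall v w, P v -> P w -> P (v - w)) ->
    (forall a v, (1 <= a <= n)%N ->
       P ((\prod_(a <= l < n) (qtau l : R)) *: pure_Li i z v)) ->
  forall w, P w.
Proof.
move=> P0 PB Pgen w; have [v ->] := toCL_surj w.
elim/conv_shuffle_ind: v => [|u u' hu hu'|a m k ha].
- by rewrite (_ : toCL 0 = 0) //; exact: raddf0.
- by rewrite toCLB; apply: PB.
- by rewrite toCLZ toCL_x1pow; apply: Pgen.
Qed.

(** A preimage is chosen; [pprojE] shows that the choice does not matter. *)
Definition pproj (w : CL) : N := pconv (sval (cid (toCL_surj w))).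

Lemma pprojE v : pproj (toCL v) = pconv v.
Proof.
rewrite /pproj; case: cid => v' /= /toCL_eq[u huv].
by apply/eqP; rewrite eq_sym -subr_eq0 -pconvB huv pconv_coker.
Qed.

Lemma pproj_zmod : zmod_morphism pproj.
Proof.
move=> w w'; have [v ->] := toCL_surj w; have [v' ->] := toCL_surj w'.
by rewrite -toCLB !pprojE pconvB.
Qed.
HB.instance Definition _ := GRing.isZmodMorphism.Build CL N pproj pproj_zmod.
Lemma pproj0 : pproj 0 = 0. Proof. exact: raddf0. Qed.
Lemma pprojB : {morph pproj : v w / v - w}. Proof. exact: raddfB. Qed.
Lemma pprojD : {morph pproj : v w / v + w}. Proof. exact: raddfD. Qed.
Lemma pproj_sum T (s : seq T) (P : pred T) F :
  pproj (\sum_(j <- s | P j) F j) = \sum_(j <- s | P j) pproj (F j).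
Proof. exact: raddf_sum. Qed.

Lemma pproj_ei w : pproj (qei D i beta *: w) = pproj w.
Proof. by have [v ->] := toCL_surj w; rewrite -toCLZ !pprojE pconv_ei. Qed.
Lemma pproj_shift a w : pproj (shift_map a *: w) = a *: pproj w.
Proof. by have [v ->] := toCL_surj w; rewrite -toCLZ !pprojE pconv_shift. Qed.
Lemma pproj_x1 w : pproj (qx 1 *: w) = z (pproj w).
Proof. by have [v ->] := toCL_surj w; rewrite -toCLZ !pprojE pconv_x1. Qed.
Lemma pproj_dual b a v : (1 <= a <= n)%N -> (1 <= b <= n)%N ->
  pproj ((\prod_(1 <= l < b) (qtau l : R)) *:
    ((\prod_(a <= l < n) (qtau l : R)) *: pure_Li i z v)) = if a == b then v else 0.
Proof. by move=> ha hb; have := pconv_dual v 0 ha hb; rewrite -pprojE !toCLZ. Qed.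

Lemma pproj_gen a v : (1 <= a <= n)%N ->
  pproj ((\prod_(a <= l < n) (qtau l : R)) *: pure_Li i z v) =
  if a == 1%N then v else 0.
Proof. by move=> ha; have := pconv_gen v 0 ha; rewrite -pprojE toCLZ. Qed.

Lemma pure_LiB v w : pure_Li i z (v - w) = pure_Li i z v - pure_Li i z w.
Proof.
rewrite -toCLB; congr (toCL _).
by apply: (addIr (pure w (x1pow 0))); rewrite subrK -tpureDm subrK.
Qed.

(** Both sides are additive, and on a generator [pproj_dual] leaves a single summand. Hence an
    element is determined by its projections after tau_1 ... tau_(a-1), which is how equalities in
    this module are proved. *)
Lemma pproj_decomp w : w = \sum_(1 <= a < n.+1)
  (\prod_(a <= l < n) (qtau l : R)) *:
    pure_Li i z (pproj ((\prod_(1 <= l < a) (qtau l : R)) *: w)).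
Proof.
have pure_Li0 : pure_Li i z 0 = 0 by rewrite -(subrr 0) pure_LiB subrr.
elim/conv_Li_ind: w => [|v w hv hw|a v ha].
- by rewrite big1 // => a _; rewrite scaler0 raddf0 pure_Li0 scaler0.
- rewrite {1}hv {1}hw -sumrB; apply: eq_bigr => a _.
  by rewrite -scalerBr -pure_LiB -raddfB -scalerBr.
- rewrite (bigD1_seq a) ?mem_index_iota ?iota_uniq //= pproj_dual // eqxx.
  rewrite [X in _ + X]big1_seq ?addr0 // => b /andP[ba]; rewrite mem_index_iota => hb.
  by move: ba; rewrite eq_sym => /negbTE ba; rewrite pproj_dual // ba pure_Li0 scaler0.
Qed.

Definition Ei_pproj (u : Ei i CL) : N := pproj (Ei_val u).
Fact Ei_pproj_linear : linear Ei_pproj.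
Proof.
move=> a u v; rewrite /Ei_pproj [Ei_val _]/(shift_map a *: Ei_val u + Ei_val v).
by rewrite raddfD /= pproj_shift.
Qed.
HB.instance Definition _ := GRing.isLinear.Build A (Ei i CL) N *:%R Ei_pproj Ei_pproj_linear.
Definition Ei_pproj_hom : {linear Ei i CL -> N} := Ei_pproj.

Lemma Ei_pproj_Er w : Ei_pproj (Er i w) = pproj w.
Proof. by rewrite /Ei_pproj Er_val pproj_ei. Qed.

Lemma shuffle_projection_Ei_pproj : shuffle_projection i z Ei_pproj.
Proof.
have n1 : (1 <= 1 <= n)%N by rewrite size_beta.
split=> [v|a v ha]; rewrite Ei_pproj_Er pproj_gen ?eqxx //; last by lia.
by case: eqP => // a1; lia.
Qed.

Lemma ErB (M : lmodType R) (u v : M) : Er i (u - v) = Er i u - Er i v.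
Proof. by apply: val_inj; rewrite /= scalerBr. Qed.

Lemma shuffle_projection_unique (p' : {linear Ei i CL -> N}) :
  shuffle_projection i z p' -> p' =1 Ei_pproj.
Proof.
move=> [h1 h2] u; rewrite -(ErK u); elim/conv_Li_ind: (Ei_val u) => [|v w hv hw|a v ha].
- have -> : Er i 0 = 0 :> Ei i CL by rewrite -(subrr 0) ErB subrr.
  by rewrite !linear0.
- by rewrite ErB !linearB hv hw.
- have [a1 s2] := shuffle_projection_Ei_pproj.
  have [->|ne] := eqVneq a 1%N; first by rewrite h1 a1.
  by rewrite h2 ?s2 //; lia.
Qed.
End ShuffleProjection.

(** * The map J *)

Section StrandMoves.
Variables (K : fieldType) (I : choiceType) (C : cartan_datum I).
Variables (D : qh_datum K C) (beta : {mset I}).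
Local Notation R := (qha D beta).

(** The product of crossings carries the strand of colour k over all of s to the first position. *)
Lemma qtau_up_qe (s t : seq I) k :
  \prod_(1 <= l < (size s).+1) qtau l * qe (s ++ k :: t) =
  qe (k :: s ++ t) * \prod_(1 <= l < (size s).+1) qtau l :> R.
Proof.
elim/last_ind: s t => [|s j IHs] t; first by rewrite big_geq // mul1r mulr1.
rewrite size_rcons big_nat_recr //= -!cats1 -!catA /=.
by rewrite -mulrA qte !mulrA IHs.
Qed.

Lemma qtau_up_deg (s t : seq I) k :
  qha_deg (- \sum_(j <- s) root_form C j k)
    (\prod_(1 <= l < (size s).+1) qtau l * qe (s ++ k :: t) : R).
Proof.
elim/last_ind: s t => [|s j IHs] t.
  by rewrite big_geq // mul1r big_nil oppr0; exact: qdeg_e.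
rewrite size_rcons big_nat_recr //= -!cats1 big_cat big_seq1 opprD -!catA /=.
(* The idempotent of the intermediate word is inserted so that each crossing becomes a homogeneous
   generator of known degree. *)
rewrite (_ : _ * _ * _ = (\prod_(1 <= l < (size s).+1) qtau l * qe (s ++ k :: j :: t)) *
   (qtau (size s).+1 * qe (s ++ [:: j, k & t]))).
  by apply: qdeg_mul; [exact: IHs | exact: qdeg_tau].
by rewrite qte -[RHS]mulrA (mulrA (qe _)) qee eqxx -qte mulrA.
Qed.

Lemma qtau_down_qe (s t : seq I) k m : (size s + size t).+1 = m ->
  \prod_((size s).+1 <= l < m) qtau l * qe (s ++ t ++ [:: k]) =
  qe (s ++ k :: t) * \prod_((size s).+1 <= l < m) qtau l :> R.
Proof.
elim: t s => [|j t IHt] s hm.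
  by rewrite big_geq ?mul1r ?mulr1 // -hm addn0.
rewrite big_ltn; last by rewrite -hm /=; lia.
have := IHt (rcons s j); rewrite size_rcons -cats1 -!catA /= => IH.
rewrite -mulrA IH ?mulrA ?qte // -hm /=; lia.
Qed.

Lemma qtau_down_deg (s t : seq I) k m : (size s + size t).+1 = m ->
  qha_deg (- \sum_(j <- t) root_form C j k)
    (\prod_((size s).+1 <= l < m) qtau l * qe (s ++ t ++ [:: k]) : R).
Proof.
elim: t s => [|j t IHt] s hm.
  rewrite big_geq ?mul1r ?big_nil ?oppr0; [exact: qdeg_e | by rewrite -hm addn0].
have hm' : (size (rcons s j) + size t).+1 = m by rewrite size_rcons -hm /=; lia.
rewrite big_ltn; last by rewrite -hm /=; lia.
have := IHt _ hm'; have := qtau_down_qe k hm'.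
rewrite size_rcons -cats1 -!catA /= => hq hd.
rewrite big_cons opprD -mulrA.
rewrite (_ : _ * _ = (qtau (size s).+1 * qe (s ++ [:: j, k & t])) *
   (\prod_((size s).+2 <= l < m) qtau l * qe (s ++ j :: (t ++ [:: k])))).
  by apply: qdeg_mul; [exact: qdeg_tau | exact: hd].
by rewrite hq -!mulrA; congr (_ * _); rewrite mulrA qee eqxx.
Qed.

End StrandMoves.

(** * The bijection r and the colour of the first strand *)

Section RestrictionMap.
Variables (K : fieldType) (I : choiceType) (C : cartan_datum I).
Variables (D : qh_datum K C) (i : I) (beta : {mset I}) (M : lmodType (qha D beta)).
Local Notation R := (qha D beta).
Local Notation n := (size beta).
Local Notation up a := (\prod_(1 <= l < a) (qtau l : R)).

Lemma ErD (V : lmodType R) (u v : V) : Er i (u + v) = Er i u + Er i v.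
Proof. by apply: val_inj; rewrite /= scalerDr. Qed.
Lemma Er0 (V : lmodType R) : Er i (0 : V) = 0.
Proof. by apply: val_inj; rewrite /= scaler0. Qed.
Lemma Er_qei (V : lmodType R) (u : V) : Er i (qei D i beta *: u) = Er i u.
Proof. by apply: val_inj; rewrite /= scalerA qeP_idem. Qed.
Lemma Er_x1 (V : lmodType R) (u : V) : Ei_z i V (Er i u) = Er i (qx 1 *: u).
Proof. by apply: val_inj; rewrite /= !scalerA -mulrA -qePx mulrA qeP_idem. Qed.
Lemma Er_shift (V : lmodType R) a (u : V) : a *: Er i u = Er i (shift_map a *: u).
Proof. by apply: val_inj; rewrite /= !scalerA shift_mapr shift_mapl. Qed.

Lemma qei_qe (nu : seq I) :
  qei D i beta * qe nu = if starts_with i nu then qe nu else 0.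
Proof. exact: qeP_e. Qed.

(** After the crossings the first letter is nu_a, so e(i, * ) kills the vector. This removes the
    condition nu_a = i from the formula for J. *)
Lemma Er_up_neq nu a (u : M) : seq_mset nu = beta -> (1 <= a <= n)%N ->
  nth i nu a.-1 != i -> Er i (up a *: (qe nu *: u)) = 0.
Proof.
move=> hnu ha; have sz := wseq_size hnu.
rewrite -(cat_take_drop a.-1 nu).
have ss : size (take a.-1 nu) = a.-1 by rewrite size_takel ?sz //; lia.
have := size_drop a.-1 nu; case: (drop a.-1 nu) => [|k t] /= sd; first by lia.
rewrite nth_cat ss ltnn subnn /= => ki.
move: (take a.-1 nu) ss => s ss; rewrite scalerA (_ : a = (size s).+1); last by lia.
rewrite qtau_up_qe -Er_qei scalerA mulrA qei_qe.
rewrite (_ : starts_with _ _ = false); last by apply/negbTE; apply: contra ki => /eqP[->].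
by rewrite mul0r scale0r Er0.
Qed.

End RestrictionMap.

(** * Linearity of J and its composition with the projection *)

Section MapJ.
Variables (K : fieldType) (I : choiceType) (C : cartan_datum I).
Variables (D : qh_datum K C) (i : I) (beta : {mset I}) (M : lmodType (qha D beta)).
Hypothesis hi : i \in beta.
Local Notation R := (qha D beta).
Local Notation n := (size beta).
Local Notation up a := (\prod_(1 <= l < a) (qtau l : R)).
Local Notation down a := (\prod_(a <= l < n) (qtau l : R)).
Local Notation pure := (pure_Li i (Ei_z i M)).
Local Notation J := (J_map i M).

(** Terms with nu_a different from i may be added since they vanish; the idempotents then sum to 1
    and the formula no longer depends on a decomposition of u. *)
Lemma J_mapE (u : M) :
  J u = \sum_(1 <= a < n.+1) down a *: pure (Er i (up a *: u)).
Proof.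
have pD v w : pure (v + w) = pure v + pure w.
  have pN x : pure (- x) = - pure x.
    by rewrite -sub0r pure_LiB -(subrr x) pure_LiB subrr sub0r.
  by rewrite -[w]opprK pure_LiB pN !opprK.
have p0 : pure 0 = 0 by rewrite -(subrr 0) pure_LiB subrr.
rewrite /J_map; under eq_bigr => nu _ do rewrite big_mkcond.
rewrite exchange_big; apply: eq_big_nat => a ha.
have {2}-> : u = \sum_(nu <- wseqs beta) qe nu *: u.
  by rewrite -scaler_suml qe_sum scale1r.
rewrite scaler_sumr.
rewrite (big_morph (Er i) (@ErD _ _ _ _ _ _ M) (Er0 i M)) (big_morph pure pD p0) scaler_sumr.
apply: eq_big_seq => nu; rewrite mem_wseqs => /eqP hnu.
by case: ifP => // /negbT ne; rewrite Er_up_neq // p0 scaler0.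
Qed.

Lemma pproj_J (x : R) u : pproj (x *: J u) = Er i (x *: u).
Proof.
rewrite -(pproj_ei hi) scalerA -[RHS]Er_qei [in RHS]scalerA.
apply: (qei_ind hi (P := fun y => pproj (y *: J u) = Er i (y *: u))) => [|a b ha hb|a ha|a b hb|c hc].
- by rewrite !scale0r (pproj0 hi) Er0.
- by rewrite !scalerBl (pprojB hi) ha hb ErB.
- by rewrite -!scalerA (pproj_x1 hi) ha; exact: Er_x1.
- by rewrite -!scalerA (pproj_shift hi) hb Er_shift.
(* By duality only the summand a = c survives the projection. *)
rewrite J_mapE scaler_sumr (pproj_sum hi) (bigD1_seq c) ?mem_index_iota ?iota_uniq //=.
rewrite (pproj_dual hi) // eqxx [X in _ + X]big1_seq ?addr0 // => a /andP[/negbTE ac].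
by rewrite mem_index_iota => ha; rewrite (pproj_dual hi) // ac.
Qed.

(** By [pproj_J] both sides have the same projections after each tau_1 ... tau_(a-1), and
    [pproj_decomp] recovers an element from these. *)
Lemma J_linear : linear J.
Proof.
move=> x u v; rewrite [LHS](pproj_decomp hi) [RHS](pproj_decomp hi).
apply: eq_bigr => a _; congr (_ *: pure _).
by rewrite pproj_J !scalerDr (pprojD hi) !scalerA !pproj_J ErD.
Qed.

Lemma Ei_pproj_J (u : Ei i M) : Ei_pproj (Ei_map i J u) = u.
Proof. by rewrite (Ei_pproj_Er hi) -[J _]scale1r pproj_J scale1r ErK. Qed.

End MapJ.

(** * The degree of J *)

Section Degree.
Variables (K : fieldType) (I : choiceType) (C : cartan_datum I).
Variables (D : qh_datum K C) (i : I) (beta : {mset I}) (M : lmodType (qha D beta)).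
Local Notation R := (qha D beta).
Local Notation n := (size beta).
Local Notation z := (Ei_z i M).
Local Notation CL := (conv_Li i z).
Local Notation up a := (\prod_(1 <= l < a) (qtau l : R)).
Local Notation down a := (\prod_(a <= l < n) (qtau l : R)).
Variable G : int -> M -> Prop.
Hypothesis HG : grading G.
Local Notation CLdeg := (conv_Li_deg (Ei_deg (i := i) G)).

Lemma conv_Li_deg0 d : CLdeg d (0 : CL).
Proof. by exists 0; [exact: cdeg_0 | rewrite raddf0]. Qed.

Lemma conv_Li_degD d (v w : CL) : CLdeg d v -> CLdeg d w -> CLdeg d (v + w).
Proof.
move=> [v' hv ->] [w' hw ->]; exists (v' + w'); first exact: cdeg_add.
by rewrite raddfD.
Qed.

Lemma Li_gen_deg : Li_deg 0 (Li_gen D i).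
Proof.
rewrite /Li_deg /Li_gen -(qe_sum D [mset i]).
by elim/big_rec: _ => [|nu a _ ha]; [exact: qdeg_0 | apply: qdeg_add => //; exact: qdeg_e].
Qed.

Lemma conv_Li_deg_summand s t d (u : M) : seq_mset (s ++ i :: t) = beta -> G d u ->
  CLdeg (d + (root_form_wt C i beta + root_form C i i))
    (down (size s).+1 *:
      pure_Li i z (Er i (up (size s).+1 *: (qe (s ++ i :: t) *: u)))).
Proof.
move=> hb Gu.
have pb : perm_eq (i :: s ++ t) (beta : seq I).
  rewrite -hb (perm_trans _ (_ : perm_eq (s ++ i :: t) _)) // 1?perm_sym ?perm_eq_seq_mset //.
  exact/permPl/(perm_catCA s [:: i] t).
have hi : i \in beta by rewrite -(perm_mem pb) mem_head.
have hmu : seq_mset (s ++ t) = beta `\ i.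
  apply/eqP; rewrite -(msetD1_mem hi) -[X in _ == X]hb; apply/eqP/eq_seq_msetP.
  by rewrite (perm_trans pb) // -hb perm_eq_seq_mset.
have szn : (size s + size t).+1 = n.
  by rewrite -(perm_size pb) /= size_cat.
set w := up _ *: _.
have ew : qe (i :: s ++ t) *: w = w.
  rewrite /w [up _ *: _]scalerA qtau_up_qe.
  by rewrite !scalerA mulrA qee eqxx.
have eE : Er i w = qe (s ++ t) *: Er i w by rewrite Er_shift (shift_map_e D hi) ew.
(* The strand of colour i crosses every letter of s on its way up and every letter of t on the way
   down, that is, all of beta except one i. *)
have degE : d + (root_form_wt C i beta + root_form C i i) =
    - (\sum_(j <- t) root_form C j i) + (- (\sum_(j <- s) root_form C j i) + d) + 0.
  have -> : root_form_wt C i beta = - \sum_(j <- i :: s ++ t) root_form C j i.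
    by rewrite (perm_big _ pb); congr (- _); apply: eq_bigr => j _; rewrite form_sym.
  rewrite big_cons big_cat /= addr0.
  by move: (\sum_(j <- s) _) (\sum_(j <- t) _) => x y; lia.
(* The factor 1 of the pure tensor is replaced by the idempotent of the current word, so that the
   product of crossings is applied to a word and has a degree. *)
have bal : pure_Li i z (Er i w) =
    mod_proj _ (qe ((s ++ t) ++ [:: i]) *: tpure beta (1 : R) (Er i w) (Li_gen D i)).
  rewrite [in LHS]eE (pureZl (Er i w) _ (a' := qe (s ++ t))) //.
  by rewrite (iL_e D hi) e_qeP splits_asE.
rewrite degE; exists (tpure beta (down (size s).+1 * qe ((s ++ t) ++ [:: i]) : R) (Er i w) (Li_gen D i)).
  apply: cdeg_pure; last exact: Li_gen_deg.
  - by rewrite -catA; apply: qtau_down_deg.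
  - rewrite /Ei_deg Er_val -ew scalerA qei_qe /starts_with /= eqxx ew /w scalerA.
    by apply: (grading_scale HG) => //; exact: qtau_up_deg.
by rewrite bal -linearZ /= !tpureZ mulr1.
Qed.

(** The defining formula is used rather than [J_mapE]: each of its summands comes with a word having
    letter i at position a, which gives the degrees of its crossings. *)
Lemma J_map_deg d u : G d u ->
  CLdeg (d + (root_form_wt C i beta + root_form C i i)) (J_map i M u).
Proof.
move=> Gu; rewrite /J_map big_seq; elim/big_rec: _ => [|nu w]; first exact: conv_Li_deg0.
rewrite mem_wseqs => /eqP hnu hw; apply: conv_Li_degD => // {w hw}.
rewrite big_nat_cond; elim/big_rec: _ => [|a w /andP[ha /eqP nui] hw]; first exact: conv_Li_deg0.
apply: conv_Li_degD => // {w hw}.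
have sz := wseq_size hnu; move: hnu nui; rewrite -(cat_take_drop a.-1 nu).
have ss : size (take a.-1 nu) = a.-1 by rewrite size_takel ?sz //; lia.
have := size_drop a.-1 nu; case: (drop a.-1 nu) => [|k t] /= sd; first by lia.
move: (take a.-1 nu) ss => s ss.
rewrite nth_cat ss ltnn subnn /= (_ : a = (size s).+1); last by lia.
by move=> hnu ki; move: hnu; rewrite ki => hnu; apply: conv_Li_deg_summand.
Qed.

End Degree.

(** * The case where i does not occur in beta *)

Section EmptyRestriction.
Variables (K : fieldType) (I : choiceType) (C : cartan_datum I).
Variables (D : qh_datum K C) (i : I) (beta : {mset I}) (M : lmodType (qha D beta)).
Hypothesis hi : i \notin beta.

(** No word of beta starts with i, so e(i, * ) = 0. *)
Lemma Ei_trivial (u : Ei i M) : u = 0.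
Proof.
apply: val_inj; rewrite -[LHS]Ei_valK (_ : qei D i beta = 0) ?scale0r //.
apply: qe_ext => nu hnu; rewrite qei_qe mul0r; case: ifP => // /eqP h.
case/negP: hi; case: nu hnu h => [|j nu] //= hnu [ji].
by rewrite -hnu (perm_mem (perm_eq_seq_mset _)) ji mem_head.
Qed.

Lemma J_map_trivial u : J_map i M u = 0.
Proof.
rewrite /J_map big1_seq // => nu /andP[_]; rewrite mem_wseqs => /eqP hnu.
rewrite big_nat_cond big1 // => a /andP[ha /eqP nui]; case/negP: hi.
have sz := wseq_size hnu.
have : i \in nu by rewrite -nui mem_nth // sz; lia.
by rewrite -hnu (perm_mem (perm_eq_seq_mset nu)).
Qed.

End EmptyRestriction.

Theorem theorem5p3 (K : fieldType) (I : choiceType) (C : cartan_datum I)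
    (D : qh_datum K C) (i : I) (beta : {mset I}) (M : lmodType (qha D beta)) :
  (* (i) *)
  (linear (J_map i M)
   /\ (forall G : int -> M -> Prop, grading G ->
         forall (d : int) (u : M), G d u ->
           conv_Li_deg (Ei_deg (i := i) G)
             (d + (root_form_wt C i beta + root_form C i i)) (J_map i M u)))
  (* (ii) *)
  /\ (exists p : {linear Ei i (conv_Li i (Ei_z i M)) -> Ei i M},
        [/\ shuffle_projection i (Ei_z i M) p,
            forall p' : {linear Ei i (conv_Li i (Ei_z i M)) -> Ei i M},
              shuffle_projection i (Ei_z i M) p' -> p' =1 p
          & forall u : Ei i M, p (Ei_map i (J_map i M) u) = u]).
Proof.
split; first split.
- have [hi|hi] := boolP (i \in beta); first exact: J_linear.
  by move=> a u v; rewrite !J_map_trivial // scaler0 addr0.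
- by move=> G HG d u; apply: J_map_deg.
(* If i is absent, removing it leaves beta unchanged and the count of strands behind the
   construction of p fails; but then the target is zero and the zero map serves as p. *)
have [hi|hi] := boolP (i \in beta); last first.
  have tr (x y : Ei i M) : x = y by rewrite (Ei_trivial hi x) (Ei_trivial hi y).
  by exists \0; split=> [|p' _ u|u]; [split=> *|..]; apply: tr.
exists (@Ei_pproj_hom K I C D i beta hi (Ei i M) (Ei_z i M)); split.
- exact: (shuffle_projection_Ei_pproj hi).
- exact: (shuffle_projection_unique hi).
- exact: (Ei_pproj_J hi).
Qed.
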